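(* Let $d\ge1$, let $f\in L^2[0,1]^d$ be real-valued, and let $\boldsymbol{x}_0,\boldsymbol{x}_1,\dots$ be the points of the $d$-dimensional Halton sequence randomized either with a nested uniform scramble or with a random linear scramble with digital shift. Then $$\lim_{n\to\infty}n\cdot\mathrm{var}\Bigl(\frac1n\sum_{i=0}^{n-1}f(\boldsymbol{x}_i)\Bigr)=0.$$
   Context: Halton points: for $j\in\{1,\dots,d\}$, $b_j$ is the $j$-th prime ($b_1=2,b_2=3,b_3=5,\dots$). For an integer $i\ge0$ write $i=\sum_{\ell\ge1}a_{ij\ell}b_j^{\ell-1}$ with base-$b_j$ digits $a_{ij\ell}\in\{0,\dots,b_j-1\}$; the Halton points are $\boldsymbol{a}_i=(a_{i1},\dots,a_{id})\in[0,1)^d$, $i\ge0$, with $a_{ij}=\sum_{\ell\ge1}a_{ij\ell}b_j^{-\ell}$. Scrambling: each randomization produces $\boldsymbol{x}_i=(x_{i1},\dots,x_{id})$ with $x_{ij}=\sum_{\ell\ge1}x_{ij\ell}b_j^{-\ell}$, $x_{ij\ell}\in\{0,\dots,b_j-1\}$, where the randomizations of the $d$ different coordinates $j$ are statistically independent, and the same randomization of coordinate $j$ is applied to all points $i$. Nested uniform scramble (base $b_j$, coordinate $j$): for every $\ell\ge1$ and every digit string $(c_1,\dots,c_{\ell-1})\in\{0,\dots,b_j-1\}^{\ell-1}$ there is a uniformly random permutation $\pi_{j;c_1,\dots,c_{\ell-1}}$ of $\{0,\dots,b_j-1\}$, all these permutations being mutually independent, and $x_{ij\ell}=\pi_{j;a_{ij1},\dots,a_{ij,\ell-1}}(a_{ij\ell})$.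 Random linear scramble with digital shift (base $b_j$, coordinate $j$): $x_{ij\ell}=\bigl(\sum_{\ell'=1}^{\ell}L^{(j)}_{\ell\ell'}a_{ij\ell'}+c^{(j)}_\ell\bigr)\bmod b_j$, where the $L^{(j)}_{\ell\ell}$ are uniform on $\{1,\dots,b_j-1\}$, the $L^{(j)}_{\ell\ell'}$ for $\ell'<\ell$ are uniform on $\{0,\dots,b_j-1\}$, the $c^{(j)}_\ell$ are uniform on $\{0,\dots,b_j-1\}$, and all of these random variables are mutually independent. Under either randomization each $\boldsymbol{x}_i$ is uniformly distributed on $[0,1]^d$. *)

(* Defs.v *)
From HB Require Import structures.
From mathcomp Require Import all_boot all_order all_algebra all_fingroup.
From mathcomp Require Import finmap.
From mathcomp Require Import all_classical all_reals all_analysis.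

Set Implicit Arguments.
Unset Strict Implicit.
Unset Printing Implicit Defensive.

Import Order.TTheory GRing.Theory Num.Theory.
Import numFieldNormedType.Exports.

Local Open Scope classical_set_scope.
Local Open Scope ring_scope.

Section Prime.
Local Open Scope nat_scope.

Lemma exists_next_prime (m : nat) : exists p : nat, (m < p) && prime p.
Proof. by have [p ltmp prp] := prime_above m; exists p; rewrite ltmp. Qed.

Definition next_prime (m : nat) : nat := ex_minn (exists_next_prime m).

(* Counted from 0: 2, 3, 5, 7, ... *)
Definition nth_prime (j : nat) : nat := iter j next_prime 2.

Lemma prime_nth_prime (j : nat) : prime (nth_prime j).
Proof.
by case: j => // j; rewrite /nth_prime/= /next_prime; case: ex_minnP => p /andP[].
Qed.

Lemma nth_prime_gt0 (j : nat) : 0 < nth_prime j.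
Proof. exact/prime_gt0/prime_nth_prime. Qed.

(* Coefficient of b ^ l (so l is counted from 0) in the base-b expansion of i,
   where b = nth_prime j. *)
Definition digit (j i l : nat) : 'I_(nth_prime j) :=
  Ordinal (ltn_pmod (i %/ nth_prime j ^ l) (nth_prime_gt0 j)).

Lemma base_expansion (b i : nat) : 1 < b ->
  i = (\sum_(l < i) (i %/ b ^ l) %% b * b ^ l).
Proof.
move=> b1; have H m : i = (\sum_(l < m) (i %/ b ^ l) %% b * b ^ l +
    i %/ b ^ m * b ^ m).
  elim: m => [|m IH]; first by rewrite big_ord0 expn0 muln1 divn1.
  rewrite big_ord_recr/= -addnA [LHS]IH; congr (_ + _).
  rewrite [X in (X * _) = _](divn_eq _ b) expnSr divnMA mulnDl addnC.
  by rewrite -mulnA [b * _]mulnC.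
rewrite [LHS](H i) [X in (_ + X)](_ : _ = 0) ?addn0//.
by rewrite divn_small// ltn_expl.
Qed.

Lemma digit_expansion (j i : nat) :
  i = (\sum_(l < i) digit j i l * nth_prime j ^ l).
Proof. exact/base_expansion/prime_gt1/prime_nth_prime. Qed.

End Prime.

(* The real number 0.u_0 u_1 u_2 ... in base b. *)
Definition radix_point (R : realType) (b : nat) (u : nat -> nat) : R :=
  limn (series (fun l => (u l)%:R / b%:R ^+ l.+1 : R)).

Section Cube.
Context {R : realType}.

Definition unit_cube (d : nat) : set (d.-tuple R) :=
  [set x | forall j : 'I_d, tnth x j \in `[0, 1]].

Definition lebesgue01 : set (measurableTypeR R) -> \bar R :=
  mrestr (@lebesgue_measure R) (measurable_itv `[0, 1]%R).

HB.instance Definition _ := Measure.on lebesgue01.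

Let lebesgue01_setT : lebesgue01 setT = 1%E.
Proof.
by rewrite /lebesgue01 /mrestr setTI lebesgue_measure_itv/= lte_fin ltr01 oppr0 adde0.
Qed.

HB.instance Definition _ :=
  Measure_isProbability.Build _ _ _ lebesgue01 lebesgue01_setT.

Definition tcons (n : nat)
    (x : measurableTypeR R * n.-tuple (measurableTypeR R)) :
  n.+1.-tuple (measurableTypeR R) := [the n.+1.-tuple _ of x.1 :: x.2].

Lemma measurable_tcons (n : nat) : measurable_fun [set: _] (@tcons n).
Proof. exact: measurable_cons. Qed.

HB.instance Definition _ (n : nat) :=
  isMeasurableFun.Build _ _ _ _ (@tcons n) (@measurable_tcons n).

(* d-dimensional Lebesgue measure restricted to the unit cube. *)
Fixpoint lebesgue_cube (d : nat) :
    probability (d.-tuple (measurableTypeR R)) R :=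
  match d with
  | 0 => \d_([tuple] : 0.-tuple (measurableTypeR R))
  | n.+1 => distribution (lebesgue01 \x lebesgue_cube n)%E (@tcons n)
  end.

End Cube.
Arguments unit_cube {R} d.
Arguments lebesgue01 R : clear implicits.
Arguments lebesgue_cube R d : clear implicits.

Lemma lebesgue_cube_box (R : realType) (d : nat)
    (A : 'I_d -> set (measurableTypeR R)) :
  (forall j, measurable (A j)) ->
  lebesgue_cube R d [set x | forall j, A j (tnth x j)] =
  (\prod_(j < d) lebesgue01 R (A j))%E.
Proof.
elim: d A => [|n IH] A mA.
  by rewrite big_ord0 /= diracE mem_set// => -[].
rewrite big_ord_recl -IH//= /distribution /pushforward.
rewrite -product_measure1E//; last first.
  rewrite (_ : [set x | _] = \bigcap_(j in [set: 'I_n])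
      (@tnth n (measurableTypeR R) ^~ j @^-1` A (lift ord0 j))).
    apply: fin_bigcap_measurable => // j _.
    by rewrite -[X in measurable X]setTI; apply: measurable_tnth.
  by apply/seteqP; split => [x h j _|x h j]; [exact: h|exact: (h j I)].
apply: congr1; apply/seteqP; split => [[x y]/= h|[x y]/= [h0 h] j].
  split; first exact: (h ord0).
  by move=> j; have := h (lift ord0 j); rewrite tnthS.
case: (unliftP ord0 j) => [k ->|->//].
by rewrite tnthS.
Qed.

(* Random variables take values in finite types with the discrete
   sigma-algebra. Measurability is part of uniform_on, which is why
   mutually_independent does not ask for it. *)
Section Random.
Context {dO : measure_display} {Om : measurableType dO} {R : realType}.
Variable P : probability Om R.

Definition uniform_on (T : finType) (X : Om -> T) (S : {set T}) : Prop :=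
  forall v : T, measurable (X @^-1` [set v]) /\
    P (X @^-1` [set v]) = (if v \in S then #|S|%:R^-1 else 0)%:E.

Definition mutually_independent (I : choiceType) (T : I -> finType)
    (X : forall k : I, Om -> T k) : Prop :=
  forall (J : {fset I}) (A : forall k : I, set (T k)),
    P (\bigcap_(k in [set` J]) X k @^-1` A k) =
    (\prod_(k <- J) P (X k @^-1` A k))%E.

Variable d : nat.

(* pi j c is the permutation attached to the digit string c in coordinate j;
   the independence is joint over coordinates and strings. *)
Definition nested_uniform_permutations
    (pi : forall j : 'I_d, seq 'I_(nth_prime j) ->
      Om -> {perm 'I_(nth_prime j)}) : Prop :=
  (forall j c, uniform_on (pi j c) [set: {perm 'I_(nth_prime j)}]%SET) /\
  mutually_independent
    (fun k : {j : 'I_d & seq 'I_(nth_prime j)} => pi (tag k) (tagged k)).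

Definition nested_uniform_halton (x : nat -> Om -> d.-tuple R) : Prop :=
  exists2 pi, nested_uniform_permutations pi &
    forall i w, x i w = [tuple radix_point R (nth_prime j) (fun l =>
      pi j (mkseq (digit j i) l) w (digit j i l)) | j < d].

(* Row l (counted from 0) of the lower triangular matrix of coordinate j has the
   entries L j l l' with l' : 'I_l.+1; the diagonal one is l' = ord_max. *)
Definition linear_shift_family
    (L : forall j : 'I_d, forall l : nat, 'I_l.+1 -> Om -> 'I_(nth_prime j))
    (c : forall j : 'I_d, nat -> Om -> 'I_(nth_prime j))
    (k : 'I_d * ({l : nat & 'I_l.+1} + nat)) : Om -> 'I_(nth_prime k.1) :=
  match k.2 with
  | inl r => L k.1 (tag r) (tagged r)
  | inr l => c k.1 l
  end.

Definition linear_shift_coefficients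
    (L : forall j : 'I_d, forall l : nat, 'I_l.+1 -> Om -> 'I_(nth_prime j))
    (c : forall j : 'I_d, nat -> Om -> 'I_(nth_prime j)) : Prop :=
  [/\ forall j l, uniform_on (L j l ord_max)
        [set v : 'I_(nth_prime j) | 0 < val v]%N%SET,
      forall j l (l' : 'I_l.+1), (l' < l)%N ->
        uniform_on (L j l l') [set: 'I_(nth_prime j)]%SET,
      forall j l, uniform_on (c j l) [set: 'I_(nth_prime j)]%SET &
      mutually_independent (linear_shift_family L c)].

Definition linear_shift_halton (x : nat -> Om -> d.-tuple R) : Prop :=
  exists L c, linear_shift_coefficients L c /\
    forall i w, x i w = [tuple radix_point R (nth_prime j) (fun l =>
      (\sum_(l' < l.+1) L j l l' w * digit j i l' + c j l w) %% nth_prime j)%N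
      | j < d].

End Random.

(* Main.v *)
(** The joint law of the first [K] digits of the scrambled points [i] and [i']
    depends only on which of the powers [b_j ^ l], [l <= K], divide [i - i'], and
    it is the same for both scrambles. So the covariance of a centred function
    of the first [K] digits is a function [G] of [i - i'] modulo
    [N = \prod_j b_j ^ K] that is positive semidefinite and invariant under
    multiplication by units. Averaging over the units, the Fourier expansion of
    [G] bounds the variance of a sum of [n] terms by [n * (N / totient N) * G 0],
    and [N / totient N = \prod_j b_j / (b_j - 1)] does not depend on [K].
    Moreover a sum over a full period of [N] points is constant almost surely,
    so for a fixed [K] the variance of the sum is bounded in [n]. Approximating
    [f] in L^2 by a function of finitely many digits, the second bound takes
    care of the approximation and the first one of the error. *)
Require Import Defs.
From HB Require Import structures.
From mathcomp Require Import all_boot all_order all_algebra all_fingroup.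
From mathcomp Require Import finmap.
From mathcomp Require Import all_classical all_reals all_analysis.
From mathcomp Require Import measurable_realfun.
From mathcomp Require Import ring lra zify.
Set Implicit Arguments.
Unset Strict Implicit.
Unset Printing Implicit Defensive.
Import Order.TTheory GRing.Theory Num.Theory.
Import numFieldNormedType.Exports.
Local Open Scope classical_set_scope.
Local Open Scope ring_scope.

(** * Positive definite functions on Z/N *)

(** A single frequency may contribute [n ^ 2] to the variance: [n] consecutive values of a slowly
    turning character do not cancel. Positivity of the Fourier weights is therefore not enough.
    Invariance under units lets the character of [h] be replaced by its average over all [h * u],
    and only the total over the units is of order [n * N]; dividing by their number produces
    [N / totient N]. That this factor is free of [K] is essential: the precision required from the
    approximation of [f], hence the number of digits, grows with [n], and a linear bound with a
    constant depending on [K] would be of no use. The other difficulty is that the scramble only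
    gives laws of finitely many digits, whereas [f] is any square-integrable function.
    Approximations are therefore stated for all maps into the cube with independent uniform digits
    at once ([digit_frame]), the identity of the cube being one of them. The uniform distribution of
    each scrambled point is then a consequence, and one function of digits approximates [f] equally
    well at every point. *)

Section Fourier.
Variables (R : realType) (p : nat).
(** The modulus has the form [p.+2] so that ['I_p.+2] carries its ring structure. *)
Local Notation N := p.+2.
Local Notation Z := 'I_p.+2.

(** Real and imaginary parts of the additive character of frequency 1 on Z/N. Real arithmetic is
    enough because [G] is even, [-1] being a unit. *)
Let cs (k : Z) : R := cos (pi *+ 2 * k%:R / N%:R).
Let sn (k : Z) : R := sin (pi *+ 2 * k%:R / N%:R).

Lemma angle_mod (T : R -> R) (k : nat) : periodic T (pi *+ 2) ->
  T (pi *+ 2 * (k %% N)%:R / N%:R) = T (pi *+ 2 * k%:R / N%:R).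
Proof.
move=> perT; rewrite {2}(divn_eq k N) natrD natrM.
have -> : pi *+ 2 * ((k %/ N)%:R * N%:R + (k %% N)%:R) / N%:R =
  pi *+ 2 * (k %% N)%:R / N%:R + (pi *+ 2) *+ (k %/ N) :> R.
  rewrite -[X in _ = _ + X]mulr_natr.
  have N0 : N%:R != 0 :> R by rewrite pnatr_eq0.
  by rewrite mulrDr mulrDl addrC !mulrA mulfK.
by rewrite (periodicn perT).
Qed.

Let csD k l : cs (k + l) = cs k * cs l - sn k * sn l.
Proof.
rewrite /cs/= angle_mod; last exact: cosD2pi.
by rewrite natrD mulrDr mulrDl cosD.
Qed.

Let snD k l : sn (k + l) = sn k * cs l + cs k * sn l.
Proof.
rewrite /sn/= angle_mod; last exact: sinD2pi.
by rewrite natrD mulrDr mulrDl sinD.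
Qed.

Let cs0 : cs 0 = 1. Proof. by rewrite /cs mulr0 mul0r cos0. Qed.
Let sn0 : sn 0 = 0. Proof. by rewrite /sn mulr0 mul0r sin0. Qed.

(** The representative of [- k] is [N - k], so parity of the cosine does not apply directly. By the
    addition formulas the rotation of [- k] inverts that of [k], and the inverse of a rotation is
    its transpose. *)
Let csN k : cs (- k) = cs k.
Proof.
have h1 : cs (- k) * cs k - sn (- k) * sn k = 1 by rewrite -csD addNr.
have h2 : sn (- k) * cs k + cs (- k) * sn k = 0 by rewrite -snD addNr sn0.
have h3 : cs k ^+ 2 + sn k ^+ 2 = 1 by exact: cos2Dsin2.
transitivity (cs k * (cs (- k) * cs k - sn (- k) * sn k) +
    sn k * (sn (- k) * cs k + cs (- k) * sn k)); last by rewrite h1 h2; ring.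
by rewrite -[LHS]mulr1 -h3; ring.
Qed.

Let snN k : sn (- k) = - sn k.
Proof.
have h1 : cs (- k) * cs k - sn (- k) * sn k = 1 by rewrite -csD addNr.
have h2 : sn (- k) * cs k + cs (- k) * sn k = 0 by rewrite -snD addNr sn0.
have h3 : cs k ^+ 2 + sn k ^+ 2 = 1 by exact: cos2Dsin2.
rewrite csN in h1 h2; nra.
Qed.

Let csB k l : cs (k - l) = cs k * cs l + sn k * sn l.
Proof. by rewrite csD csN snN mulrN opprK. Qed.

Let cs_neq1 k : k != 0 -> cs k < 1.
Proof.
move=> k0; rewrite /cs.
have -> : pi *+ 2 * k%:R / N%:R = (pi * k%:R / N%:R) *+ 2 :> R.
  by rewrite -!mulrnAl.
rewrite cos_mulr2n cos2sin2.
suff : 0 < sin (pi * k%:R / N%:R) :> R by move=> ?; nra.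
apply: sin_gt0_pi.
have kp : (0 < k)%N by rewrite lt0n.
rewrite divr_gt0 ?mulr_gt0 ?pi_gt0 ?ltr0n//=.
by rewrite ltr_pdivrMr ?ltr0n// ltr_pM2l ?pi_gt0// ltr_nat.
Qed.

(** Shifting [h] by 1 permutes the terms and rotates the vector [(C, S)] by the angle of [k]. A
    vector fixed by a rotation other than the identity is zero. *)
Lemma sum_cs (k : Z) : \sum_(h : Z) cs (h * k) = if k == 0 then N%:R else 0.
Proof.
case: eqVneq => [->|k0].
  under eq_bigr do rewrite mulr0 cs0.
  by rewrite sumr_const card_ord.
have := cs_neq1 k0.
set C := \sum_h _; pose S := \sum_(h : Z) sn (h * k).
have HC : C = C * cs k - S * sn k.
  rewrite {1}/C (reindex_inj (addIr 1)) /= /S !mulr_suml -sumrB.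
  by apply: eq_bigr => h _; rewrite mulrDl mul1r csD.
have HS : S = S * cs k + C * sn k.
  rewrite {1}/S (reindex_inj (addIr 1)) /= !mulr_suml -big_split.
  by apply: eq_bigr => h _; rewrite mulrDl mul1r snD.
move: (cs k) (sn k) HC HS => c s HC HS c1.
have e1 : C * (1 - c) = - (S * s) by lra.
have e2 : S * (1 - c) = C * s by lra.
(* The factor is the determinant of the identity minus the rotation, positive since [c < 1]. *)
have e3 : C * ((1 - c) ^+ 2 + s ^+ 2) = 0.
  by rewrite mulrDr expr2 mulrA e1 mulNr mulrAC e2; ring.
move/eqP: e3; rewrite mulf_eq0 => /orP[/eqP//|/eqP]; nra.
Qed.

Variable G : Z -> R.
Hypothesis G_unit : forall u k : Z, u \is a GRing.unit -> G (u * k) = G k.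
Hypothesis G_psd : forall a : Z -> R,
  0 <= \sum_(i : Z) \sum_(j : Z) a i * a j * G (i - j).
Hypothesis G_sum : \sum_(k : Z) G k = 0.

Let w (h : Z) : R := \sum_(k : Z) G k * cs (h * k).

(** The product formula for cosines and orthogonality leave the terms [l = - k] and [l = k], each
    with weight one half; they agree because [-1] is a unit. *)
Lemma fourier_inv k : \sum_(h : Z) w h * cs (h * k) = N%:R * G k.
Proof.
under eq_bigr do rewrite mulr_suml.
rewrite exchange_big/=.
have E l : \sum_(h : Z) G l * cs (h * l) * cs (h * k) =
    G l * ((if l + k == 0 then N%:R else 0) + (if l - k == 0 then N%:R else 0)) / 2.
  rewrite -!sum_cs -big_split -mulrA mulr_suml mulr_sumr/=.
  by apply: eq_bigr => h _; rewrite mulrBr mulrDr csB csD; field.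
under eq_bigr do rewrite E mulrDr mulrDl.
rewrite big_split/= (bigD1 (- k))//= addNr eqxx big1 => [|l]; last first.
  by rewrite -addr_eq0 => /negPf ->; rewrite mulr0 mul0r.
rewrite (bigD1 k)//= subrr eqxx big1 => [|l]; last first.
  by rewrite -subr_eq0 => /negPf ->; rewrite mulr0 mul0r.
have -> : G (- k) = G k by rewrite -mulN1r G_unit// unitrN1.
by field.
Qed.

(** Easy half of Bochner's theorem: [cs (h * (i - j))] splits into a product of cosines plus a
    product of sines, and each part is a value of the quadratic form of [G]. *)
Lemma fourier_ge0 h : 0 <= w h.
Proof.
have : 0 <= N%:R * w h; last by rewrite pmulr_rge0 ?ltr0n.
have -> : N%:R * w h = \sum_(i : Z) \sum_(j : Z) G (i - j) * cs (h * (i - j)).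
  under eq_bigr => i _ do rewrite (reindex_inj (@subrI _ i))/=.
  under eq_bigr => i _ do under eq_bigr do rewrite subKr.
  by rewrite sumr_const card_ord mulr_natl.
have -> : \sum_(i : Z) \sum_(j : Z) G (i - j) * cs (h * (i - j)) =
  \sum_(i : Z) \sum_(j : Z) cs (h * i) * cs (h * j) * G (i - j) +
  \sum_(i : Z) \sum_(j : Z) sn (h * i) * sn (h * j) * G (i - j).
  rewrite -big_split; apply: eq_bigr => i _; rewrite -big_split; apply: eq_bigr => j _.
  by rewrite /= mulrBr csB; ring.
by rewrite addr_ge0// G_psd.
Qed.

Lemma fourier0 : w 0 = 0.
Proof.
by rewrite /w -[RHS]G_sum; apply: eq_bigr => k _; rewrite mul0r cs0 mulr1.
Qed.

Lemma fourier_total : \sum_(h : Z) w h = N%:R * G 0.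
Proof. by rewrite -fourier_inv; apply: eq_bigr => h _; rewrite mulr0 cs0 mulr1. Qed.

(** Unnormalized Fejer kernel, the squared modulus of a sum of [n] consecutive values of the
    character [a]. *)
Let F n (a : Z) : R := \sum_(i < n) \sum_(j < n) cs (a * (i%:R - j%:R)).

Let F_ge0 n a : 0 <= F n a.
Proof.
have -> : F n a = (\sum_(i < n) cs (a * i%:R)) ^+ 2 + (\sum_(i < n) sn (a * i%:R)) ^+ 2.
  rewrite !expr2 !mulr_suml -big_split; apply: eq_bigr => i _.
  rewrite /= !mulr_sumr -big_split; apply: eq_bigr => j _.
  by rewrite /= mulrBr csB.
by rewrite addr_ge0// sqr_ge0.
Qed.

(** The additive order of [h] is [N %/ gcdn N h]. *)
Lemma mul_eq (h : Z) (i j : nat) :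
  (h * (i%:R - j%:R) == 0) = (j == i %[mod N %/ gcdn N h]).
Proof.
rewrite mulrBr subr_eq0.
have E (k : nat) : h * k%:R = inZp (h * k) :> Z.
  by apply: val_inj; rewrite Zp_nat /= modnMmr.
rewrite !E -val_eqE /=.
set g := gcdn N h; have g0 : (0 < g)%N by rewrite gcdn_gt0.
have cop : coprime (N %/ g) (h %/ g).
  by rewrite /coprime -(eqn_pmul2l g0) muln_gcdr !(mulnC g) !divnK ?dvdn_gcdl ?dvdn_gcdr// mul1n.
have K (a b : nat) : (a <= b)%N ->
    ((h * a == h * b %[mod N]) = (a == b %[mod N %/ g]))%N.
  move=> ab; rewrite eq_sym eqn_mod_dvd ?leq_mul//.
  rewrite [RHS]eq_sym (eqn_mod_dvd (N %/ g))//.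
  rewrite -mulnBr -{1}(divnK (dvdn_gcdr N h)) -/g -{1}(divnK (dvdn_gcdl N h)) -/g.
  by rewrite mulnAC dvdn_pmul2r// Gauss_dvdr.
case: (leqP i j) => [ij|/ltnW ji]; first by rewrite K// eq_sym.
by rewrite eq_sym K.
Qed.

(** Elements of one residue class are told apart by their quotients by [m]. *)
Lemma count_mod (n m r : nat) : (0 < m)%N ->
  (#|[set k : 'I_n | k == r %[mod m]]%SET| <= n %/ m + 1)%N.
Proof.
move=> m0; rewrite addn1 -[X in (_ <= X)%N]card_ord.
pose f (k : 'I_n) : 'I_(n %/ m).+1 := inord (k %/ m).
rewrite -(@card_in_imset _ _ f) ?max_card// => k l.
rewrite !inE => /eqP kr /eqP lr /(congr1 val)/=.
rewrite !inordK ?ltnS ?leq_div2r ?(ltnW (ltn_ord _))// => kl.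
by apply: val_inj; rewrite /= (divn_eq k m) (divn_eq l m) kl kr lr.
Qed.

(* Over all [u], orthogonality counts the [i = j %[mod m]] with [m] the order of
   [h]; restricting to [h * u != 0] removes the main term [n ^ 2 * gcd]. *)
Lemma unit_bound n (h : Z) : h != 0 ->
  \sum_(u : Z | u \is a GRing.unit) F n (h * u) <= n%:R * N%:R.
Proof.
move=> h0; set m := (N %/ gcdn N h)%N.
have g0 : (0 < gcdn N h)%N by rewrite gcdn_gt0.
have Nm : (N = m * gcdn N h)%N by rewrite divnK// dvdn_gcdl.
have m0 : (0 < m)%N by rewrite divn_gt0// dvdn_leq// dvdn_gcdl.
(* The annihilator of [h] contains the [gcdn N h] multiples of [m]. *)
pose A := [set u : Z | h * u == 0]%SET.
have gA : (gcdn N h <= #|A|)%N.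
  pose f (k : 'I_(gcdn N h)) : Z := inord (m * k).
  have fE (k : 'I_(gcdn N h)) : f k = (m * k)%N :> nat.
    rewrite inordK//; have : (m * k < m * gcdn N h)%N by rewrite ltn_pmul2l.
    by rewrite -Nm.
  rewrite -[X in (X <= _)%N]card_ord -(@card_imset _ _ f); last first.
    move=> k l /(congr1 val); rewrite /= !fE => /eqP.
    by rewrite eqn_pmul2l// => /eqP /val_inj.
  apply/subset_leq_card/fintype.subsetP => _ /imsetP[k _ ->]; rewrite inE.
  have := mul_eq h 0%N (f k); rewrite sub0r mulrN oppr_eq0 natr_Zp => ->.
  by rewrite -/m fE modnMr mod0n.
(* A unit does not annihilate [h], and [F] is nonnegative, so the sum may be enlarged to all [u]
   with [h * u != 0]. *)
apply: (@le_trans _ _ (\sum_(u : Z | h * u != 0) F n (h * u))).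
  rewrite [leRHS](bigID (fun u : Z => u \is a GRing.unit))/=.
  have -> : \sum_(u : Z | (h * u != 0) && (u \is a GRing.unit)) F n (h * u) =
      \sum_(u : Z | u \is a GRing.unit) F n (h * u).
    apply: eq_bigl => u; case: (boolP (u \is a GRing.unit)) => uu; last by rewrite andbF.
    rewrite andbT; apply/negP => /eqP hu; move/eqP: h0; apply.
    by rewrite -(mulrK uu h) hu mul0r.
  by rewrite lerDl; apply: sumr_ge0 => u _; exact: F_ge0.
have : \sum_(u : Z) F n (h * u) <= n%:R * (n%:R * #|A|%:R + N%:R).
  rewrite exchange_big/=; under eq_bigr do rewrite exchange_big/=.
  apply: (@le_trans _ _ (\sum_(i < n) (n%:R * #|A|%:R + N%:R))); last first.
    by rewrite sumr_const card_ord -[leLHS]mulr_natl.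
  apply: ler_sum => i _.
  have -> : \sum_(j < n) \sum_(u : Z) cs (h * u * (i%:R - j%:R)) =
      N%:R * #|[set k : 'I_n | k == i %[mod m]]%SET|%:R.
    rewrite -sumr_const mulr_sumr [RHS]big_mkcond; apply: eq_bigr => j _.
    have -> : \sum_(u : Z) cs (h * u * (i%:R - j%:R)) =
        \sum_(u : Z) cs (u * (h * (i%:R - j%:R))).
      by apply: eq_bigr => u _; rewrite [h * u]mulrC mulrA.
    by rewrite sum_cs mul_eq inE mulr1.
  have /(leq_trans _) := count_mod n i m0.
  move=> /(_ _ (leqnn _)) c1.
  rewrite -!natrM -natrD ler_nat.
  (* [N * (n %/ m)] is [gcdn N h] times [m * (n %/ m)], hence at most [n * #|A|]; the extra [N] pays
     for the incomplete period. *)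
  apply: (@leq_trans (N * (n %/ m + 1))%N); first by rewrite leq_mul2l c1 orbT.
  rewrite mulnDr muln1 leq_add2r {1}Nm mulnAC (mulnC m).
  by rewrite leq_mul// leq_divM.
rewrite (bigID (fun u => h * u == 0))/=.
(* Each annihilating [u] contributes exactly [n ^ 2], which cancels the main term of the bound. *)
have -> : \sum_(u : Z | h * u == 0) F n (h * u) = n%:R * (n%:R * #|A|%:R).
  rewrite (eq_big (fun u => u \in A) (fun=> n%:R * n%:R)).
  - by rewrite sumr_const -[LHS]mulr_natr mulrA.
  - by move=> u; rewrite inE.
  - move=> u /eqP ->; rewrite /F.
    under eq_bigr do under eq_bigr do rewrite mul0r cs0.
    by rewrite !sumr_const !card_ord -[LHS]mulr_natr.
by rewrite mulrDr; lra.
Qed.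

(* [G_sum] kills the frequency [h = 0], the only one that would give [n ^ 2]. *)
Lemma stationary_sum_le n :
  (\sum_(u : Z | u \is a GRing.unit) 1) *
    (\sum_(i < n) \sum_(j < n) G (i%:R - j%:R)) <= n%:R * N%:R * G 0.
Proof.
rewrite -(@ler_pM2l _ N%:R) ?ltr0n//.
(* For each unit [u] the inversion formula at [u * (i - j)] gives [N * G (u * (i - j))], which is
   [N * G (i - j)]. *)
have -> : N%:R * ((\sum_(u : Z | u \is a GRing.unit) 1) *
    (\sum_(i < n) \sum_(j < n) G (i%:R - j%:R))) =
  \sum_(h : Z) w h * \sum_(u : Z | u \is a GRing.unit) F n (h * u).
  under [RHS]eq_bigr do rewrite mulr_sumr.
  rewrite [RHS]exchange_big/=.
  have -> (x : R) : N%:R * ((\sum_(u : Z | u \is a GRing.unit) 1) * x) =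
      \sum_(u : Z | u \is a GRing.unit) (N%:R * x).
    by rewrite mulrCA mulr_suml; apply: eq_bigr => u _; rewrite mul1r.
  apply: eq_bigr => u uu.
  under [RHS]eq_bigr do rewrite mulr_sumr.
  rewrite [RHS]exchange_big/= mulr_sumr; apply: eq_bigr => i _.
  under [RHS]eq_bigr do rewrite mulr_sumr.
  rewrite [RHS]exchange_big/= mulr_sumr; apply: eq_bigr => j _.
  under [RHS]eq_bigr do rewrite -mulrA.
  by rewrite fourier_inv G_unit.
have -> : N%:R * (n%:R * N%:R * G 0) = \sum_(h : Z) w h * (n%:R * N%:R).
  by rewrite -mulr_suml fourier_total; ring.
apply: ler_sum => h _; have [->|h0] := eqVneq h 0.
  by rewrite fourier0 !mul0r.
by rewrite ler_wpM2l ?fourier_ge0// unit_bound.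
Qed.

End Fourier.

(** Lagrange's identity: the defect is half the sum of all [(a i - a j) ^+ 2]. *)
Lemma sqr_sum_le (R : realDomainType) (I : finType) (a : I -> R) :
  (\sum_i a i) ^+ 2 <= #|I|%:R * \sum_i a i ^+ 2.
Proof.
have : 0 <= \sum_i \sum_j (a i - a j) ^+ 2.
  by apply: sumr_ge0 => i _; apply: sumr_ge0 => j _; exact: sqr_ge0.
have -> : \sum_i \sum_j (a i - a j) ^+ 2 =
    2 * (#|I|%:R * \sum_i a i ^+ 2 - (\sum_i a i) ^+ 2).
  have E i : \sum_j (a i - a j) ^+ 2 =
      #|I|%:R * a i ^+ 2 + \sum_j a j ^+ 2 - 2 * (\sum_j a j) * a i.
    rewrite mulr_sumr mulr_suml.
    have -> : #|I|%:R * a i ^+ 2 = \sum_(j : I) a i ^+ 2 by rewrite sumr_const mulr_natl.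
    rewrite -big_split -sumrB; apply: eq_bigr => j _ /=; ring.
  under eq_bigr do rewrite E.
  rewrite sumrB big_split /= -!mulr_sumr sumr_const -[X in _ + X - _]mulr_natl; ring.
lra.
Qed.

Lemma measurable_sqr (d : measure_display) (T : measurableType d) (R : realType)
    (D : set T) (g : T -> R) :
  measurable_fun D g -> measurable_fun D (fun x => (g x ^+ 2)%:E).
Proof.
move=> mg; have h : measurable_fun D (fun x => g x ^+ 2) by exact: measurable_funX.
exact/measurable_EFinP.
Qed.

(** * Random variables with finitely many values *)

Section FiniteValued.
Context {dO : measure_display} {Om : measurableType dO} {R : realType}.
Variable P : probability Om R.

Definition finite_rv (T : finType) (Y : Om -> T) : Prop :=
  forall s, measurable (Y @^-1` [set s]).

Lemma finite_rv_preimage (T : finType) (Y : Om -> T) (S : set T) :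
  finite_rv Y -> measurable (Y @^-1` S).
Proof.
move=> mY; have -> : Y @^-1` S = \bigcup_(s in S) (Y @^-1` [set s]).
  by apply/seteqP; split => [w Sw|w [s Ss /= ->]//]; exists (Y w).
by apply: fin_bigcup_measurable => // s _; exact: mY.
Qed.

Lemma finite_rv_pair (T U : finType) (Y : Om -> T) (Z : Om -> U) :
  finite_rv Y -> finite_rv Z -> finite_rv (fun w => (Y w, Z w)).
Proof.
move=> mY mZ [s t]; have -> : (fun w => (Y w, Z w)) @^-1` [set (s, t)] =
    (Y @^-1` [set s]) `&` (Z @^-1` [set t]).
  by apply/seteqP; split => w /= [-> ->].
exact: measurableI.
Qed.

Lemma measurable_fun_finite (T : finType) (Y : Om -> T) (phi : T -> R) :
  finite_rv Y -> measurable_fun [set: Om] (fun w => phi (Y w)).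
Proof.
move=> mY _ B mB; rewrite setTI.
exact: (finite_rv_preimage (phi @^-1` B) mY).
Qed.

Lemma finite_rv_indic (T : finType) (Y : Om -> T) (phi : T -> R) w :
  (phi (Y w))%:E = (\sum_s (phi s)%:E * (\1_(Y @^-1` [set s]) w)%:E)%E.
Proof.
rewrite (bigD1 (Y w))//= indicE mem_set// mule1 big1 ?adde0// => s sY.
by rewrite indicE memNset ?mule0// => /= Ys; rewrite Ys eqxx in sY.
Qed.

Lemma integrable_finite (T : finType) (Y : Om -> T) (phi : T -> R) :
  finite_rv Y -> P.-integrable setT (fun w => (phi (Y w))%:E).
Proof.
move=> mY; rewrite (funext (finite_rv_indic Y phi)).
apply: integrable_sum => // s _; apply: integrableZl => //.
exact: integrable_indic.
Qed.

Lemma integral_finite (T : finType) (Y : Om -> T) (phi : T -> R) :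
  finite_rv Y ->
  (\int[P]_w (phi (Y w))%:E)%E = (\sum_s phi s * fine (P (Y @^-1` [set s])))%:E.
Proof.
move=> mY; rewrite (funext (finite_rv_indic Y phi)).
rewrite integral_sum//; last first.
  by move=> s; apply: integrableZl => //; exact: integrable_indic.
rewrite -sumEFin; apply: eq_bigr => s _.
rewrite integralZl//; last exact: integrable_indic.
by rewrite integral_indic// setIT EFinM fineK// fin_num_measure.
Qed.

Variables (T : finType) (Y : nat -> Om -> T) (pi : nat -> nat -> T -> T -> R).
Hypothesis mY : forall i, finite_rv (Y i).
Hypothesis pairP : forall i j s t,
  P ((Y i @^-1` [set s]) `&` (Y j @^-1` [set t])) = (pi i j s t)%:E.

Lemma integral_pair i j (phi : T -> T -> R) :
  (\int[P]_w (phi (Y i w) (Y j w))%:E)%E =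
  (\sum_s \sum_t phi s t * pi i j s t)%:E.
Proof.
rewrite (integral_finite (fun u => phi u.1 u.2) (finite_rv_pair (mY i) (mY j))).
rewrite pair_bigA/=; congr (_%:E); apply: eq_bigr => -[s t] _ /=; congr (_ * _).
rewrite -[RHS]/(fine (pi i j s t)%:E) -pairP; congr (fine (P _)).
by apply/seteqP; split => w /= [-> ->].
Qed.

Lemma integrable_pair i j (phi : T -> T -> R) :
  P.-integrable setT (fun w => (phi (Y i w) (Y j w))%:E).
Proof.
exact: (integrable_finite (fun u => phi u.1 u.2) (finite_rv_pair (mY i) (mY j))).
Qed.

(** The summand may vary with [i]; positive semidefiniteness of the covariance needs this
    generality. Here [pi] is a joint law, not the number. *)
Lemma second_moment n (a : nat -> T -> R) :
  (\int[P]_w ((\sum_(i < n) a i (Y i w)) ^+ 2)%:E)%E =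
  (\sum_(i < n) \sum_(j < n) \sum_s \sum_t a i s * a j t * pi i j s t)%:E.
Proof.
under eq_integral => w _.
  rewrite expr2 mulr_suml -sumEFin.
  under eq_bigr do rewrite mulr_sumr -sumEFin.
  over.
have I i j := integrable_pair i j (fun s t => a i s * a j t).
rewrite integral_sum//; last by move=> i; exact: integrable_sum.
rewrite -sumEFin; apply: eq_bigr => i _.
rewrite integral_sum// -sumEFin; apply: eq_bigr => j _.
by rewrite (integral_pair i j (fun s t => a i s * a j t)).
Qed.

(** The index [j] is free, so comparing two choices of it evaluates the row sums of a kernel without
    expanding it. *)
Lemma marginal i j s : P (Y i @^-1` [set s]) = (\sum_t pi i j s t)%:E.
Proof.
rewrite -[LHS](@fineK _ (P _)) ?fin_num_measure//; last exact: mY.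
have := integral_pair i j (fun s' _ => (s' == s)%:R).
rewrite (integral_finite (fun s' => (s' == s)%:R) (mY i)) => -[].
rewrite (bigD1 s)//= eqxx mul1r big1 ?addr0; last first.
  by move=> t /negPf ->; rewrite mul0r.
rewrite (bigD1 s)//= eqxx [X in _ + X]big1 ?addr0; last first.
  by move=> t /negPf ->; apply: big1 => u _; rewrite mul0r.
by move=> ->; congr (_%:E); apply: eq_bigr => t _; rewrite mul1r.
Qed.

End FiniteValued.

(** * The joint law of two scrambled points *)

Section PairLaw.
Context {R : realType}.

(* Law of the [l]-th digits of two points whose indices agree modulo [b ^ l.+1]
   (flag [e1]) and modulo [b ^ l] (flag [e0]). *)
Definition pair_kernel (b : nat) (e1 e0 : bool) (s t : nat) : R :=
  ((s < b) && (t < b))%N%:R *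
  (if e1 then (s == t)%:R / b%:R
   else if e0 then (s != t)%:R / (b%:R * (b%:R - 1))
   else b%:R ^- 2).

Context {dO : measure_display} {Om : measurableType dO}.
Variable P : probability Om R.
Variable d : nat.

(** The interface of the proof: both scrambles are shown to satisfy it, and the variance estimates
    use nothing else about them. The strings [s] and [t] are arbitrary; out-of-range digits have
    kernel 0. *)
Definition halton_pair_law (X : nat -> 'I_d -> nat -> Om -> nat) : Prop :=
  [/\ forall i j l w, (X i j l w < nth_prime j)%N,
      forall i j l v, measurable (X i j l @^-1` [set v]) &
      forall i i' K (s t : 'I_d -> nat -> nat),
        P [set w | forall j l, (l < K)%N -> X i j l w = s j l /\ X i' j l w = t j l] =
        (\prod_(j < d) \prod_(l < K) pair_kernel (nth_prime j)
           (i == i' %[mod nth_prime j ^ l.+1]) (i == i' %[mod nth_prime j ^ l])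
           (s j l) (t j l))%:E].

Variable K : nat.
Let B := (\max_(j < d) nth_prime j).
(** A common codomain for all bases avoids dependent finite functions; strings with an out-of-range
    digit get weight 0 in [unif_prod] and [kernel_prod]. *)
Definition digits : finType := {ffun 'I_d * 'I_K -> 'I_B.+1}.

Definition ext (s : digits) (j : 'I_d) (l : nat) : nat :=
  oapp (fun l' : 'I_K => s (j, l') : nat) 0%N (insub l).

Definition restr (x : 'I_d -> nat -> nat) : digits :=
  [ffun q : 'I_d * 'I_K => inord (x q.1 q.2)].

Lemma extE s j (l : 'I_K) : ext s j l = s (j, l).
Proof. by rewrite /ext valK. Qed.

Lemma restrP (x : 'I_d -> nat -> nat) s : (forall j l, x j l < nth_prime j)%N ->
  restr x = s <-> forall j l, (l < K)%N -> x j l = ext s j l.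
Proof.
move=> xb; have xB j l : (x j l < B.+1)%N.
  by rewrite ltnS (leq_trans (ltnW (xb j l)))// leq_bigmax.
split=> [<- j l lK|h].
  by rewrite -[l]/(val (Ordinal lK)) extE ffunE inordK.
apply/ffunP => -[j l]; apply: val_inj; rewrite ffunE /= inordK//.
by rewrite h// extE.
Qed.

Definition kernel_prod (k : nat) (s t : digits) : R :=
  \prod_(j < d) \prod_(l < K) pair_kernel (nth_prime j)
    (nth_prime j ^ l.+1 %| k)%N (nth_prime j ^ l %| k)%N (s (j, l)) (t (j, l)).

Definition unif_prod (s : digits) : R :=
  \prod_(j < d) \prod_(l < K) ((s (j, l) < nth_prime j)%N%:R / (nth_prime j)%:R).

Lemma kernel_prod0 s t : kernel_prod 0 s t = (s == t)%:R * unif_prod s.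
Proof.
rewrite /kernel_prod /unif_prod; have [<-|/eqP st] := eqVneq s t.
  rewrite mul1r; apply: eq_bigr => j _; apply: eq_bigr => l _.
  by rewrite /pair_kernel !dvdn0 eqxx andbb mul1r.
rewrite mul0r; have [[j l]/= stjl] : exists q, s q != t q.
  by apply/existsP; rewrite -negb_forall; apply/negP => /forallP h;
    apply: st; apply/ffunP => q; apply/eqP.
rewrite (bigD1 j)//= (bigD1 l)//= /pair_kernel !dvdn0.
by rewrite -val_eqE /= in stjl; rewrite (negPf stjl) mul0r mulr0 !mul0r.
Qed.

Lemma restr_finite_rv (X : 'I_d -> nat -> Om -> nat) :
  (forall j l w, X j l w < nth_prime j)%N ->
  (forall j l v, measurable (X j l @^-1` [set v])) ->
  finite_rv (fun w => restr (fun j l => X j l w)).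
Proof.
move=> Xb mX s.
have -> : (fun w => restr (fun j l => X j l w)) @^-1` [set s] =
    \bigcap_(q in [set: 'I_d * 'I_K]) X q.1 q.2 @^-1` [set s q : nat].
  apply/seteqP; split => w /=.
    by move=> /restrP h [j l] _ /=; rewrite h// extE.
  move=> h; apply/restrP => // j l lK.
  by have := h (j, Ordinal lK) I => /= ->; rewrite -[l]/(val (Ordinal lK)) extE.
by apply: fin_bigcap_measurable.
Qed.

Variable p : nat.
Hypothesis pN : p.+2 = (\prod_(j < d) nth_prime j ^ K)%N.

Lemma pow_dvd_modulus (j : 'I_d) l : (l <= K)%N -> (nth_prime j ^ l %| p.+2)%N.
Proof.
by move=> lK; rewrite pN (bigD1 j)//= dvdn_mulr// dvdn_exp2l.
Qed.

(** The moduli in the pair law divide [N], so its flags survive the reduction of [i - i'] modulo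
    [N]; this makes the covariance a function on Z/N. *)
Lemma dvd_sub m (i i' : nat) : (m %| p.+2)%N ->
  (m %| (i%:R - i'%:R : 'I_p.+2)%R)%N = (i == i' %[mod m]).
Proof.
move=> mN; set k := (i%:R - i'%:R : 'I_p.+2).
have : k%:R + i'%:R = i%:R :> 'I_p.+2 by rewrite natr_Zp subrK.
rewrite -natrD !Zp_nat => /(congr1 val)/= /(congr1 (modn^~ m)) h.
have {h} : (k + i' = i %[mod m])%N by rewrite -(modn_dvdm _ mN) h modn_dvdm.
by rewrite eq_sym => <-; rewrite -{2}[i']add0n eqn_modDr mod0n.
Qed.

(** A unit is coprime to [N], hence to each divisor [m]. This is the source of the invariance under
    units. *)
Lemma dvd_unit m (u k : 'I_p.+2) : (m %| p.+2)%N -> u \is a GRing.unit ->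
  (m %| (u * k : 'I_p.+2)%R)%N = (m %| k)%N.
Proof.
move=> mN uu; rewrite /dvdn /= modn_dvdm// -!/(dvdn _ _) Gauss_dvdr//.
have : coprime p.+2 u.
  by rewrite -(@unitZpE p.+2)// natr_Zp.
exact: coprime_dvdl.
Qed.

Lemma nth_prime_lt i j : (i < j)%N -> (nth_prime i < nth_prime j)%N.
Proof.
elim: j => // j IH; rewrite ltnS leq_eqVlt => /orP[/eqP ->|/IH h].
  by rewrite /nth_prime/= /next_prime; case: ex_minnP => q /andP[].
apply: (ltn_trans h).
by rewrite /nth_prime/= /next_prime; case: ex_minnP => q /andP[].
Qed.

Lemma nth_prime_inj : injective nth_prime.
Proof.
move=> i j h; case: (ltngtP i j) => // /nth_prime_lt; by rewrite h ltnn.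
Qed.

Lemma coprime_nth_prime (i j : 'I_d) e f : i != j ->
  coprime (nth_prime i ^ e) (nth_prime j ^ f).
Proof.
move=> ij; apply/coprimeXl/coprimeXr; rewrite prime_coprime ?prime_nth_prime//.
rewrite dvdn_prime2 ?prime_nth_prime//; apply: contra ij => /eqP /nth_prime_inj h.
exact/eqP/val_inj.
Qed.

Lemma prod_dvd k : (forall j : 'I_d, nth_prime j ^ K %| k)%N -> (p.+2 %| k)%N.
Proof.
move=> h; rewrite pN.
have : uniq (index_enum 'I_d) by exact: index_enum_uniq.
elim: (index_enum _) => [|j r IH /=/andP[jr ur]]; first by rewrite big_nil dvd1n.
rewrite big_cons Gauss_dvd ?h ?IH//.
rewrite big_seq; elim/big_ind: _ => [|x y|i ir]; first exact: coprimen1.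
  by rewrite coprimeMr => -> ->.
by rewrite coprime_nth_prime//; apply: contraNneq jr => ->.
Qed.

(** For [k] nonzero modulo [N] some coordinate has a level [l] with [b ^ l] but not [b ^ l.+1]
    dividing [k]; there the two digits differ almost surely. *)
Lemma kernel_prod_diag (k : 'I_p.+2) t : k != 0 -> kernel_prod k t t = 0.
Proof.
move=> k0; have [j jk] : exists j : 'I_d, ~~ (nth_prime j ^ K %| k)%N.
  apply/existsP; rewrite -negb_forall; apply: contra k0 => /forallP /prod_dvd.
  by rewrite /dvdn modn_small// => /eqP h; apply/eqP/val_inj.
have [l lK /andP[lk lk1]] : exists2 l, (l < K)%N &
    (nth_prime j ^ l %| k)%N && ~~ (nth_prime j ^ l.+1 %| k)%N.
  move: (K) jk; elim=> [|m IH]; first by rewrite expn0 dvd1n.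
  move=> jm; have [h|] := boolP (nth_prime j ^ m %| k)%N; first by exists m; rewrite ?h.
  by move=> /IH[l lm h]; exists l => //; exact: ltnW.
rewrite /kernel_prod (bigD1 j)//= (bigD1 (Ordinal lK))//= /pair_kernel lk (negPf lk1) eqxx.
by rewrite !mul0r mulr0 !mul0r.
Qed.

Lemma unif_prodE s : unif_prod s = 0 \/ unif_prod s = p.+2%:R^-1.
Proof.
have [h|] := boolP [forall j : 'I_d, [forall l : 'I_K, (s (j, l) < nth_prime j)%N]].
  right; rewrite /unif_prod pN natr_prod -prodfV; apply: eq_bigr => j _.
  have -> : (nth_prime j ^ K)%:R^-1 = \prod_(l < K) (nth_prime j)%:R^-1 :> R.
    by rewrite prodr_const card_ord natrX exprVn.
  apply: eq_bigr => l _.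
  by move/forallP: h => /(_ j)/forallP/(_ l) ->; rewrite mul1r.
rewrite negb_forall => /existsP[j]; rewrite negb_forall => /existsP[l sl].
left; rewrite /unif_prod (bigD1 j)//= (bigD1 l)//=.
by rewrite (negPf sl) !mul0r.
Qed.

Definition covar (h : digits -> R) (k : nat) : R :=
  \sum_s \sum_t h s * h t * kernel_prod k s t.

Variable X : nat -> 'I_d -> nat -> Om -> nat.
Hypothesis lawX : halton_pair_law X.

Definition level i w : digits := restr (fun j l => X i j l w).

Lemma level_finite_rv i : finite_rv (level i).
Proof.
by case: lawX => Xb mX _; exact: (restr_finite_rv (Xb i) (mX i)).
Qed.

Lemma level_pair i i' s t :
  P ((level i @^-1` [set s]) `&` (level i' @^-1` [set t])) =
  (kernel_prod (i%:R - i'%:R : 'I_p.+2)%R s t)%:E.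
Proof.
case: lawX => Xb mX XP.
have -> : (level i @^-1` [set s]) `&` (level i' @^-1` [set t]) =
    [set w | forall j l, (l < K)%N -> X i j l w = ext s j l /\ X i' j l w = ext t j l].
  apply/seteqP; split => w /=.
    by move=> [/restrP h1 /restrP h2] j l lK; rewrite h1// h2.
  by move=> h; split; apply/restrP => // j l lK; case: (h j l lK).
rewrite XP; congr (_%:E); apply: eq_bigr => j _; apply: eq_bigr => l _.
by rewrite !extE !dvd_sub ?pow_dvd_modulus// ltnW.
Qed.

Lemma second_moment_level n (h : digits -> R) :
  (\int[P]_w ((\sum_(i < n) h (level i w)) ^+ 2)%:E)%E =
  (\sum_(i < n) \sum_(j < n) covar h (i%:R - j%:R : 'I_p.+2)%R)%:E.
Proof.
exact: (second_moment level_finite_rv level_pair n (fun=> h)).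
Qed.

(** Both sides are the law of point [k], paired with point 0 on the left and with itself, where the
    kernel is diagonal, on the right. *)
Lemma sum_kernel_l (k : 'I_p.+2) s : \sum_t kernel_prod k s t = unif_prod s.
Proof.
have m1 := marginal level_finite_rv level_pair k 0%N s.
have m2 := marginal level_finite_rv level_pair k k s.
move: m1; rewrite m2 subrr natr_Zp subr0 => -[<-].
rewrite (bigD1 s)//= kernel_prod0 eqxx mul1r big1 ?addr0// => t ts.
by rewrite kernel_prod0 eq_sym (negPf ts) mul0r.
Qed.

Lemma kernel_prodC k s t : kernel_prod k s t = kernel_prod k t s.
Proof.
apply: eq_bigr => j _; apply: eq_bigr => l _; rewrite /pair_kernel andbC.
by rewrite (eq_sym (s _ : nat)).
Qed.

Lemma sum_kernel_diag s : \sum_(k < p.+2) kernel_prod k s s = unif_prod s.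
Proof.
rewrite (bigD1 0)//= kernel_prod0 eqxx mul1r big1 ?addr0// => k k0.
exact: kernel_prod_diag.
Qed.

Lemma sum_unif_prod : \sum_s unif_prod s = 1.
Proof.
have := integral_finite P (fun=> 1) (level_finite_rv 0).
rewrite integral_cst//= mul1e probability_setT => -[->].
apply: eq_bigr => s _.
by rewrite mul1r (marginal level_finite_rv level_pair 0%N 0%N s) sum_kernel_l.
Qed.

Lemma sum_sub_nat n (F : 'I_p.+2 -> R) : n = p.+2 ->
  \sum_(i < n) \sum_(j < n) F (i%:R - j%:R) = p.+2%:R * \sum_k F k.
Proof.
move=> ->; transitivity (\sum_(i : 'I_p.+2) \sum_(k : 'I_p.+2) F k).
  apply: eq_bigr => i _; rewrite natr_Zp.
  rewrite [RHS](reindex_inj (@subrI _ i))/=.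
  by apply: eq_bigr => j _; rewrite natr_Zp.
by rewrite sumr_const card_ord mulr_natl.
Qed.

(* [k |-> kernel_prod k t t] vanishes on nonzero residues: the points of a full
   period have pairwise different digit strings, so each string occurs once. *)
Lemma full_period_count t :
  (\int[P]_w ((\sum_(i < p.+2) ((level i w == t)%:R - unif_prod t)) ^+ 2)%:E = 0)%E.
Proof.
pose a s : R := (s == t)%:R - unif_prod t.
rewrite (second_moment_level _ a) (sum_sub_nat (fun k => covar a k))//.
suff -> : \sum_(k < p.+2) covar a k = 0 by rewrite mulr0.
have E (k : 'I_p.+2) : covar a k =
    kernel_prod k t t - unif_prod t ^+ 2.
  rewrite /covar; transitivity (\sum_s ((s == t)%:R - unif_prod t) *
      (kernel_prod k s t - unif_prod t * unif_prod s)).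
    apply: eq_bigr => s _; rewrite -(sum_kernel_l k s) mulr_sumr mulrBr.
    rewrite [in RHS]mulr_sumr.
    transitivity (\sum_t0 (a s * ((t0 == t)%:R * kernel_prod k s t0) -
       a s * (unif_prod t * kernel_prod k s t0))).
      by apply: eq_bigr => t0 _; rewrite /a; ring.
    rewrite sumrB; congr (_ - _).
    rewrite -mulr_sumr; congr (_ * _).
    rewrite (bigD1 t)//= eqxx mul1r big1 ?addr0// => s' /negPf ->.
    by rewrite mul0r.
  transitivity (\sum_s ((s == t)%:R * (kernel_prod k s t - unif_prod t * unif_prod s)) -
     unif_prod t * \sum_s (kernel_prod k s t - unif_prod t * unif_prod s)).
    by rewrite mulr_sumr -sumrB; apply: eq_bigr => s _; rewrite mulrBl.
  rewrite [X in _ - _ * X](_ : _ = 0) ?mulr0 ?subr0; last first.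
    rewrite sumrB -mulr_sumr sum_unif_prod mulr1.
    by under eq_bigr do rewrite kernel_prodC; rewrite sum_kernel_l subrr.
  rewrite (bigD1 t)//= eqxx mul1r big1 ?addr0 ?expr2// => s' /negPf ->.
  by rewrite mul0r.
(* The sum over [k] is [unif_prod t - N * unif_prod t ^+ 2], which is 0 because [unif_prod t] is 0
   or [1 / N]. *)
under eq_bigr do rewrite E.
rewrite sumrB sum_kernel_diag sumr_const card_ord.
case: (unif_prodE t) => ->; first by rewrite expr0n mul0rn subrr.
by rewrite expr2 -mulrnAr -[X in _ * X]mulr_natr mulVf ?pnatr_eq0// mulr1 subrr.
Qed.

Variable h : digits -> R.
Hypothesis h0 : \sum_s h s * unif_prod s = 0.

(** As [h] is centred, the sum is a combination, with coefficients [h t], of the centred counts of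
    the strings [t], all of which vanish in mean square. *)
Lemma full_period_sum :
  (\int[P]_w ((\sum_(i < p.+2) h (level i w)) ^+ 2)%:E = 0)%E.
Proof.
have E w : \sum_(i < p.+2) h (level i w) =
    \sum_t h t * (\sum_(i < p.+2) ((level i w == t)%:R - unif_prod t)).
  transitivity (\sum_(i < p.+2) \sum_t h t * ((level i w == t)%:R - unif_prod t)).
    apply: eq_bigr => i _; under eq_bigr do rewrite mulrBr.
    rewrite sumrB h0 subr0 (bigD1 (level i w))//= eqxx mulr1 big1 ?addr0// => t.
    by rewrite eq_sym => /negPf ->; rewrite mulr0.
  by rewrite exchange_big; apply: eq_bigr => t _; rewrite mulr_sumr.
have mZ t : measurable_fun setT (fun w => \sum_(i < p.+2) ((level i w == t)%:R - unif_prod t) : R).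
  apply: measurable_sum => i.
  exact: (measurable_fun_finite (fun s => (s == t)%:R - unif_prod t) (level_finite_rv i)).
have mh : measurable_fun setT (fun w => \sum_(i < p.+2) h (level i w)).
  by apply: measurable_sum => i; exact: measurable_fun_finite (level_finite_rv i).
apply/eqP; rewrite eq_le; apply/andP; split; last first.
  by apply: integral_ge0 => w _; rewrite lee_fin sqr_ge0.
pose Z t w := \sum_(i < p.+2) ((level i w == t)%:R - unif_prod t) : R.
apply: (@le_trans _ _ (\int[P]_w (\sum_t (#|digits|%:R * h t ^+ 2)%:E * (Z t w ^+ 2)%:E))%E).
  apply: ge0_le_integral => //.
  - by move=> w _; rewrite lee_fin sqr_ge0.
  - exact: measurable_sqr.
  - apply: emeasurable_sum => t; apply: measurable_funeM.
    by apply: measurable_sqr; exact: mZ.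
  - move=> w _; have -> : (\sum_t (#|digits|%:R * h t ^+ 2)%:E * (Z t w ^+ 2)%:E =
        (\sum_t #|digits|%:R * h t ^+ 2 * Z t w ^+ 2)%:E)%E.
      by rewrite -sumEFin; apply: eq_bigr => t _; rewrite EFinM.
    rewrite lee_fin E (le_trans (sqr_sum_le _))// mulr_sumr ler_sum// => t _.
    by rewrite exprMn mulrA.
rewrite ge0_integral_sum//; last 2 first.
- by move=> t; apply: measurable_funeM; apply: measurable_sqr; exact: mZ.
- move=> t w _; apply: mule_ge0; rewrite lee_fin ?sqr_ge0//.
  by apply: mulr_ge0; [exact: ler0n|exact: sqr_ge0].
rewrite big1// => t _; rewrite ge0_integralZl//.
- by rewrite full_period_count mule0.
- by apply: measurable_sqr; exact: mZ.
- by move=> w _; rewrite lee_fin sqr_ge0.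
- by rewrite lee_fin; apply: mulr_ge0; [exact: ler0n|exact: sqr_ge0].
Qed.

Lemma covar_sum : \sum_(k < p.+2) covar h k = 0.
Proof.
have := full_period_sum; rewrite second_moment_level.
rewrite (sum_sub_nat (fun k => covar h k))// => -[/eqP].
by rewrite mulf_eq0 pnatr_eq0/= => /eqP.
Qed.

Lemma covar_unit (u k : 'I_p.+2) : u \is a GRing.unit ->
  covar h (u * k : 'I_p.+2)%R = covar h k.
Proof.
move=> uu; apply: eq_bigr => s _; apply: eq_bigr => t _; congr (_ * _).
apply: eq_bigr => j _; apply: eq_bigr => l _.
by rewrite !dvd_unit ?pow_dvd_modulus// ltnW.
Qed.

(** The quadratic form is the second moment of the sum of [a i * h (level i w)]. *)
Lemma covar_psd (a : 'I_p.+2 -> R) :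
  0 <= \sum_(i : 'I_p.+2) \sum_(j : 'I_p.+2) a i * a j * covar h (i - j : 'I_p.+2)%R.
Proof.
rewrite -lee_fin.
have := second_moment level_finite_rv level_pair p.+2 (fun i s => a (inord i) * h s).
have -> : \sum_(i < p.+2) \sum_(j < p.+2) \sum_s \sum_t
    a (inord i) * h s * (a (inord j) * h t) *
    kernel_prod (i%:R - j%:R : 'I_p.+2)%R s t =
  \sum_(i : 'I_p.+2) \sum_(j : 'I_p.+2) a i * a j * covar h (i - j : 'I_p.+2)%R.
  apply: eq_bigr => i _; apply: eq_bigr => j _; rewrite !natr_Zp !inord_val.
  rewrite /covar !mulr_sumr; apply: eq_bigr => s _; rewrite mulr_sumr.
  by apply: eq_bigr => t _; ring.
by move=> <-; apply: integral_ge0 => w _; rewrite lee_fin sqr_ge0.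
Qed.

End PairLaw.

(** * Mean square estimates at a fixed number of digits *)

Lemma sum_periodic (V : zmodType) (N n : nat) (f : nat -> V) :
  (forall i, f (N + i)%N = f i) -> \sum_(i < N) f i = 0 ->
  \sum_(i < n) f i = \sum_(i < n %% N) f i.
Proof.
move=> fN f0; suff E q r : \sum_(i < q * N + r) f i = \sum_(i < r) f i.
  by rewrite -[RHS](E (n %/ N)%N) -divn_eq.
elim: q => [//|q IH].
rewrite mulSn -addnA big_split_ord /= f0 add0r -IH.
by apply: eq_bigr => i _; rewrite fN.
Qed.

Lemma sum_periodic2 (V : zmodType) (N n : nat) (F : nat -> nat -> V) :
  (forall i j, F (N + i)%N j = F i j) -> (forall i j, F i (N + j)%N = F i j) ->
  (forall j, \sum_(i < N) F i j = 0) -> (forall i, \sum_(j < N) F i j = 0) ->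
  \sum_(i < n) \sum_(j < n) F i j =
  \sum_(i < n %% N) \sum_(j < n %% N) F i j.
Proof.
move=> F1 F2 S1 S2.
under eq_bigr => i _ do rewrite (@sum_periodic _ N n (F i))//.
rewrite (@sum_periodic _ N n (fun i => \sum_(j < n %% N) F i j))//.
  by move=> i; apply: eq_bigr => j _; rewrite F1.
by rewrite exchange_big big1.
Qed.

Section Totient.
Variable R : realType.

(* The factor [N / totient N] for [N = \prod_j b_j ^ K], [K > 0]. *)
Definition gain (d : nat) : R :=
  \prod_(j < d) ((nth_prime j)%:R / ((nth_prime j)%:R - 1)).

Lemma nth_prime_gt1R j : 1 < (nth_prime j)%:R :> R.
Proof. by rewrite ltr1n prime_gt1// prime_nth_prime. Qed.

Lemma gain_ge0 d : 0 <= gain d.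
Proof.
by apply: prodr_ge0 => j _; rewrite divr_ge0// subr_ge0 ltW// nth_prime_gt1R.
Qed.

(** With a positive exponent each factor [b ^ K.+1] has totient [(b - 1) * b ^ K], so the ratio does
    not see [K]; the exponent 0 would break this. *)
Lemma totient_gain (d K : nat) :
  (totient (\prod_(j < d) nth_prime j ^ K.+1))%:R * gain d =
  (\prod_(j < d) nth_prime j ^ K.+1)%N%:R.
Proof.
rewrite /gain; have : uniq (index_enum 'I_d) by exact: index_enum_uniq.
elim: (index_enum _) => [_|j r IH /=/andP[jr ur]].
  by rewrite !big_nil mulr1.
rewrite !big_cons totient_coprime; last first.
  rewrite big_seq; elim/big_ind: _ => [|x y|i ir]; first exact: coprimen1.
    by rewrite coprimeMr => -> ->.
  by rewrite coprime_nth_prime//; apply: contraNneq jr => ->.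
rewrite natrM natrM -IH// totient_pfactor ?prime_nth_prime//= expnS.
rewrite mulrACA; congr (_ * _).
rewrite !natrM.
have b1 := nth_prime_gt1R j.
have -> : (nth_prime j).-1%:R = (nth_prime j)%:R - 1 :> R.
  by rewrite -subn1 natrB// ltnW// prime_gt1// prime_nth_prime.
have b0 : (nth_prime j)%:R - 1 != 0 :> R by rewrite gt_eqF// subr_gt0.
by field.
Qed.

Lemma sum_units p : \sum_(u : 'I_p.+2 | u \is a GRing.unit) 1 =
  (totient p.+2)%:R :> R.
Proof.
rewrite totient_count_coprime big_mkord natr_sum big_mkcond.
apply: eq_bigr => u _; rewrite -{1}[u]natr_Zp.
by rewrite (@unitZpE p.+2)//; case: ifP.
Qed.

End Totient.

Section StepBounds.
Context {R : realType} {dO : measure_display} {Om : measurableType dO}.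
Variables (P : probability Om R) (d : nat).
Variable X : nat -> 'I_d -> nat -> Om -> nat.
Hypothesis lawX : halton_pair_law P X.

Section FixedLevel.
Variables (K p : nat).
Hypothesis pN : p.+2 = (\prod_(j < d) nth_prime j ^ K.+1)%N.

Lemma integral_level i (phi : digits d K.+1 -> R) :
  (\int[P]_w (phi (level K.+1 X i w))%:E)%E = (\sum_s phi s * unif_prod s)%:E.
Proof.
rewrite (integral_finite P phi (level_finite_rv lawX i)).
congr (_%:E); apply: eq_bigr => s _; congr (_ * _).
rewrite (marginal (level_finite_rv lawX) (level_pair pN lawX) i i s).
exact: (sum_kernel_l pN lawX).
Qed.

Variable h : digits d K.+1 -> R.
Hypothesis h0 : \sum_s h s * unif_prod s = 0.

Lemma covar0 : covar h 0 = \sum_s h s ^+ 2 * unif_prod s.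
Proof.
apply: eq_bigr => s _; rewrite (bigD1 s)//= big1 ?addr0.
  by rewrite kernel_prod0 eqxx mul1r expr2.
by move=> t ts; rewrite kernel_prod0 eq_sym (negPf ts) mul0r mulr0.
Qed.

Let Q n : R := \sum_(i < n) \sum_(j < n) covar h (i%:R - j%:R : 'I_p.+2)%R.

Let Q_le n : Q n <= n%:R * gain R d * covar h 0.
Proof.
have := stationary_sum_le (covar_unit pN h) (covar_psd pN lawX h)
  (covar_sum pN lawX h0) n.
have T : (totient p.+2)%:R * gain R d = p.+2%:R by rewrite pN totient_gain.
rewrite sum_units -T => le.
have t0 : 0 < (totient p.+2)%:R :> R by rewrite ltr0n totient_gt0.
by rewrite -(ler_pM2l t0) (le_trans le)// le_eqVlt; apply/orP; left; apply/eqP; ring.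
Qed.

Lemma level_moment_le n :
  (\int[P]_w ((\sum_(i < n) h (level K.+1 X i w)) ^+ 2)%:E <=
   (n%:R * gain R d * \sum_s h s ^+ 2 * unif_prod s)%:E)%E.
Proof. by rewrite (second_moment_level pN lawX) lee_fin -covar0 Q_le. Qed.

(** Full periods cancel in both indices of the double sum; the linear bound is then applied to the
    remaining [n %% N] terms. *)
Lemma level_moment_bounded n :
  (\int[P]_w ((\sum_(i < n) h (level K.+1 X i w)) ^+ 2)%:E <=
   (p.+2%:R * gain R d * \sum_s h s ^+ 2 * unif_prod s)%:E)%E.
Proof.
rewrite (second_moment_level pN lawX) lee_fin.
have NR : p.+2%:R = 0 :> 'I_p.+2 by rewrite (@pchar_Zp p.+2).
have S0 (k : 'I_p.+2) : \sum_(i < p.+2) covar h (i%:R - k : 'I_p.+2)%R = 0.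
  rewrite -[RHS](covar_sum pN lawX h0) [RHS](reindex_inj (addIr (- k)))/=.
  by apply: eq_bigr => i _; rewrite natr_Zp.
have S1 (k : 'I_p.+2) : \sum_(i < p.+2) covar h (k - i%:R : 'I_p.+2)%R = 0.
  rewrite -[RHS](covar_sum pN lawX h0) [RHS](reindex_inj (@subrI _ k))/=.
  by apply: eq_bigr => i _; rewrite natr_Zp.
rewrite (@sum_periodic2 _ p.+2 n (fun i j => covar h (i%:R - j%:R : 'I_p.+2)%R)).
- apply: (le_trans (Q_le _)); rewrite covar0 -!mulrA ler_wpM2r//.
    rewrite mulr_ge0 ?gain_ge0//; apply: sumr_ge0 => s _.
    rewrite mulr_ge0 ?sqr_ge0//.
    by apply: prodr_ge0 => j _; apply: prodr_ge0 => l _; rewrite divr_ge0.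
  by rewrite ler_nat ltnW// ltn_pmod.
- by move=> i j; rewrite natrD NR add0r.
- by move=> i j; rewrite natrD NR add0r.
- by move=> j; exact: S0.
- by move=> i; exact: S1.
Qed.

End FixedLevel.

Definition depends (K : nat) (T : Type) (g : ('I_d -> nat -> nat) -> T) : Prop :=
  forall x y, (forall j l, (l < K)%N -> x j l = y j l) -> g x = g y.

Lemma dependsS K K' (T : Type) (g : ('I_d -> nat -> nat) -> T) :
  (K <= K')%N -> depends K g -> depends K' g.
Proof. by move=> KK' dg x y xy; apply: dg => j l lK; apply: xy; exact: leq_trans KK'. Qed.

Lemma step_mean_square_le (hd : (0 < d)%N) K (g : ('I_d -> nat -> nat) -> R) :
  depends K g -> exists m M, forall n,
  (\int[P]_w ((\sum_(i < n) (g (fun j l => X i j l w) - m)) ^+ 2)%:E <=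
     (n%:R * gain R d)%:E * \int[P]_w (g (fun j l => X 0%N j l w) ^+ 2)%:E)%E /\
  (\int[P]_w ((\sum_(i < n) (g (fun j l => X i j l w) - m)) ^+ 2)%:E <= M%:E)%E.
Proof.
move=> /(dependsS (leqnSn K)) dg.
(* Positivity of [d] and the passage from [K] to [K.+1] digits make the modulus at least 2. *)
have [p pN] : exists p, p.+2 = (\prod_(j < d) nth_prime j ^ K.+1)%N.
  case: d hd => [//|d' _].
  have : (1 < \prod_(j < d'.+1) nth_prime j ^ K.+1)%N.
    rewrite big_ord_recl expnS -mulnA; apply: (@leq_trans (2 * 1)) => //.
    rewrite leq_mul ?prime_gt1 ?prime_nth_prime// muln_gt0 expn_gt0 nth_prime_gt0 orTb andTb.
    by apply: prodn_gt0 => i; rewrite expn_gt0 nth_prime_gt0.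
  by case: (\prod_(j < d'.+1) _)%N => [|[|q]] // _; exists q.
pose G (s : digits d K.+1) := g (ext s).
pose m := \sum_(s : digits d K.+1) G s * unif_prod s.
pose h s := G s - m.
have GX i w : g (fun j l => X i j l w) = G (level K.+1 X i w).
  apply: dg => j l lK; case: lawX => Xb _ _.
  have [hX _] := restrP (level K.+1 X i w) (fun j l => Xb i j l w).
  exact: hX.
have h0 : \sum_s h s * unif_prod s = 0.
  under eq_bigr do rewrite mulrBl.
  by rewrite sumrB -mulr_sumr (sum_unif_prod pN lawX) mulr1 subrr.
exists m, (p.+2%:R * gain R d * \sum_s h s ^+ 2 * unif_prod s) => n.
have E w : \sum_(i < n) (g (fun j l => X i j l w) - m) =
    \sum_(i < n) h (level K.+1 X i w).
  by apply: eq_bigr => i _; rewrite GX.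
under eq_integral do rewrite E; split; last exact: level_moment_bounded.
rewrite (le_trans (level_moment_le pN h0 n))//.
under eq_integral do rewrite GX.
rewrite (integral_level pN 0%N (fun s => G s ^+ 2)) -EFinM lee_fin.
rewrite ler_wpM2l ?mulr_ge0 ?gain_ge0//.
(* [m] is the mean of [G], and centring lowers the second moment by [m ^+ 2]; so the bound can be
   stated with [g] itself. *)
have -> : \sum_s h s ^+ 2 * unif_prod s =
    \sum_s G s ^+ 2 * unif_prod s - m ^+ 2.
  transitivity (\sum_s (G s ^+ 2 * unif_prod s) - 2 * m * \sum_s (G s * unif_prod s)
      + m ^+ 2 * \sum_(s : digits d K.+1) unif_prod s).
    rewrite /h; move: (m) => c; rewrite !mulr_sumr -sumrB -big_split.
    by apply: eq_bigr => s _ /=; ring.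
  by rewrite (sum_unif_prod pN lawX) -/m; ring.
by rewrite lerBlDr lerDl sqr_ge0.
Qed.

End StepBounds.

(* The integer with base-[b] digits [u 0, .., u K.-1], most significant first. *)
Fixpoint cell (b : nat) (u : nat -> nat) (K : nat) : nat :=
  if K is K'.+1 then (b * cell b u K' + u K')%N else 0%N.

Lemma cell_inj b u v K : (forall l, u l < b)%N -> (forall l, v l < b)%N ->
  cell b u K = cell b v K -> forall l, (l < K)%N -> u l = v l.
Proof.
move=> ub vb; elim: K => [//|K IH] /= h l.
have b0 : (0 < b)%N by exact: leq_trans (ub 0%N).
have [q r] : cell b u K = cell b v K /\ u K = v K.
  split; move: h.
    move/(congr1 (divn^~ b)).
    by rewrite !(mulnC b) !divnMDl// !divn_small ?addn0 ?ub ?vb.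
  by move/(congr1 (modn^~ b)); rewrite !(mulnC b) !modnMDl !modn_small.
by rewrite ltnS leq_eqVlt => /orP[/eqP ->//|]; exact: IH.
Qed.

Lemma cell_dep b u v K : (forall l, (l < K)%N -> u l = v l) ->
  cell b u K = cell b v K.
Proof.
elim: K => [//|K IH] h /=; rewrite h// IH// => l lK.
by apply: h; exact: ltnW.
Qed.

Lemma exists_expV_le (R : realType) (b : nat) (e : R) : (1 < b)%N -> 0 < e ->
  exists K, b%:R ^- K <= e.
Proof.
(* Powers of [b] dominate those of 2, and [2 ^ K] exceeds [e^-1] from [K = Num.bound e^-1] on. *)
move=> b1 e0; exists (Num.bound e^-1).
rewrite -[leRHS]invrK lef_pV2 ?posrE ?exprn_gt0 ?invr_gt0 ?ltr0n ?(ltnW b1)//.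
apply: ltW; apply: (lt_le_trans (upper_nthrootP (leqnn _))).
by apply: lerXn2r; rewrite ?nnegrE ?ler0n// ler_nat.
Qed.

(** * Approximation by functions of finitely many digits *)

Section Frame.
Variables (R : realType) (d : nat).
Local Notation cube := (d.-tuple (measurableTypeR R)).
Local Notation digitseq := ('I_d -> nat -> nat).

(* The null set [Z] is empty for Halton points; for the identity of the cube it
   is needed outside [0, 1)^d, where truncation does not give the digits. *)
Definition digit_frame (dO : measure_display) (Om : measurableType dO)
    (P : probability Om R) (X : 'I_d -> nat -> Om -> nat) (x : Om -> cube) : Prop :=
  [/\ forall j l w, (X j l w < nth_prime j)%N,
      forall j l v, measurable (X j l @^-1` [set v]),
      measurable_fun [set: Om] x,
      forall K (s : digitseq),
        P [set w | forall j l, (l < K)%N -> X j l w = s j l] =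
        (\prod_(j < d) \prod_(l < K) ((s j l < nth_prime j)%N%:R / (nth_prime j)%:R))%:E &
      exists2 Z, measurable Z /\ P Z = 0%E & forall w, ~ Z w -> forall (j : 'I_d) K,
        (cell (nth_prime j) (fun l => X j l w) K)%:R / (nth_prime j)%:R ^+ K <= tnth (x w) j /\
        tnth (x w) j <= (cell (nth_prime j) (fun l => X j l w) K).+1%:R / (nth_prime j)%:R ^+ K].

Section OneFrame.
Context {dO : measure_display} {Om : measurableType dO}.
Variables (P : probability Om R) (X : 'I_d -> nat -> Om -> nat) (x : Om -> cube).
Hypothesis F : digit_frame P X x.

Definition frame_level K w : digits d K := restr K (fun j l => X j l w).

Lemma frame_levelP K w s :
  frame_level K w = s <-> forall j l, (l < K)%N -> X j l w = ext s j l.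
Proof. by case: F => Xb _ _ _ _; apply: restrP => j l; exact: Xb. Qed.

Lemma frame_finite_rv K : finite_rv (frame_level K).
Proof. by case: F => Xb mX _ _ _; apply: restr_finite_rv => // j l w; exact: Xb. Qed.

Lemma frame_level_prob K s : P (frame_level K @^-1` [set s]) = (unif_prod s)%:E.
Proof.
case: F => _ _ _ XP _.
have -> : frame_level K @^-1` [set s] =
    [set w | forall j l, (l < K)%N -> X j l w = ext s j l].
  by apply/seteqP; split => w /frame_levelP.
rewrite XP; congr (_%:E); apply: eq_bigr => j _; apply: eq_bigr => l _.
by rewrite extE.
Qed.

Lemma frame_dep K (T : Type) (g : digitseq -> T) w : depends K g ->
  g (fun j l => X j l w) = g (ext (frame_level K w)).
Proof. move=> dg; apply: dg => j l lK; have [h _] := frame_levelP w (frame_level K w).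
exact: h. Qed.

Lemma measurable_frame_event K (E : digitseq -> bool) : depends K E ->
  measurable [set w | E (fun j l => X j l w)].
Proof.
move=> dE; have -> : [set w | E (fun j l => X j l w)] =
    frame_level K @^-1` [set s | E (ext s)].
  by apply/seteqP; split => w /=; rewrite (frame_dep w dE).
exact/finite_rv_preimage/frame_finite_rv.
Qed.

Lemma frame_integral K (g : digitseq -> R) : depends K g ->
  (\int[P]_w (g (fun j l => X j l w))%:E)%E =
  (\sum_(s : digits d K) g (ext s) * unif_prod s)%:E.
Proof.
move=> dg; under eq_integral do rewrite (frame_dep _ dg).
rewrite (integral_finite P (fun s => g (ext s)) (@frame_finite_rv K)).
by congr (_%:E); apply: eq_bigr => s _; rewrite frame_level_prob.
Qed.

Lemma frame_event_prob K (E : digitseq -> bool) : depends K E ->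
  P [set w | E (fun j l => X j l w)] =
  (\sum_(s : digits d K) (E (ext s))%:R * unif_prod s)%:E.
Proof.
move=> dE; rewrite -(@frame_integral K (fun u => (E u)%:R)); last first.
  by move=> u v /dE ->.
rewrite -(setIT [set w | _]) -integral_indic//; last exact: measurable_frame_event dE.
by apply: eq_integral => w _; rewrite indicE mem_setE.
Qed.

Lemma measurable_mismatch K (E : digitseq -> bool) (A : set cube) :
  depends K E -> measurable A ->
  measurable [set w | `[< A (x w) >] != E (fun j l => X j l w)].
Proof.
case: F => _ _ mx _ _ dE mA.
have mxA : measurable (x @^-1` A) by rewrite -[X in measurable X]setTI; exact: mx.
have mE := measurable_frame_event dE.
have -> : [set w | `[< A (x w) >] != E (fun j l => X j l w)] =
    (x @^-1` A `\` [set w | E (fun j l => X j l w)]) `|`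
    ([set w | E (fun j l => X j l w)] `\` x @^-1` A).
  apply/seteqP; split => w /=.
    case: (pselect (A (x w))) => a.
      by rewrite asboolT//; case: (E _) => // _; left.
    by rewrite asboolF//; case: (E _) => // _; right.
  move=> [[a e]|[e a]]; first by rewrite asboolT//; move/negP/negPf: e => ->.
  by rewrite asboolF// e.
by apply: measurableU; exact: measurableD.
Qed.

(** The weight of a string is a product over the positions [(i, l)], so the sum over strings
    factors: positions of coordinate [j] give [1 / b] and all others give 1. *)
Lemma prob_prefix_le (j : 'I_d) K (v : nat -> nat) : (forall l, v l < nth_prime j)%N ->
  (P [set w | forall l, (l < K)%N -> X j l w = v l] <= ((nth_prime j)%:R ^- K)%:E)%E.
Proof.
move=> vb; pose E (u : digitseq) := [forall l : 'I_K, u j l == v l].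
have dE : depends K E.
  by move=> y z yz; apply: eq_forallb => l; rewrite yz.
have -> : [set w | forall l, (l < K)%N -> X j l w = v l] =
    [set w | E (fun j l => X j l w)].
  apply/seteqP; split => w /=; first by move=> h; apply/forallP => l; rewrite h.
  by move=> /forallP h l lK; apply/eqP; exact: (h (Ordinal lK)).
rewrite (frame_event_prob dE) lee_fin.
pose B := \max_(j < d) nth_prime j.
pose f (q : 'I_d * 'I_K) (y : 'I_B.+1) : R :=
  ((q.1 == j) ==> (y == v q.2 :> nat))%:R * ((y < nth_prime q.1)%N%:R / (nth_prime q.1)%:R).
have -> : \sum_(s : digits d K) (E (ext s))%:R * unif_prod s =
    \sum_(s : digits d K) \prod_q f q (s q).
  apply: eq_bigr => s _; rewrite /f big_split /=; congr (_ * _); last first.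
    by rewrite /unif_prod pair_bigA/=; apply: eq_bigr => -[].
  have [/forallP h|] := boolP (E (ext s)).
    rewrite big1// => -[i l] _ /=; case: eqVneq => [->|//].
    by rewrite -extE (eqP (h l)) eqxx.
  rewrite negb_forall => /existsP[l hl].
  by rewrite (bigD1 (j, l))//= -extE eqxx/= (negPf hl) mul0r.
rewrite -bigA_distr_bigA /=.
apply: (@le_trans _ _ (\prod_(q : 'I_d * 'I_K)
    (if q.1 == j then (nth_prime j)%:R^-1 else 1))); last first.
  rewrite -(pair_bigA _ (fun i (l : 'I_K) => if i == j then (nth_prime j)%:R^-1 else 1))/=.
  rewrite (bigD1 j)//= eqxx prodr_const card_ord exprVn big1 ?mulr1//.
  by move=> i /negPf ij; rewrite ij big1.
have pb i : (0 < nth_prime i)%N := nth_prime_gt0 i.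
apply: ler_prod => -[i l] _ /=; apply/andP; split.
  by apply: sumr_ge0 => y _; rewrite mulr_ge0// divr_ge0.
rewrite /f /=; case: eqVneq => [->|ij].
  have vB : (v l < B.+1)%N by rewrite ltnS (leq_trans (ltnW (vb l)))// leq_bigmax.
  rewrite (bigD1 (Ordinal vB))//= eqxx vb mul1r mul1r big1 ?addr0// => y yl.
  by rewrite (_ : (y == v l :> nat) = false) ?mul0r//; apply/negbTE.
under eq_bigr do rewrite mul1r.
rewrite -mulr_suml.
have -> : \sum_(y < B.+1) (y < nth_prime i)%N%:R = (nth_prime i)%:R :> R.
  have iB : (nth_prime i <= B.+1)%N 
    by rewrite (leq_trans (@leq_bigmax _ (fun j : 'I_d => nth_prime j) i)).
  under eq_bigr do rewrite -[X in X%:R]/(nat_of_bool _) mulrb.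
  by rewrite -big_mkcond -(big_ord_widen _ (fun=> 1) iB) sumr_const card_ord.
by rewrite mulfV ?pnatr_eq0 -?lt0n.
Qed.

End OneFrame.

(* The digit event [E] serves all frames at once, so it can be found on the
   cube and then used for the scrambled points. *)
Definition approx (A : set cube) : Prop := forall e : R, 0 < e ->
  exists K (E : digitseq -> bool), depends K E /\
  forall (dO : measure_display) (Om : measurableType dO) (P : probability Om R) X x,
    digit_frame P X x ->
    (P [set w | `[< A (x w) >] != E (fun j l => X j l w)] <= e%:E)%E.

(** Comparing [a] with the truncation to [K] digits goes wrong only in the cell that contains [a],
    of probability at most [b ^- K]. *)
Lemma approx_ray (j : 'I_d) (a : R) : approx ((@tnth d (measurableTypeR R))^~ j @^-1` `]a, +oo[%classic).
Proof.
move=> e e0.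
have [K Ke] := exists_expV_le (prime_gt1 (prime_nth_prime j)) e0.
set b := nth_prime j in Ke *.
have bK : 0 < b%:R ^+ K :> R by rewrite exprn_gt0// ltr0n nth_prime_gt0.
pose E (u : digitseq) := a < (cell b (u j) K)%:R / b%:R ^+ K.
have dE : depends K E.
  by move=> u v uv; rewrite /E (@cell_dep _ _ (v j))// => l lK; exact: uv.
exists K, E; split => //.
move=> dO Om P X x F; have mA : measurable ((@tnth d (measurableTypeR R))^~ j @^-1` `]a, +oo[%classic).
  by rewrite -[X in measurable X]setTI; apply: measurable_tnth.
have [Xb mX _ _ [Z [mZ PZ] HZ]] := F.
set D := [set w | _].
(* The cell number is the integer part of [a * b ^ K] on [C], so all of [C] shares one digit
   prefix. *)
pose C := [set w | (cell b (fun l => X j l w) K)%:R <= a * b%:R ^+ K <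
  (cell b (fun l => X j l w) K).+1%:R].
have DC : D `<=` Z `|` C.
  move=> w; have [Zw _|nZ] := pselect (Z w); first by left.
  have [l u] := HZ w nZ j K; rewrite /D /E /=.
  have [ax|ax] := ltP a (tnth (x w) j).
    rewrite asboolT/= ?in_itv/= ?ax// => h; right; rewrite /C/=.
    have {h} : (cell b (fun l => X j l w) K)%:R / b%:R ^+ K <= a.
      by rewrite leNgt; apply/negP => h'; rewrite h' in h.
    rewrite ler_pdivrMr// => -> /=.
    by rewrite -ltr_pdivlMr//; exact: lt_le_trans u.
  rewrite asboolF/= ?in_itv/= ?andbT; last by apply/negP; rewrite -leNgt.
  by rewrite ltNge (le_trans l ax).
have mD : measurable D := measurable_mismatch F dE mA.
(* A sample point of [C] supplies the prefix; if [C] is empty, the mismatch lies in the null set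
   [Z]. *)
have [[w0 Cw0]|nC] := pselect (exists w0, C w0); last first.
  apply: (@le_trans _ _ (P Z)); last by rewrite PZ lee_fin ltW.
  rewrite le_measure ?inE// => w /DC[//|Cw].
  by exfalso; apply: nC; exists w.
pose V := [set w | forall l, (l < K)%N -> X j l w = X j l w0].
have mV : measurable V.
  have -> : V = \bigcap_(l in [set: 'I_K]) X j l @^-1` [set X j l w0].
    apply/seteqP; split => w /=; first by move=> h l _; exact: h.
    by move=> h l lK; exact: (h (Ordinal lK) I).
  by apply: fin_bigcap_measurable.
have DV : D `<=` Z `|` V.
  move=> w /DC[Zw|Cw]; [by left|right].
  apply: (@cell_inj b (fun l => X j l w) (fun l => X j l w0)) => //.
  move: Cw Cw0 => /andP[c1 c2] /andP[c3 c4].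
  have := le_lt_trans c1 c4; have := le_lt_trans c3 c2.
  by rewrite !ltr_nat !ltnS => h1 h2; apply/eqP; rewrite eqn_leq h1 h2.
apply: (@le_trans _ _ (P (Z `|` V))).
  by rewrite le_measure ?inE//; exact: measurableU.
apply: (@le_trans _ _ (P Z + P V)%E); first exact: measureU2.
rewrite PZ add0e.
apply: le_trans (prob_prefix_le F K (fun l => Xb j l w0)) _.
by rewrite lee_fin.
Qed.

Lemma approx0 : approx set0.
Proof.
move=> e e0; exists 0%N, (fun=> false); split => // dO Om P X x F.
rewrite (_ : [set w | _] = set0) ?measure0 ?lee_fin ?ltW//.
by apply/seteqP; split => w //=; rewrite asboolF.
Qed.

Lemma approxC A : approx A -> approx (~` A).
Proof.
move=> aA e /aA[K [E [dE HE]]]; exists K, (fun u => ~~ E u); split.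
  by move=> u v /dE ->.
move=> dO Om P X x /HE; rewrite (_ : [set w | _ != ~~ _] =
  [set w | `[< A (x w) >] != E (fun j l => X j l w)])//.
by apply/funext => w /=; rewrite asbool_neg; congr (is_true _);
  case: (`[< _ >]) (E _) => -[].
Qed.

Lemma approxU A B : measurable A -> measurable B ->
  approx A -> approx B -> approx (A `|` B).
Proof.
move=> mA mB aA aB e e0; have e20 : 0 < e / 2 by rewrite divr_gt0.
have [K [E [dE HE]]] := aA _ e20; have [K' [E' [dE' HE']]] := aB _ e20.
have dEU : depends (maxn K K') (fun u => E u || E' u).
  move=> u v uv; rewrite (dE u v) ?(dE' u v)// => j l lK; apply: uv;
  by rewrite leq_max lK ?orbT.
exists (maxn K K'), (fun u => E u || E' u); split => //.
move=> dO Om P X x F; have {}HE := HE _ _ _ _ _ F; have {}HE' := HE' _ _ _ _ _ F.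
rewrite [e]splitr EFinD (le_trans _ (leeD HE HE'))//.
have m1 := measurable_mismatch F dE mA; have m2 := measurable_mismatch F dE' mB.
apply: le_trans (measureU2 _ m1 m2); rewrite le_measure ?inE//.
- by apply: (measurable_mismatch F dEU); exact: measurableU.
- exact: measurableU.
move=> w /=; have -> : `[< (A `|` B) (x w) >] = `[< A (x w) >] || `[< B (x w) >].
  by rewrite -asbool_or.
move=> h; have [|h1] := boolP (`[< A (x w) >] != E (fun j l => X j l w)); [by left|].
have [|h2] := boolP (`[< B (x w) >] != E' (fun j l => X j l w)); [by right|].
by move: h; rewrite (eqP (negPn h1)) (eqP (negPn h2)) eqxx.
Qed.

(** A digit event has the same probability in every frame, and [A] is within [e / 2] of one such
    event in both frames. Thus all frame points have the same law. *)
Lemma approx_prob_eq A (dO dO' : measure_display) (Om : measurableType dO)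
    (Om' : measurableType dO') (P : probability Om R) (P' : probability Om' R)
    X X' (x : Om -> cube) (x' : Om' -> cube) :
  measurable A -> approx A -> digit_frame P X x -> digit_frame P' X' x' ->
  P (x @^-1` A) = P' (x' @^-1` A).
Proof.
move=> mA aA F F'; apply/eqP; rewrite eq_le; apply/andP.
suff H (d1 d2 : measure_display) (O1 : measurableType d1) (O2 : measurableType d2)
    (P1 : probability O1 R) (P2 : probability O2 R) X1 X2 x1 x2 :
    digit_frame P1 X1 x1 -> digit_frame P2 X2 x2 ->
    (P1 (x1 @^-1` A) <= P2 (x2 @^-1` A))%E.
  by split; [exact: H F F'|exact: H F' F].
move=> F1 F2; apply/lee_addgt0Pr => e e0; have e20 : 0 < e / 2 by rewrite divr_gt0.
have [K [E [dE HE]]] := aA _ e20.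
have HE1 := HE _ _ _ _ _ F1; have HE2 := HE _ _ _ _ _ F2.
have mx d3 (O3 : measurableType d3) (P3 : probability O3 R) X3 x3 :
    digit_frame P3 X3 x3 -> measurable (x3 @^-1` A).
  by case=> _ _ mx3 _ _; rewrite -[X in measurable X]setTI; exact: mx3.
have m1 := measurable_mismatch F1 dE mA; have m2 := measurable_mismatch F2 dE mA.
have e1 := measurable_frame_event F1 dE; have e2 := measurable_frame_event F2 dE.
apply: (@le_trans _ _ (P1 [set w | E (fun j l => X1 j l w)] + (e / 2)%:E)%E).
  apply: le_trans (leeD (lexx _) HE1); apply: le_trans (measureU2 _ e1 m1).
  rewrite le_measure ?inE//; [exact: mx F1|exact: measurableU|].
  move=> w /= Aw; have [|nE] := boolP (E (fun j l => X1 j l w)); [by left|right].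
  by rewrite asboolT.
rewrite (frame_event_prob F1 dE) -(frame_event_prob F2 dE).
rewrite [in leRHS](splitr e) EFinD addeA leeD2r//.
apply: le_trans (leeD (lexx _) HE2); apply: le_trans (measureU2 _ (mx _ _ _ _ _ F2) m2).
rewrite le_measure ?inE//; first by apply: measurableU => //; exact: mx F2.
move=> w /= Ew; have [Aw|nA] := pselect (A (x2 w)); [by left|right].
by rewrite asboolF//= Ew.
Qed.

Lemma measurable_frame_preimage A (dO : measure_display) (Om : measurableType dO)
    (P : probability Om R) X (x : Om -> cube) :
  measurable A -> digit_frame P X x -> measurable (x @^-1` A).
Proof. by move=> mA [_ _ mx _ _]; rewrite -[X in measurable X]setTI; exact: mx. Qed.

Section Reference.
Context {d0 : measure_display} {O0 : measurableType d0}.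
Variables (P0 : probability O0 R) (X0 : 'I_d -> nat -> O0 -> nat) (x0 : O0 -> cube).
Hypothesis F0 : digit_frame P0 X0 x0.

(** The finite union approximating the countable one must be chosen before the frame is known. It is
    chosen in the reference frame, and [approx_prob_eq] transfers the size of the tail to every
    other frame. *)
Lemma approx_bigcup (A : nat -> set cube) : (forall i, measurable (A i)) ->
  (forall i, approx (A i)) -> approx (\bigcup_i A i).
Proof.
move=> mA aA; pose B n := \big[setU/set0]_(i < n.+1) A i.
have mB n : measurable (B n) by exact: bigsetU_measurable.
have aB n : approx (B n).
  suff H m : approx (\big[setU/set0]_(i < m) A i) by exact: H.
  elim: m => [|m IH]; first by rewrite big_ord0; exact: approx0.
  by rewrite big_ord_recr; apply: approxU => //; exact: bigsetU_measurable.
have UB : \bigcup_n B n = \bigcup_i A i by exact: bigcup_bigsetU_bigcup.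
have mU : measurable (\bigcup_i A i) by exact: bigcupT_measurable.
have cvgB (dO : measure_display) (Om : measurableType dO) (P : probability Om R) X x :
    digit_frame P X x -> P (x @^-1` B n) @[n --> \oo] --> P (x @^-1` \bigcup_i A i).
  move=> F; have mxB n := measurable_frame_preimage (mB n) F.
  rewrite -UB preimage_bigcup; apply: nondecreasing_cvg_mu => //.
    by rewrite -preimage_bigcup UB; exact: measurable_frame_preimage F.
  move=> m n mn; apply/subsetPset => w /=; exact: (@subset_bigsetU _ _ m.+1 n.+1).
have c0 := cvgB _ _ _ _ _ F0.
have nd0 : nondecreasing_seq (fun n => P0 (x0 @^-1` B n)).
  move=> m n mn; rewrite le_measure ?inE//.
  - exact: measurable_frame_preimage F0.
  - exact: measurable_frame_preimage F0.
  - by move=> w /=; exact: (@subset_bigsetU _ _ m.+1 n.+1).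
move=> e e0; have e20 : 0 < e / 2 by rewrite divr_gt0.
have [m Hm] : exists m, (P0 (x0 @^-1` \bigcup_i A i) - (e / 2)%:E <= P0 (x0 @^-1` B m))%E.
  have fin : P0 (x0 @^-1` \bigcup_i A i) \is a fin_num.
    by rewrite fin_num_measure//; exact: measurable_frame_preimage F0.
  have : (((fine (P0 (x0 @^-1` \bigcup_i A i)) - e / 2)%:E) < limn (fun n => P0 (x0 @^-1` B n)))%E.
    rewrite (cvg_lim _ c0)// -{2}(fineK fin) lte_fin.
    by rewrite ltrBlDr ltrDl.
  move=> /(lte_lim nd0 (cvgP _ c0)) [m _ /(_ m (leqnn m)) /=].
  by rewrite EFinB fineK//; exists m.
have [K [E [dE HE]]] := aB m _ e20.
exists K, E; split => // dO Om P X x F.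
have mxB := measurable_frame_preimage (mB m) F.
have mxU := measurable_frame_preimage mU F.
have BU : x @^-1` B m `<=` x @^-1` \bigcup_i A i.
  by rewrite -UB => w Bw; exists m.
have PU : P (x @^-1` \bigcup_i A i) = P0 (x0 @^-1` \bigcup_i A i).
  apply: (cvg_unique _ (cvgB _ _ _ _ _ F)) => //.
  rewrite (_ : (fun n => P (x @^-1` B n)) = fun n => P0 (x0 @^-1` B n))//.
  by apply/funext => n; exact: (approx_prob_eq (mB n) (aB n) F F0).
have tail : (P (x @^-1` (\bigcup_i A i) `\` x @^-1` B m) <= (e / 2)%:E)%E.
  have -> : P (x @^-1` (\bigcup_i A i) `\` x @^-1` B m) =
      (P (x @^-1` \bigcup_i A i) - P (x @^-1` B m))%E.
    rewrite measureD//; first by rewrite (setIidr BU).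
    by rewrite (le_lt_trans (probability_le1 _ _)) ?ltry.
  rewrite PU (approx_prob_eq (mB m) (aB m) F F0).
  rewrite leeBlDr; last first.
    by rewrite fin_num_measure//; exact: measurable_frame_preimage F0.
  by rewrite addeC -leeBlDr.
have mD := measurable_mismatch F dE (mB m).
have mT : measurable (x @^-1` (\bigcup_i A i) `\` x @^-1` B m) by exact: measurableD.
rewrite [e]splitr EFinD (le_trans _ (leeD (HE _ _ _ _ _ F) tail))//.
apply: le_trans (measureU2 _ mD mT); rewrite le_measure ?inE//.
- exact: (measurable_mismatch F dE mU).
- exact: measurableU.
move=> w /= h; have [Bw|nB] := pselect (B m (x w)).
  by left; rewrite asboolT//; move: h; rewrite asboolT//; exact: BU.
have [Uw|nU] := pselect ((\bigcup_i A i) (x w)); first by right.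
by left; rewrite asboolF//; move: h; rewrite asboolF.
Qed.

(** Approximable measurable sets form a sigma-algebra. The argument runs twice: on the line, from
    open rays to Borel sets of one coordinate, then on the cube, from these to all measurable
    sets. *)
Lemma approx_measurable (A : set cube) : measurable A -> approx A.
Proof.
pose H := [set B : set cube | measurable B /\ approx B].
have sH : sigma_algebra setT H.
  split.
  - by split; [exact: measurable0|exact: approx0].
  - by move=> B [mB aB]; rewrite setTD; split; [exact: measurableC|exact: approxC].
  - move=> B hB; split; first by apply: bigcupT_measurable => i; case: (hB i).
    by apply: approx_bigcup => i; case: (hB i).
suff : measurable `<=` H by move=> h mA; case: (h A mA).
apply: smallest_sub => //.
elim/big_ind: _ => [//|B C hB hC D [/hB//|/hC//]|j _] D [B mB <-].
rewrite setTI; move: mB.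
pose f := (@tnth d (measurableTypeR R))^~ j.
have mf : measurable_fun setT f by exact: measurable_tnth.
pose G := [set C : set (measurableTypeR R) | measurable C /\ approx (f @^-1` C)].
suff h : measurable `<=` G.
  move=> /h[mB aB]; split => //.
  by rewrite -[X in measurable X]setTI; exact: mf.
have mfC C : measurable C -> measurable (f @^-1` C).
  by move=> mC; rewrite -[X in measurable X]setTI; exact: mf.
rewrite [X in X `<=` _](_ : _ = <<s @RGenOInfty.G R >>); last exact: RGenOInfty.measurableE.
apply: smallest_sub.
  split.
  - by split; [exact: measurable0|exact: approx0].
  - move=> C [mC aC]; rewrite setTD; split; first exact: measurableC.
    by rewrite preimage_setC; exact: approxC.
  - move=> C hC; split; first by apply: bigcupT_measurable => i; case: (hC i).
    rewrite preimage_bigcup; apply: approx_bigcup => i; case: (hC i) => // mC _.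
    exact: mfC.
move=> _ [a ->]; split; first exact: measurable_itv.
exact: approx_ray.
Qed.

End Reference.
End Frame.

Import HBSimple HBNNSimple.

(** * Lebesgue measure as a digit frame, and approximation in L^2 *)

Section LebesgueFrame.
Variable R : realType.

Definition real_digit (b l : nat) (t : R) : nat := (Num.truncn (t * b%:R ^+ l.+1) %% b)%N.

Lemma measurable_truncn (n : nat) (c : R) :
  measurable [set t : measurableTypeR R | Num.truncn (t * c) = n].
Proof.
have mc : measurable_fun [set: measurableTypeR R] (fun t => t * c : measurableTypeR R).
  exact: measurable_funM.
pose A (i : interval R) := (fun t : measurableTypeR R => t * c) @^-1` [set` i].
have mA i : measurable (A i).
  by rewrite -[X in measurable X]setTI; apply: mc => //; exact: measurable_itv.
(* [Num.truncn] sends negative numbers to 0, hence the extra half-line when [n = 0]. *)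
have -> : [set t : measurableTypeR R | Num.truncn (t * c) = n] =
    A `[n%:R, n.+1%:R[ `|` (A `]-oo, 0[ `&` [set _ | n = 0%N]).
  apply/seteqP; split => t /=; rewrite /A/= !in_itv/=.
    move=> <-; have [t0|t0] := leP 0 (t * c); first by left; exact: truncn_itv.
    by right; split => //; apply/truncn0Pn; rewrite -ltNge (lt_trans t0).
  move=> [/truncn_def//|[t0 ->]]; apply/truncn0Pn.
  by rewrite -ltNge (lt_trans t0).
apply: measurableU => //; case: n => [|n].
  by rewrite (_ : [set _ | _] = setT) ?setIT//; apply/seteqP.
by rewrite (_ : [set _ | _] = set0) ?setI0//; apply/seteqP; split.
Qed.

Lemma measurable_real_digit (b l v : nat) :
  measurable ((fun t : measurableTypeR R => real_digit b l t) @^-1` [set v]).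
Proof.
rewrite (_ : _ @^-1` _ = \bigcup_(n in [set n | (n %% b)%N = v])
  [set t : measurableTypeR R | Num.truncn (t * b%:R ^+ l.+1) = n]).
  by apply: bigcup_measurable => n _; exact: measurable_truncn.
by apply/seteqP; split => t /=; [move=> h; eexists; [exact: h|]|case=> n /= <- <-].
Qed.

Lemma truncn_div (b : nat) (y : R) : (0 < b)%N -> 0 <= y ->
  (Num.truncn (y * b%:R) %/ b)%N = Num.truncn y.
Proof.
move=> b0 y0; have bR : 0 < b%:R :> R by rewrite ltr0n.
apply/esym/truncn_def.
have /truncn_itv/andP[h1 h2] : 0 <= y * b%:R by rewrite mulr_ge0// ltW.
apply/andP; split.
  rewrite -(ler_pM2r bR) -natrM; apply: le_trans h1.
  by rewrite ler_nat leq_divM.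
rewrite -(ltr_pM2r bR) -natrM; apply: (lt_le_trans h2).
by rewrite ler_nat ltn_ceil.
Qed.

Lemma cell_real_digit (b K : nat) (t : R) : (0 < b)%N -> 0 <= t < 1 ->
  cell b (fun l => real_digit b l t) K = Num.truncn (t * b%:R ^+ K).
Proof.
move=> b0 /andP[t0 t1]; elim: K => [|K IH].
  by rewrite expr0 mulr1; apply/esym/truncn0Pn; rewrite -ltNge.
rewrite /= IH /real_digit -(@truncn_div b (t * b%:R ^+ K))//; last first.
  by rewrite mulr_ge0// exprn_ge0.
by rewrite exprSr mulrA mulnC -divn_eq.
Qed.

Lemma cell_lt b u K : (forall l, (l < K)%N -> (u l < b)%N) -> (cell b u K < b ^ K)%N.
Proof.
elim: K => [//|K IH] h /=.
have {}IH : (cell b u K < b ^ K)%N by apply: IH => l lK; apply: h; exact: ltnW.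
rewrite expnS; apply: (@leq_trans (b * (cell b u K).+1)); last by rewrite leq_mul2l IH orbT.
by rewrite mulnS addnC ltn_add2r h.
Qed.

Lemma cell_inj_le b u v K : (forall l, (l < K)%N -> (u l < b)%N) ->
  (forall l, (l < K)%N -> (v l < b)%N) -> (0 < b)%N ->
  cell b u K = cell b v K -> forall l, (l < K)%N -> u l = v l.
Proof.
move=> ub vb b0 h l lK.
(* Replacing the digits past [K] by 0 keeps the cell and meets the bound that [cell_inj] asks at
   every position. *)
pose r (w : nat -> nat) i := if (i < K)%N then w i else 0%N.
have E w : cell b w K = cell b (r w) K.
  by apply: cell_dep => i iK; rewrite /r iK.
have := @cell_inj b (r u) (r v) K; rewrite -!E => /(_ _ _ h l lK).
by rewrite /r lK; apply=> i; case: ifP => // iK; [exact: ub|exact: vb].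
Qed.

Lemma lebesgue01_prefix (b K : nat) (s : nat -> nat) : (0 < b)%N ->
  lebesgue01 R [set t | forall l, (l < K)%N -> real_digit b l t = s l] =
  (\prod_(l < K) ((s l < b)%N%:R / b%:R))%:E.
Proof.
move=> b0; have [vs|] := boolP [forall l : 'I_K, (s l < b)%N]; last first.
  rewrite negb_forall => /existsP[l sl].
  rewrite (bigD1 l)//= (negPf sl) !mul0r (_ : [set t | _] = set0) ?measure0//.
  apply/seteqP; split => t //= /(_ l (ltn_ord l)) E.
  by move: sl; rewrite -E ltn_pmod.
have {}vs l : (l < K)%N -> (s l < b)%N by move=> lK; exact: (forallP vs (Ordinal lK)).
have bK : 0 < b%:R ^+ K :> R by rewrite exprn_gt0// ltr0n.
under eq_bigr => l _ do rewrite vs// mul1r.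
rewrite prodr_const card_ord exprVn.
pose c : R := (cell b s K)%:R / b%:R ^+ K.
pose c' : R := (cell b s K).+1%:R / b%:R ^+ K.
have c0 : 0 <= c by rewrite divr_ge0// ltW.
have c1 : c' <= 1.
  rewrite ler_pdivrMr// mul1r -natrX ler_nat; exact: cell_lt.
have cc' : c < c' by rewrite ltr_pM2r ?invr_gt0// ltr_nat.
set A := [set t | _].
have AE : A `&` `[0, 1[ = `[c, c'[%classic.
  apply/seteqP; split => t /=; rewrite !in_itv/=.
    move=> [At t01].
    have := cell_real_digit K b0 t01.
    rewrite (@cell_dep _ _ s)// => E.
    have /truncn_itv : 0 <= t * b%:R ^+ K by case/andP: t01 => t0 _; rewrite mulr_ge0// ltW.
    by rewrite -E ler_pdivrMr// ltr_pdivlMr.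
  move=> /andP[ct tc]; have t01 : 0 <= t < 1 by rewrite (le_trans c0)// (lt_le_trans tc).
  split => //; have E := cell_real_digit K b0 t01.
  apply: (@cell_inj_le b (fun l => real_digit b l t) s K) => //.
    by move=> l _; rewrite /real_digit ltn_pmod.
  rewrite E; apply: truncn_def.
  by rewrite -ler_pdivrMr// ct -ltr_pdivlMr.
have mA : measurable (A : set (measurableTypeR R)).
  have -> : A = \bigcap_(l in [set: 'I_K])
      ((fun t : measurableTypeR R => real_digit b l t) @^-1` [set s l]).
    apply/seteqP; split => t /=; first by move=> h l _; exact: h.
    by move=> h l lK; exact: (h (Ordinal lK) I).
  by apply: fin_bigcap_measurable => // l _; exact: measurable_real_digit.
have L1 : lebesgue_measure (`[c, c'[%classic : set R) = (b%:R ^- K)%:E.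
  rewrite lebesgue_measure_itv/= lte_fin cc' -EFinB; congr (_%:E).
  by rewrite /c /c' -mulrBl -natrB// subSnn mul1r.
have mI : measurable (A `&` `[0, 1] : set (measurableTypeR R)).
  by apply: measurableI => //; exact: measurable_itv.
(* The reference interval is closed, and the point 1, whose digits all come out as 0, may belong to
   [A]; it is absorbed as a null set. *)
rewrite /lebesgue01 /mrestr -L1; apply/eqP; rewrite eq_le; apply/andP; split.
  apply: (@le_trans _ _ (lebesgue_measure (`[c, c'[%classic `|` [set 1] : set R))).
    rewrite le_measure ?inE//; first by apply: measurableU => //; exact: measurable_itv.
    move=> t [At /=]; rewrite in_itv/= => /andP[t0 t1].
    have [t1'|t1'] := ltP t 1; last by right; apply/eqP; rewrite eq_le t1 t1'.
    have : (A `&` `[0, 1[) t by split => //=; rewrite in_itv/= t0.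
    by rewrite AE; left.
  apply: (@le_trans _ _ (lebesgue_measure (`[c, c'[%classic : set R) +
      lebesgue_measure ([set 1%R] : set R))%E).
    by apply: measureU2 => //; exact: measurable_itv.
  by rewrite lebesgue_measure_set1 adde0.
rewrite le_measure ?inE//.
by rewrite -AE => t [At /=]; rewrite !in_itv/= => /andP[t0 /ltW t1]; split => //=; rewrite t0.
Qed.

Variable d : nat.

Lemma lebesgue_frame : digit_frame (lebesgue_cube R d)
  (fun j l w => real_digit (nth_prime j) l (tnth w j)) id.
Proof.
split => //.
- by move=> j l w; rewrite ltn_pmod// nth_prime_gt0.
- move=> j l v.
  rewrite -[X in measurable X]setTI.
  have mt : measurable_fun setT ((@tnth d (measurableTypeR R))^~ j) by exact: measurable_tnth.
  exact: (mt measurableT _ (measurable_real_digit (nth_prime j) l v)).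
- move=> K s; pose A (j : 'I_d) := [set t : measurableTypeR R |
    forall l, (l < K)%N -> real_digit (nth_prime j) l t = s j l].
  have mA j : measurable (A j).
    have -> : A j = \bigcap_(l in [set: 'I_K])
        ((fun t : measurableTypeR R => real_digit (nth_prime j) l t) @^-1` [set s j l]).
      apply/seteqP; split => t /=; first by move=> h l _; exact: h.
      by move=> h l lK; exact: (h (Ordinal lK) I).
    by apply: fin_bigcap_measurable => // l _; exact: measurable_real_digit.
  rewrite -prodEFin -(eq_bigr _ (fun j _ => lebesgue01_prefix K (s j) (nth_prime_gt0 j))).
  by rewrite -lebesgue_cube_box//; congr (lebesgue_cube R d _).
pose G := [set w : d.-tuple (measurableTypeR R) | forall j, `[0, 1[%classic (tnth w j)].
have PG : lebesgue_cube R d G = 1%E.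
  rewrite (@lebesgue_cube_box R d (fun=> `[0, 1[%classic)); last by move=> j; exact: measurable_itv.
  rewrite big1// => j _; rewrite /lebesgue01 /mrestr (_ : _ `&` _ = `[0, 1[%classic).
    by rewrite lebesgue_measure_itv/= lte_fin ltr01 oppr0 adde0.
  by apply/seteqP; split => t /=; [case|]; rewrite !in_itv/=; [by []|move=> /andP[-> /[dup] t1 /ltW ->]].
have mG : measurable G.
  rewrite (_ : G = \bigcap_(j in [set: 'I_d])
      ((@tnth d (measurableTypeR R))^~ j @^-1` `[0, 1[%classic)).
    apply: fin_bigcap_measurable => // j _.
    rewrite -[X in measurable X]setTI.
    by apply: measurable_tnth => //; exact: measurable_itv.
  by apply/seteqP; split => w /= h j; [move=> _|]; exact: h.
exists (~` G); first by split; [exact: measurableC|rewrite probability_setC// PG subee].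
move=> w /contrapT Gw j K.
have /= := Gw j; rewrite in_itv/= => t01.
have b0 := nth_prime_gt0 j.
have bK : 0 < (nth_prime j)%:R ^+ K :> R by rewrite exprn_gt0// ltr0n.
rewrite cell_real_digit// ler_pdivrMr// ler_pdivlMr//.
have /truncn_itv/andP[h1 h2] : 0 <= tnth w j * (nth_prime j)%:R ^+ K.
  by case/andP: t01 => t0 _; rewrite mulr_ge0// ltW.
by split => //; exact: ltW.
Qed.

Local Notation cube := (d.-tuple (measurableTypeR R)).
Local Notation digitseq := ('I_d -> nat -> nat).

(** Comparison with the Lebesgue frame: every frame point, in particular every scrambled Halton
    point, is uniform on the cube. *)
Lemma frame_law (dO : measure_display) (Om : measurableType dO)
    (P : probability Om R) X (x : Om -> cube) (F : digit_frame P X x)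
    (h : cube -> \bar R) :
  measurable_fun setT h -> (forall y, 0 <= h y)%E ->
  (\int[P]_w h (x w) = \int[lebesgue_cube R d]_y h y)%E.
Proof.
move=> mh h0; case: (F) => _ _ mx _ _.
pose mxT : {mfun Om >-> cube} := HB.pack x (@isMeasurableFun.Build _ _ _ _ x mx).
transitivity (\int[distribution P mxT]_y h y)%E.
  by rewrite ge0_integral_distribution.
apply: eq_measure_integral => A mA _.
have := approx_prob_eq mA (approx_measurable lebesgue_frame mA) F lebesgue_frame.
by [].
Qed.

(** As in [approx], [g] is chosen before the frame, so that one [g] serves all points of the
    sequence. *)
Definition L2approx (f : cube -> R) : Prop := forall e : R, 0 < e ->
  exists K (g : digitseq -> R), depends K g /\
  forall (dO : measure_display) (Om : measurableType dO) (P : probability Om R) X x,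
    digit_frame P X x ->
    (\int[P]_w ((f (x w) - g (fun j l => X j l w)) ^+ 2)%:E <= e%:E)%E.

(** The squared difference of two indicators is the indicator of their mismatch. *)
Lemma L2approx_indic A : measurable A -> L2approx \1_A.
Proof.
move=> mA e e0; have [K [E [dE HE]]] := approx_measurable lebesgue_frame mA e0.
exists K, (fun u => (E u)%:R); split; first by move=> u v /dE ->.
move=> dO Om P X x F; apply: le_trans (HE _ _ _ _ _ F).
have mD := measurable_mismatch F dE mA.
set D := [set w | _].
have -> : P D = (\int[P]_w (\1_D w)%:E)%E by rewrite integral_indic// setIT.
rewrite le_eqVlt; apply/orP; left; apply/eqP; apply: eq_integral => w _; congr (_%:E).
rewrite !indicE; have -> : (x w \in A) = `[< A (x w) >] by [].
have -> : (w \in D) =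
  (`[< A (x w) >] != E (fun j l => X j l w)).
  by apply/idP/idP; rewrite inE.
by case: (`[< _ >]) (E _) => -[] /=; rewrite ?subrr ?subr0 ?sub0r ?sqrrN ?expr1n ?expr0n.
Qed.

Lemma measurable_frame_fun (dO : measure_display) (Om : measurableType dO)
    (P : probability Om R) X (x : Om -> cube) (F : digit_frame P X x)
    K (g : digitseq -> R) : depends K g ->
  measurable_fun [set: Om] (fun w => g (fun j l => X j l w)).
Proof.
move=> dg; under eq_fun do rewrite (frame_dep F _ dg).
exact: (measurable_fun_finite (fun s => g (ext s)) (frame_finite_rv F (K := K))).
Qed.

Lemma measurable_frame_comp (dO : measure_display) (Om : measurableType dO)
    (P : probability Om R) X (x : Om -> cube) (F : digit_frame P X x)
    (f : cube -> R) : measurable_fun setT f ->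
  measurable_fun [set: Om] (fun w => f (x w)).
Proof. by case: F => _ _ mx _ _ mf; exact: measurableT_comp mx. Qed.

Lemma integral_sqrD_le (dO : measure_display) (Om : measurableType dO)
    (P : probability Om R) (u v : Om -> R) :
  measurable_fun setT u -> measurable_fun setT v ->
  (\int[P]_w ((u w + v w) ^+ 2)%:E <=
   2%:E * \int[P]_w (u w ^+ 2)%:E + 2%:E * \int[P]_w (v w ^+ 2)%:E)%E.
Proof.
move=> mu mv; have mu2 := measurable_sqr mu; have mv2 := measurable_sqr mv.
rewrite -muleDr//; last by rewrite ge0_adde_def// inE; apply: integral_ge0 => w _; rewrite lee_fin sqr_ge0.
rewrite -ge0_integralD//; try by move=> w _; rewrite lee_fin sqr_ge0.
rewrite -ge0_integralZl//; last 2 first.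
- exact: emeasurable_funD.
- by move=> w _; rewrite -EFinD lee_fin addr_ge0 ?sqr_ge0.
apply: ge0_le_integral => //.
- by move=> w _; rewrite lee_fin sqr_ge0.
- by apply: measurable_sqr; exact: measurable_funD.
- by apply: measurable_funeM; exact: emeasurable_funD.
- move=> w _; rewrite -EFinD -EFinM lee_fin.
  by have := sqr_ge0 (u w - v w); nra.
Qed.

Lemma L2approxD (f f' : cube -> R) : measurable_fun setT f -> measurable_fun setT f' ->
  L2approx f -> L2approx f' -> L2approx (fun y => f y + f' y).
Proof.
move=> mf mf' af af' e e0; have e40 : 0 < e / 4 by rewrite divr_gt0.
have [K [g [dg Hg]]] := af _ e40; have [K' [g' [dg' Hg']]] := af' _ e40.
exists (maxn K K'), (fun u => g u + g' u); split.
  move=> u v uv; rewrite (dg u v) ?(dg' u v)// => j l lK; apply: uv;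
  by rewrite leq_max lK ?orbT.
move=> dO Om P X x F; have {}Hg := Hg _ _ _ _ _ F; have {}Hg' := Hg' _ _ _ _ _ F.
have m1 : measurable_fun setT (fun w => f (x w) - g (fun j l => X j l w)).
  by apply: measurable_funB; [exact: (measurable_frame_comp F)|exact: (measurable_frame_fun F dg)].
have m2 : measurable_fun setT (fun w => f' (x w) - g' (fun j l => X j l w)).
  by apply: measurable_funB; [exact: (measurable_frame_comp F)|exact: (measurable_frame_fun F dg')].
apply: (@le_trans _ _ (2%:E * (e / 4)%:E + 2%:E * (e / 4)%:E)%E); last first.
  by rewrite -EFinM -EFinD lee_fin; lra.
apply: (@le_trans _ _ (2%:E * \int[P]_w ((f (x w) - g (fun j l => X j l w)) ^+ 2)%:E +
   2%:E * \int[P]_w ((f' (x w) - g' (fun j l => X j l w)) ^+ 2)%:E)%E).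
  apply: le_trans (integral_sqrD_le _ m1 m2).
  rewrite le_eqVlt; apply/orP; left; apply/eqP; apply: eq_integral => w _.
  by congr (_%:E); ring.
by apply: leeD; apply: lee_wpmul2l.
Qed.

Lemma L2approxZ (f : cube -> R) c : measurable_fun setT f -> L2approx f ->
  L2approx (fun y => c * f y).
Proof.
move=> mf af e e0.
(* Dividing by [c ^+ 2 + 1] avoids a separate case [c = 0]. *)
have c0 : 0 < c ^+ 2 + 1 by rewrite ltr_wpDl ?sqr_ge0.
have e'0 : 0 < e / (c ^+ 2 + 1) by rewrite divr_gt0.
have [K [g [dg Hg]]] := af _ e'0.
exists K, (fun u => c * g u); split; first by move=> u v /dg ->.
move=> dO Om P X x F; have {}Hg := Hg _ _ _ _ _ F.
apply: (@le_trans _ _ ((c ^+ 2)%:E * (e / (c ^+ 2 + 1))%:E)%E); last first.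
  rewrite -EFinM lee_fin mulrCA ger_pMr// ler_pdivrMr// mul1r; lra.
have m1 : measurable_fun setT (fun w => f (x w) - g (fun j l => X j l w)).
  by apply: measurable_funB; [exact: (measurable_frame_comp F)|exact: (measurable_frame_fun F dg)].
apply: le_trans (lee_wpmul2l _ Hg); last by rewrite lee_fin sqr_ge0.
rewrite -ge0_integralZl//; last 3 first.
- exact: measurable_sqr.
- by move=> w _; rewrite lee_fin sqr_ge0.
- by rewrite lee_fin sqr_ge0.
rewrite le_eqVlt; apply/orP; left; apply/eqP; apply: eq_integral => w _.
by rewrite -EFinM; congr (_%:E); ring.
Qed.

Lemma L2approx_simple (f : {nnsfun cube >-> R}) : L2approx f.
Proof.
pose s := fset_set (range f).
have -> : (f : cube -> R) =
    fun y => \sum_(i < #|` s|) (s`_i * \1_(f @^-1` [set s`_i]) y).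
  by apply/funext => y; exact: fimfunEord.
have mi i : measurable_fun setT (fun y => s`_i * \1_(f @^-1` [set s`_i]) y : R).
  by apply: measurable_funM => //; apply: measurable_indic; exact: measurable_sfunP.
elim: (#|` s|) => [|n IH].
  move=> e e0; exists 0%N, (fun=> 0); split => // dO Om P X x F.
  under eq_integral do rewrite big_ord0 subr0 expr0n/=.
  by rewrite integral0 lee_fin ltW.
rewrite (_ : (fun y => _) = fun y => (\sum_(i < n) (s`_i * \1_(f @^-1` [set s`_i]) y)) +
   s`_n * \1_(f @^-1` [set s`_n]) y); last first.
  by apply/funext => y; rewrite big_ord_recr.
apply: L2approxD => //; first by apply: measurable_sum => i; exact: mi.
apply: L2approxZ; first by apply: measurable_indic; exact: measurable_sfunP.
by apply: L2approx_indic; exact: measurable_sfunP.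
Qed.

(** Increasing simple functions converge to [f] in mean square on the cube, by domination by
    [f ^+ 2]; a simple function is then replaced by a function of digits. *)
Lemma L2approx_ge0 (f : cube -> R) : measurable_fun setT f -> (forall y, 0 <= f y) ->
  (\int[lebesgue_cube R d]_y (f y ^+ 2)%:E < +oo)%E -> L2approx f.
Proof.
move=> mf f0 foo e e0.
have mfE : measurable_fun setT (EFin \o f) by exact/measurable_EFinP.
pose fn := nnsfun_approx measurableT mfE.
have fn_cvg y : EFin \o fn^~ y @ \oo --> (f y)%:E.
  by apply: cvg_nnsfun_approx => // z _; rewrite lee_fin.
have fn_le n y : fn n y <= f y.
  rewrite /fn nnsfun_approxE -lee_fin.
  by apply: le_approx => // z _; rewrite lee_fin.
have [] := @dominated_convergence _ _ _ (lebesgue_cube R d) setT measurableT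
  (fun n y => ((f y - fn n y) ^+ 2)%:E) (cst 0%E) (fun y => (f y ^+ 2)%:E).
- by move=> n; apply: measurable_sqr; exact: measurable_funB.
- exact: measurable_cst.
- apply: aeW => y _.
  have h : (f y - fn n y) ^+ 2 @[n --> \oo] --> (0 : R).
    rewrite -[X in _ --> X](_ : (f y - f y) ^+ 2 = 0); last by rewrite subrr expr0n.
    have h1 : f y - fn n y @[n --> \oo] --> f y - f y.
      apply: cvgB; first exact: cvg_cst.
      by move/fine_cvgP: (fn_cvg y) => [].
    by rewrite expr2; under eq_fun do rewrite expr2; exact: cvgM.
  by apply/fine_cvgP; split => //; exact: nearW.
- apply/integrableP; split; first exact: measurable_sqr.
  by under eq_integral do rewrite gee0_abs ?lee_fin ?sqr_ge0//.
- apply: aeW => y n _; rewrite /= ger0_norm ?sqr_ge0// lee_fin.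
  have := fn_le n y; have : 0 <= fn n y by []; nra.
move=> _ _; rewrite integral_cst//= mul0e => cv.
have e40 : 0 < e / 4 by rewrite divr_gt0.
have [n Hn] : exists n, (\int[lebesgue_cube R d]_y ((f y - fn n y) ^+ 2)%:E <= (e / 4)%:E)%E.
  move/fine_cvgP: cv => [[m _ hm] /cvgrPdist_le /(_ _ e40)[m' _ hm']].
  exists (maxn m m').
  have := hm' _ (leq_maxr m m'); have := hm _ (leq_maxl m m').
  move=> /= fin; rewrite sub0r normrN => /(le_trans (ler_norm _)).
  by rewrite -lee_fin fineK.
have [K [g [dg Hg]]] := L2approx_simple (fn n) e40.
exists K, g; split => // dO Om P X x F; have {}Hg := Hg _ _ _ _ _ F.
have mfn : measurable_fun setT (fn n : cube -> R) by [].
have m1 : measurable_fun setT (fun w => f (x w) - fn n (x w)).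
  by apply: measurable_funB; exact: (measurable_frame_comp F).
have m2 : measurable_fun setT (fun w => fn n (x w) - g (fun j l => X j l w)).
  by apply: measurable_funB; [exact: (measurable_frame_comp F)|exact: (measurable_frame_fun F dg)].
apply: (@le_trans _ _ (2%:E * (e / 4)%:E + 2%:E * (e / 4)%:E)%E); last first.
  by rewrite -EFinM -EFinD lee_fin; lra.
apply: (@le_trans _ _ (2%:E * \int[P]_w ((f (x w) - fn n (x w)) ^+ 2)%:E +
   2%:E * \int[P]_w ((fn n (x w) - g (fun j l => X j l w)) ^+ 2)%:E)%E).
  apply: le_trans (integral_sqrD_le _ m1 m2).
  rewrite le_eqVlt; apply/orP; left; apply/eqP; apply: eq_integral => w _.
  by congr (_%:E); ring.
apply: leeD; apply: lee_wpmul2l => //.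
(* The first error was measured on the cube; equality of laws carries it to the frame. *)
rewrite (frame_law F (h := fun y => ((f y - fn n y) ^+ 2)%:E))//.
  by apply: measurable_sqr; exact: measurable_funB.
by move=> y; rewrite lee_fin sqr_ge0.
Qed.

Lemma L2approx_sqr_integrable (f : cube -> R) : measurable_fun setT f ->
  (\int[lebesgue_cube R d]_y (f y ^+ 2)%:E < +oo)%E -> L2approx f.
Proof.
move=> mf foo.
have mp : measurable_fun setT (fun y => Num.max (f y) 0) by exact: measurable_maxr.
have mn : measurable_fun setT (fun y => Num.max (- f y) 0).
  by apply: measurable_maxr => //; exact: measurableT_comp.
rewrite (_ : f = fun y => Num.max (f y) 0 + (-1) * Num.max (- f y) 0); last first.
  apply/funext => y; rewrite /Order.max oppr_lt0.
  by case: ltrgt0P => [//|//|] ?; lra.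
have bound (u : cube -> R) : measurable_fun setT u -> (forall y, u y ^+ 2 <= f y ^+ 2) ->
    (\int[lebesgue_cube R d]_y (u y ^+ 2)%:E < +oo)%E.
  move=> mu uf; apply: le_lt_trans foo; apply: ge0_le_integral => //.
  - by move=> y _; rewrite lee_fin sqr_ge0.
  - exact: measurable_sqr.
  - exact: measurable_sqr.
  - by move=> y _; rewrite lee_fin.
apply: L2approxD => //; first exact: measurable_funM.
  apply: L2approx_ge0 => // [y|]; first by rewrite le_max lexx orbT.
  by apply: bound => // y; rewrite /Order.max; case: ifP => _; rewrite ?expr0n ?sqr_ge0.
apply: L2approxZ => //; apply: L2approx_ge0 => // [y|]; first by rewrite le_max lexx orbT.
by apply: bound => // y; rewrite /Order.max; case: ifP => _; rewrite ?expr0n ?sqr_ge0 ?sqrrN.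
Qed.

End LebesgueFrame.

(** * Consequences of mutual independence *)

Section Independence.
Context {dO : measure_display} {Om : measurableType dO} {R : realType}.
Variable P : probability Om R.

Lemma finite_rv_prob (T : finType) (Y : Om -> T) (S : set T) : finite_rv Y ->
  P (Y @^-1` S) = (\sum_s `[< S s >]%:R * fine (P (Y @^-1` [set s])))%:E.
Proof.
move=> mY; rewrite -(integral_finite P (fun s => `[< S s >]%:R) mY).
rewrite -[in LHS](setIT (Y @^-1` S)) -integral_indic//; last exact: finite_rv_preimage.
Qed.

Lemma total_prob (T : finType) (Y : Om -> T) (A : set Om) : finite_rv Y ->
  measurable A -> P A = (\sum_s P (A `&` Y @^-1` [set s]))%E.
Proof.
move=> mY mA; pose Z w := `[< A w >].
have ZA : Z @^-1` [set true] = A by apply/seteqP; split => w /= /asboolP.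
have mZ : finite_rv Z.
  move=> [|]; first by rewrite ZA.
  have -> : Z @^-1` [set false] = ~` A.
    apply/seteqP; split => w /=; rewrite /Z.
      by move=> h Aw; move: h; rewrite asboolT.
    by move=> nA; rewrite asboolF.
  exact: measurableC.
have -> : P A = P ((fun w => (Z w, Y w)) @^-1` [set u | u.1 = true]).
  by congr (P _); rewrite -[LHS]ZA.
rewrite (finite_rv_prob _ (finite_rv_pair mZ mY)).
rewrite [RHS](eq_bigr (fun s => (fine (P (A `&` Y @^-1` [set s])))%:E)); last first.
  by move=> s _; rewrite fineK ?fin_num_measure//; exact: measurableI.
rewrite [X in X%:E](_ : _ = \sum_b \sum_s `[< b = true >]%:R *
    fine (P ((fun w => (Z w, Y w)) @^-1` [set (b, s)]))); last first.
  by rewrite pair_bigA; apply: eq_bigr => -[].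
rewrite big_bool /=.
rewrite [X in _ + X]big1 ?addr0 => [|s _]; last by rewrite asboolF ?mul0r.
rewrite sumEFin; congr (_%:E); apply: eq_bigr => s _.
rewrite asboolT// mul1r; congr (fine (P _)).
rewrite -ZA; apply/seteqP; split => w /=; first by case.
by move=> [-> ->].
Qed.

Lemma uniform_on_finite_rv (T : finType) (Y : Om -> T) (S : {set T}) :
  uniform_on P Y S -> finite_rv Y.
Proof. by move=> uY s; case: (uY s). Qed.

Lemma uniform_on_prob (T : finType) (Y : Om -> T) (S : {set T}) (A : set T) :
  uniform_on P Y S ->
  P (Y @^-1` A) = (#|[set s in S | `[< A s >]]%SET|%:R / #|S|%:R)%:E.
Proof.
move=> uY; rewrite (finite_rv_prob A (uniform_on_finite_rv uY)).
congr (_%:E); rewrite -sum1_card natr_sum mulr_suml [RHS]big_mkcond.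
apply: eq_bigr => s _; rewrite inE; case: (uY s) => _ ->.
by case: (s \in S); case: (`[< A s >]); rewrite /= ?mul0r ?mul1r ?mulr0.
Qed.

Section Family.
Variables (I : choiceType) (T : I -> finType) (X : forall k, Om -> T k).
Hypothesis indX : mutually_independent P X.
Hypothesis mX : forall k, finite_rv (X k).

Lemma indep_seq (ks : seq I) (A : forall k, set (T k)) : uniq ks ->
  P [set w | forall k, k \in ks -> A k (X k w)] =
  (\prod_(k <- ks) P (X k @^-1` A k))%E.
Proof.
move=> uks; pose J := [fset k in ks]%fset.
have -> : [set w | forall k, k \in ks -> A k (X k w)] =
    \bigcap_(k in [set` J]) X k @^-1` A k.
  by apply/seteqP; split => w /= h k; [move=> kJ|move=> kk];
    apply: h; move: kJ || move: kk; rewrite /= ?in_fset ?inE.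
rewrite indX; apply: perm_big; apply: uniq_perm => //.
by move=> k; rewrite !inE.
Qed.

Lemma indep_blocks (Q : finType) (ks : Q -> seq I) (A : forall k, set (T k)) :
  (forall q, uniq (ks q)) ->
  (forall q q' k, k \in ks q -> k \in ks q' -> q = q') ->
  P [set w | forall q k, k \in ks q -> A k (X k w)] =
  (\prod_q \prod_(k <- ks q) P (X k @^-1` A k))%E.
Proof.
move=> uks dks; have u (r : seq Q) : uniq r -> uniq (flatten (map ks r)).
  elim: r => [//|q r IH] /=/andP[qr ur]; rewrite cat_uniq uks IH// andbT /=.
  apply/hasPn => k /flatten_mapP[q' q'r kq']; apply: contraNN qr => kq.
  by rewrite (dks _ _ _ kq kq').
have := indep_seq A (u _ (enum_uniq Q)).
rewrite big_flatten big_map big_enum /= => <-; congr (P _).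
apply/seteqP; split => w /= h.
  by move=> k /flatten_mapP[q _]; exact: h.
by move=> q k kq; apply: h; apply/flatten_mapP; exists q => //; rewrite mem_enum.
Qed.

Lemma measurable_family_event (ks : seq I) (A : forall k, set (T k)) :
  measurable [set w | forall k, k \in ks -> A k (X k w)].
Proof.
have -> : [set w | forall k, k \in ks -> A k (X k w)] =
    \bigcap_(k in [set` [fset k in ks]%fset]) X k @^-1` A k.
  by apply/seteqP; split => w /= h k kk; apply: h; move: kk; rewrite /= !inE.
by apply: fin_bigcap_measurable => // k _; exact: finite_rv_preimage.
Qed.

(* If the conditional probability of [E] given the variables in [N] is constant,
   it is the unconditional one; no variable outside [N] is mentioned, so [r] can
   be averaged out one key at a time. *)
Lemma indep_condition (N : seq I) (E : set Om) (c : \bar R) (r0 : forall k, T k) :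
  measurable E -> (0 <= c)%E ->
  (forall r : forall k, T k,
    P (E `&` [set w | forall k, k \in N -> X k w = r k]) =
    (c * P [set w | forall k, k \in N -> X k w = r k])%E) ->
  P E = c.
Proof.
move=> mE c0; elim: N => [|k N IH] H.
  have := H r0; rewrite (_ : [set w | _] = setT) ?setIT ?probability_setT ?mule1//.
  by apply/seteqP; split.
apply: IH => r; set M := [set w | _].
have mM : measurable M by exact: (measurable_family_event N (fun k => [set r k])).
rewrite (total_prob (@mX k) (measurableI _ _ mE mM)) (total_prob (@mX k) mM).
rewrite ge0_sume_distrr//; apply: eq_bigr => x _; rewrite -setIA.
(* A repeated key is already fixed to [r k], so only [x = r k] survives; a new key extends the
   assignment by [dfwith r k x]. *)
have [kN|kN] := boolP (k \in N).
  have [->|xr] := eqVneq x (r k).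
    have -> : M `&` X k @^-1` [set r k] = [set w | forall k', k' \in k :: N -> X k' w = r k'].
      apply/seteqP; split => w /=.
        by move=> [h1 h2] k'; rewrite inE => /orP[/eqP ->//|]; exact: h1.
      move=> h; split; last by apply: h; rewrite inE eqxx.
      by move=> k' k'N; apply: h; rewrite inE k'N orbT.
    exact: H.
  rewrite (_ : M `&` _ = set0) ?setI0 ?measure0 ?mule0//.
  apply/seteqP; split => w //= [/(_ k kN) h1 h2].
  by move: xr; rewrite -h1 h2 eqxx.
have -> : M `&` X k @^-1` [set x] =
    [set w | forall k', k' \in k :: N -> X k' w = dfwith r k x k'].
  apply/seteqP; split => w /=.
    move=> [h1 h2] k'; rewrite inE => /orP[/eqP ->|k'N]; first by rewrite dfwithin.
    by rewrite dfwithout ?h1//; apply: contraNneq kN => ->.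
  move=> h; split; last by rewrite h ?inE ?eqxx// dfwithin.
  move=> k' k'N; rewrite h ?inE ?k'N ?orbT// dfwithout//.
  by apply: contraNneq kN => ->.
exact: H.
Qed.

End Family.
End Independence.

(** * Digits of the index and congruences modulo powers of the base *)

Lemma modn_digits (j i i' m : nat) :
  (i == i' %[mod nth_prime j ^ m])%N <-> forall l, (l < m)%N -> digit j i l = digit j i' l.
Proof.
have b0 := nth_prime_gt0 j; set b := nth_prime j.
have E k n : (k %% b ^ n.+1 = k %% b ^ n + b ^ n * ((k %/ b ^ n) %% b))%N.
  rewrite expnSr [in LHS](divn_eq k (b ^ n)) {1}(divn_eq (k %/ b ^ n)%N b).
  rewrite mulnDl -addnA -mulnA (mulnC b) modnMDl modn_small; first by rewrite addnC mulnC.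
  have h1 : (k %% b ^ n < b ^ n)%N by rewrite ltn_pmod// expn_gt0 b0.
  have h2 : ((k %/ b ^ n) %% b < b)%N by rewrite ltn_pmod.
  apply: (@leq_trans (((k %/ b ^ n) %% b).+1 * b ^ n)%N); first by rewrite mulSn addnC ltn_add2r.
  by rewrite mulnC leq_mul2l h2 orbT.
elim: m => [|m IH]; first by rewrite expn0 !modn1; split.
split=> [h l|h].
  have h' : (i == i' %[mod b ^ m])%N.
    have d : (b ^ m %| b ^ m.+1)%N by rewrite dvdn_exp2l.
    by rewrite -(modn_dvdm i d) (eqP h) modn_dvdm.
  rewrite ltnS leq_eqVlt => /orP[/eqP ->|]; last exact: IH.1.
  apply: val_inj => /=; move: h; rewrite !E (eqP h') eqn_add2l eqn_pmul2l ?expn_gt0 ?b0//.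
  by move/eqP.
have h' : (i == i' %[mod b ^ m])%N by apply/IH => l lm; apply: h; exact: ltnW.
rewrite !E (eqP h') eqn_add2l; apply/eqP; congr (_ * _)%N.
exact: (congr1 val (h m (leqnn _))).
Qed.

(** Two points meet the same permutation at level [l] exactly when their indices agree modulo
    [b ^ l]. *)
Lemma mkseq_digit_eq (j i i' l : nat) :
  (mkseq (digit j i) l == mkseq (digit j i') l) = (i == i' %[mod nth_prime j ^ l])%N.
Proof.
apply/eqP/idP => [h|/modn_digits h].
  apply/modn_digits => m ml.
  by rewrite -(nth_mkseq (digit j i 0) (digit j i) ml) h nth_mkseq.
by apply/eq_in_map => m; rewrite mem_iota => /andP[_]; exact: h.
Qed.

(** * The nested scramble *)

(** Composition with a transposition matches the permutations sending [a] to [s'] with those sending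
    [a] to [s], so the classes given by the value at [a] have equal size. *)
Lemma card_perm_at (T : finType) (a s : T) :
  (#|[set g : {perm T} | g a == s]%SET| * #|T| = #|{perm T}|)%N.
Proof.
have E s' : #|[set g : {perm T} | g a == s']%SET| = #|[set g : {perm T} | g a == s]%SET|.
  rewrite -(card_imset _ (mulIg (tperm s' s))); apply: eq_card => g.
  apply/imsetP/idP => [[h]|].
    by rewrite !inE => /eqP ha ->; rewrite permM ha tpermL.
  rewrite inE => /eqP ga; exists (g * tperm s' s)%g; last by rewrite -mulgA tperm2 mulg1.
  by rewrite inE permM ga tpermR.
rewrite -[RHS]sum1_card (partition_big (fun g : {perm T} => g a) predT)//=.
rewrite mulnC -sum_nat_const; apply: eq_bigr => s' _.
by rewrite -(E s') -sum1_card; apply: eq_bigl => g; rewrite inE.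
Qed.

Lemma card_perm_at2 (T : finType) (a a' s t : T) : a != a' -> s != t ->
  (#|[set g : {perm T} | (g a == s) && (g a' == t)]%SET| * (#|T|.-1 * #|T|) = #|{perm T}|)%N.
Proof.
move=> aa st; rewrite -(card_perm_at a s) mulnA; congr (_ * _)%N.
pose S t' := [set g : {perm T} | (g a == s) && (g a' == t')]%SET.
have E t' : t' != s -> #|S t'| = #|S t|.
  move=> t's; rewrite -(card_imset _ (mulIg (tperm t' t))); apply: eq_card => g.
  apply/imsetP/idP => [[h]|].
    rewrite !inE => /andP[/eqP ha /eqP ha'] ->.
    by rewrite !permM ha ha' tpermL tpermD// ?eqxx// eq_sym.
  rewrite inE => /andP[/eqP ga /eqP ga'].
  exists (g * tperm t' t)%g; last by rewrite -mulgA tperm2 mulg1.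
  by rewrite inE !permM ga ga' tpermR tpermD ?eqxx// eq_sym.
rewrite -[RHS]sum1_card (partition_big (fun g : {perm T} => g a') (predC1 s))/=; last first.
  move=> g; rewrite inE => /eqP ga; rewrite -ga.
  by rewrite (inj_eq perm_inj) eq_sym.
rewrite mulnC -(cardC1 s) -sum_nat_const; apply: eq_bigr => t' t's.
by rewrite -(E t')// -sum1_card; apply: eq_bigl => g; rewrite !inE.
Qed.

Lemma modnS_digits (j i i' l : nat) :
  (i == i' %[mod nth_prime j ^ l.+1])%N =
  (i == i' %[mod nth_prime j ^ l])%N && (digit j i l == digit j i' l).
Proof.
apply/idP/andP => [/modn_digits h|[/modn_digits h /eqP hl]].
  by split; [apply/modn_digits => m ml; apply: h; exact: ltnW|apply/eqP; exact: h].
by apply/modn_digits => m; rewrite ltnS leq_eqVlt => /orP[/eqP ->//|]; exact: h.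
Qed.

Section Nested.
Context {dO : measure_display} {Om : measurableType dO} {R : realType}.
Variable P : probability Om R.

Section OnePerm.
Variables (b : nat) (Y : Om -> {perm 'I_b}).
Hypothesis uY : uniform_on P Y [set: {perm 'I_b}]%SET.

Lemma uniform_perm_at (a : 'I_b) (s : nat) :
  P [set w | Y w a = s :> nat] = ((s < b)%N%:R / b%:R)%:E.
Proof.
have -> : [set w | Y w a = s :> nat] = Y @^-1` [set g : {perm 'I_b} | g a = s :> nat] by [].
rewrite (uniform_on_prob _ uY); congr (_%:E).
have b0 : (0 < b)%N by exact: leq_trans (ltn_ord a).
have [sb|sb] := ltnP s b; last first.
  rewrite (_ : finset _ = finset.set0) ?cards0 ?mul0r//; apply/finset.setP => g; rewrite !inE/=.
  by apply/asboolP => E; move: (ltn_ord (g a)); rewrite E ltnNge sb.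
rewrite cardsT -(card_perm_at a (Ordinal sb)) natrM card_ord.
rewrite [X in X%:R / _](_ : _ = #|[set g : {perm 'I_b} | g a == Ordinal sb]%SET|); last first.
  by apply: eq_card => g; rewrite !inE /=; apply/asboolP/eqP => [E|->//]; exact: val_inj.
have c0 : #|[set g : {perm 'I_b} | g a == Ordinal sb]%SET|%:R != 0 :> R.
  rewrite pnatr_eq0 -lt0n; apply/card_gt0P; exists (tperm a (Ordinal sb)).
  by rewrite inE tpermL.
have b0R : b%:R != 0 :> R by rewrite pnatr_eq0 -lt0n.
by rewrite invfM mulrA mulfV.
Qed.

Lemma uniform_perm_at2 (a a' : 'I_b) (s t : nat) : a != a' ->
  P [set w | Y w a = s :> nat /\ Y w a' = t :> nat] =
  (((s < b) && (t < b))%N%:R * ((s != t)%:R / (b%:R * (b%:R - 1))))%:E.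
Proof.
move=> aa.
have -> : [set w | Y w a = s :> nat /\ Y w a' = t :> nat] =
  Y @^-1` [set g : {perm 'I_b} | g a = s :> nat /\ g a' = t :> nat] by [].
rewrite (uniform_on_prob _ uY); congr (_%:E).
have [|nst] := boolP ((s < b) && (t < b))%N; last first.
  rewrite mul0r (_ : finset _ = finset.set0) ?cards0 ?mul0r//; apply/finset.setP => g; rewrite !inE/=.
  by apply/asboolP => -[E E']; move: nst; rewrite -E -E' !ltn_ord.
move=> /andP[sb tb]; rewrite mul1r; have [st|st] := eqVneq s t.
  rewrite mul0r (_ : finset _ = finset.set0) ?cards0 ?mul0r//; apply/finset.setP => g; rewrite !inE/=.
  apply/asboolP => -[E E']; move/negP: aa; apply; apply/eqP/(@perm_inj _ g)/val_inj.
  by rewrite /= E E'.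
pose s' := Ordinal sb; pose t' := Ordinal tb.
have st' : s' != t' by apply: contra st => /eqP[->].
rewrite cardsT -(card_perm_at2 aa st') !natrM card_ord.
rewrite [X in X%:R / _](_ : _ =
    #|[set g : {perm 'I_b} | (g a == s') && (g a' == t')]%SET|); last first.
  apply: eq_card => g; rewrite !inE /=; apply/asboolP/andP => [[E E']|[/eqP -> /eqP ->]//].
  by split; apply/eqP/val_inj.
have c0 : #|[set g : {perm 'I_b} | (g a == s') && (g a' == t')]%SET|%:R != 0 :> R.
  rewrite pnatr_eq0 -lt0n; apply/card_gt0P.
  (* The first transposition sends [a] to [s']; the second moves the image of [a'] to [t'] and fixes
     [s']. *)
  exists (tperm a s' * tperm (tperm a s' a') t')%g.
  rewrite inE !permM tpermL; apply/andP; split; last by rewrite tpermL.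
  have h1 : tperm a s' a' != s' by rewrite -{2}(tpermL a s') (inj_eq perm_inj) eq_sym.
  have h2 : t' != s' by rewrite eq_sym.
  by rewrite (tpermD h1 h2).
have b1 : (1 < b)%N by move/eqP: (st) => st0; lia.
have -> : b.-1%:R = b%:R - 1 :> R by rewrite -subn1 natrB// ltnW.
have b0R : b%:R != 0 :> R by rewrite pnatr_eq0 -lt0n ltnW.
have b1R : b%:R - 1 != 0 :> R by rewrite subr_eq0 -[1]/(1%:R) eqr_nat gtn_eqF.
rewrite [(~~ false)%:R](_ : _ = 1 :> R)//; by field; rewrite ?c0 ?b0R ?b1R.
Qed.

End OnePerm.

Variable d : nat.
Variable pi : forall j : 'I_d, seq 'I_(nth_prime j) -> Om -> {perm 'I_(nth_prime j)}.
Arguments pi : clear implicits.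
Hypothesis Hpi : nested_uniform_permutations P pi.

Let X (i : nat) (j : 'I_d) (l : nat) (w : Om) : nat :=
  pi j (mkseq (digit j i) l) w (digit j i l).

(** At each position the two points use one or two permutations. Keys record the coordinate and,
    through the length of the prefix, the level; so the blocks of different positions are disjoint
    and independence gives a product. *)
Lemma nested_pair_law : halton_pair_law P X.
Proof.
case: Hpi => upi indpi.
have fpi j c : finite_rv (pi j c) := uniform_on_finite_rv (upi j c).
split.
- by move=> i j l w; exact: ltn_ord.
- move=> i j l v.
  exact: (finite_rv_preimage [set g : {perm _} | g (digit j i l) = v :> nat] (@fpi _ _)).
move=> i i' K s t.
pose key n (q : 'I_d * 'I_K) : {j : 'I_d & seq 'I_(nth_prime j)} :=
  Tagged (fun j : 'I_d => seq 'I_(nth_prime j)) (mkseq (digit q.1 n) q.2).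
pose ks q := undup [:: key i q; key i' q].
(* Independence needs a condition on each key alone, so the level is recovered by comparing the key
   with the prefixes of [i] and [i']. *)
pose A (k : {j : 'I_d & seq 'I_(nth_prime j)}) : set {perm 'I_(nth_prime (tag k))} :=
  [set g : {perm 'I_(nth_prime (tag k))} | forall l, (l < K)%N ->
    (tagged k = mkseq (digit (tag k) i) l -> g (digit (tag k) i l) = s (tag k) l :> nat) /\
    (tagged k = mkseq (digit (tag k) i') l -> g (digit (tag k) i' l) = t (tag k) l :> nat)].
have -> : [set w | forall j l, (l < K)%N -> X i j l w = s j l /\ X i' j l w = t j l] =
    [set w | forall q k, k \in ks q -> A k (pi (tag k) (tagged k) w)].
  apply/seteqP; split => w /= h.
    move=> [j l] k _ l' l'K; case: k => j' c /=.
    by have [h1 h2] := h j' l' l'K; split => ->.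
  move=> j l lK; split.
    have kk : key i (j, Ordinal lK) \in ks (j, Ordinal lK).
      by rewrite mem_undup inE eqxx.
    by have [h1 _] := h _ _ kk l lK; exact: h1.
  have kk : key i' (j, Ordinal lK) \in ks (j, Ordinal lK).
    by rewrite mem_undup !inE eqxx orbT.
  by have [_ h2] := h _ _ kk l lK; exact: h2.
rewrite (indep_blocks indpi A (ks := ks)); last 2 first.
- by move=> q; exact: undup_uniq.
- have sz q k : k \in ks q -> tag k = q.1 /\ size (tagged k) = q.2.
    by rewrite mem_undup !inE => /orP[] /eqP ->; rewrite /= size_mkseq.
  move=> [j l] [j' l'] k /sz[/= jk lk] /sz[/= jk' lk'].
  by congr (_, _); [rewrite -jk jk'|apply: val_inj; rewrite /= -lk lk'].
rewrite -(pair_bigA _ (fun j l => \prod_(k <- ks (j, l)) P (pi (tag k) (tagged k) @^-1` A k))%E)/=.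
rewrite -prodEFin; apply: eq_bigr => j _; rewrite -prodEFin; apply: eq_bigr => l _.
have keq : (key i (j, l) == key i' (j, l)) = (i == i' %[mod nth_prime j ^ l])%N.
  by rewrite -mkseq_digit_eq; exact: eq_Tagged.
have sz n n' (m : nat) : mkseq (digit j n) l = mkseq (digit j n') m -> m = l.
  by move=> /(congr1 size); rewrite !size_mkseq.
(* A shared permutation gives the same value at equal arguments and a uniform pair of distinct
   values at different ones. *)
rewrite modnS_digits; have [e0|e0] := boolP (i == i' %[mod nth_prime j ^ l])%N.
  have kk : key i (j, l) = key i' (j, l) by apply/eqP; rewrite keq.
  have mm : mkseq (digit j i) l = mkseq (digit j i') l by apply/eqP; rewrite mkseq_digit_eq.
  have -> : ks (j, l) = [:: key i (j, l)] by rewrite /ks -kk /= inE eqxx.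
  rewrite big_seq1.
  have -> : pi (tag (key i (j, l))) (tagged (key i (j, l))) @^-1` A (key i (j, l)) =
      [set w | pi j (mkseq (digit j i) l) w (digit j i l) = s j l :> nat /\
               pi j (mkseq (digit j i) l) w (digit j i' l) = t j l :> nat].
    apply/seteqP; split => w /= h.
      by have [h1 h2] := h l (ltn_ord l); split; [exact: h1|exact: h2].
    move=> m mK; split => E.
      by have ml := sz _ _ _ E; subst m; case: h.
    by have ml := sz _ _ _ E; subst m; case: h.
  rewrite /pair_kernel /=; have [dd|dd] := eqVneq (digit j i l) (digit j i' l); last first.
    exact: (uniform_perm_at2 (upi j _)).
  rewrite -dd; have [st|st] := eqVneq (s j l) (t j l).
    rewrite -st andbb; have := uniform_perm_at (upi j (mkseq (digit j i) l)) (digit j i l) (s j l).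
    rewrite mul1r => <-; congr (P _); by apply/seteqP; split => w /=; [case|].
  rewrite mul0r mulr0 (_ : [set w | _] = set0) ?measure0//.
  by apply/seteqP; split => w //= [h1 h2]; move: st; rewrite -h1 -h2 eqxx.
(* Otherwise the two prefixes differ, and independent permutations give independent uniform
   digits. *)
have ne n n' (m : nat) : (n == i) && (n' == i') || (n == i') && (n' == i) ->
    mkseq (digit j n) l <> mkseq (digit j n') m.
  move=> H /[dup] /sz -> /eqP; rewrite mkseq_digit_eq.
  by case/orP: H => /andP[/eqP -> /eqP ->]; apply/negP; rewrite // eq_sym.
have -> : ks (j, l) = [:: key i (j, l); key i' (j, l)].
  by rewrite /ks /= inE keq (negPf e0).
rewrite big_cons big_seq1.
have -> : pi (tag (key i (j, l))) (tagged (key i (j, l))) @^-1` A (key i (j, l)) =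
    [set w | pi j (mkseq (digit j i) l) w (digit j i l) = s j l :> nat].
  apply/seteqP; split => w /= h.
    by have [h1 _] := h l (ltn_ord l); exact: h1.
  move=> m mK; split => E; last by exfalso; apply: (ne i i' m) E; rewrite !eqxx.
  by have ml := sz _ _ _ E; subst m.
have -> : pi (tag (key i' (j, l))) (tagged (key i' (j, l))) @^-1` A (key i' (j, l)) =
    [set w | pi j (mkseq (digit j i') l) w (digit j i' l) = t j l :> nat].
  apply/seteqP; split => w /= h.
    by have [_ h1] := h l (ltn_ord l); exact: h1.
  move=> m mK; split => E; first by exfalso; apply: (ne i' i m) E; rewrite !eqxx orbT.
  by have ml := sz _ _ _ E; subst m.
rewrite (uniform_perm_at (upi j _)) (uniform_perm_at (upi j _)) -EFinM; congr (_%:E).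
rewrite /pair_kernel /= mulf_div -natrM mulnb.
by rewrite expr2.
Qed.

End Nested.

(** * The linear scramble *)

Lemma mod_mul_cancel (b e x y : nat) : prime b -> (0 < e < b)%N -> (x < b)%N -> (y < b)%N ->
  (x * e == y * e %[mod b])%N -> x = y.
Proof.
move=> bp /andP[e0 eb]; wlog xy : x y / (x <= y)%N => [H|] xb yb h.
  by case: (leqP x y) => [|/ltnW] xy; [exact: H|apply/esym/H => //; rewrite eq_sym].
move: h; rewrite eq_sym eqn_mod_dvd ?leq_mul2r ?xy ?orbT// -mulnBl Euclid_dvdM//.
case/orP => /dvdn_leq; rewrite ?subn_gt0; last by move=> /(_ e0); rewrite leqNgt eb.
have [->//|xy'] := eqVneq x y; rewrite ltn_neqAle xy' xy => /(_ isT); lia.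
Qed.

Lemma affine1_mod (b u s : nat) : (s < b)%N -> exists2 x0, (x0 < b)%N &
  forall x, (x < b)%N -> ((u + x) %% b == s)%N = (x == x0).
Proof.
move=> sb; have b0 : (0 < b)%N by exact: leq_trans sb.
exists ((s + (b - u %% b)) %% b)%N => [|x xb]; first by rewrite ltn_pmod.
set x0 := ((s + _) %% b)%N.
have E : (u + x0 = s %[mod b])%N.
  rewrite modnDmr -modnDml addnCA subnKC; last by rewrite ltnW// ltn_pmod.
  by rewrite modnDr.
rewrite -(modn_small sb) -E eqn_modDl modn_small// modn_small// ltn_pmod//.
Qed.

(** The unknowns are a matrix entry [y] and the shift [x]. The last clause serves the diagonal
    entry, which avoids 0: with equal offsets the solution has [y = 0] exactly when both digits are
    to be equal. *)
Lemma affine2_mod (b a a' u u' s t : nat) : prime b -> (a < b)%N -> (a' < b)%N ->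
  a != a' -> (s < b)%N -> (t < b)%N ->
  exists z : nat * nat, [/\ (z.1 < b)%N, (z.2 < b)%N,
    forall y x, (y < b)%N -> (x < b)%N ->
      ((u + y * a + x) %% b == s)%N && ((u' + y * a' + x) %% b == t)%N =
      (y == z.1) && (x == z.2) &
    u = u' -> (z.1 == 0%N) = (s == t)].
Proof.
move=> bp ab a'b aa' sb tb; have b0 := prime_gt0 bp.
(* This is [(y - y2) * (a - a') = 0] modulo [b], written without subtraction. *)
have cancel y y2 : (y < b)%N -> (y2 < b)%N ->
    (y * a + y2 * a' == y2 * a + y * a' %[mod b])%N -> y = y2.
  move=> yb y2b; case: (ltngtP a a') aa' => // h _.
    have -> : a' = (a + (a' - a))%N by rewrite subnKC// ltnW.
    rewrite !mulnDr addnA [in X in _ == X]addnA [(y2 * a + y * a)%N]addnC eqn_modDl eq_sym.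
    by apply: mod_mul_cancel => //; rewrite subn_gt0 h/=; lia.
  have -> : a = (a' + (a - a'))%N by rewrite subnKC// ltnW.
  rewrite !mulnDr addnAC [in X in _ == X]addnAC [(y2 * a' + y * a')%N]addnC eqn_modDl.
  by apply: mod_mul_cancel => //; rewrite subn_gt0 h/=; lia.
have xcancel w x x2 : (x < b)%N -> (x2 < b)%N -> ((w + x) %% b = (w + x2) %% b)%N -> x = x2.
  by move=> xb x2b /eqP; rewrite eqn_modDl !modn_small// => /eqP.
have inj y x y2 x2 : (y < b)%N -> (x < b)%N -> (y2 < b)%N -> (x2 < b)%N ->
    ((u + y * a + x) %% b = (u + y2 * a + x2) %% b)%N ->
    ((u' + y * a' + x) %% b = (u' + y2 * a' + x2) %% b)%N -> y = y2 /\ x = x2.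
  move=> yb xb y2b x2b h1 h2.
  have yy : y = y2.
    apply: cancel => //.
    have : ((u + y * a + x) + (u' + y2 * a' + x2) == (u + y2 * a + x2) + (u' + y * a' + x) %[mod b])%N.
      by rewrite -modnDm h1 -h2 modnDm.
    have -> : (u + y * a + x + (u' + y2 * a' + x2) = (u + u' + x + x2) + (y * a + y2 * a'))%N by ring.
    have -> : (u + y2 * a + x2 + (u' + y * a' + x) = (u + u' + x + x2) + (y2 * a + y * a'))%N by ring.
    by rewrite eqn_modDl.
  by split => //; move: h1; rewrite yy; exact: xcancel.
(* Existence follows from uniqueness: an injective self-map of a finite set is onto. *)
pose g (z : 'I_b * 'I_b) : 'I_b * 'I_b :=
  (Ordinal (ltn_pmod (u + z.1 * a + z.2) b0), Ordinal (ltn_pmod (u' + z.1 * a' + z.2) b0)).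
have ginj : injective g.
  move=> [y x] [y2 x2] /(congr1 (fun z : 'I_b * 'I_b => (val z.1, val z.2))) /= [h1 h2].
  have [e1 e2] := inj _ _ _ _ (ltn_ord y) (ltn_ord x) (ltn_ord y2) (ltn_ord x2) h1 h2.
  by congr (_, _); exact: val_inj.
have := injF_onto ginj (Ordinal sb, Ordinal tb).
move=> /codomP[[y0 x0]] /(congr1 (fun z : 'I_b * 'I_b => (val z.1, val z.2))) /= [Es Et].
exists (val y0, val x0); split => //=.
  move=> y x yb xb; apply/andP/andP => [[/eqP h1 /eqP h2]|[/eqP -> /eqP ->]].
    by have [-> ->] := inj _ _ _ _ yb xb (ltn_ord y0) (ltn_ord x0) (etrans h1 Es) (etrans h2 Et).
  by rewrite -Es -Et.
move=> uu; apply/eqP/eqP => [y00|st].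
  by rewrite Es Et uu y00 !mul0n.
have : ((u + y0 * a + x0) %% b = (u' + y0 * a' + x0) %% b)%N by rewrite -Es -Et.
rewrite uu => /eqP; rewrite -!addnA eqn_modDl addnC [in X in _ == X]addnC eqn_modDl => h.
apply: (cancel y0 0%N) => //; rewrite !mul0n addn0 add0n.
exact: h.
Qed.

Section Linear.
Context {dO : measure_display} {Om : measurableType dO} {R : realType}.
Variable P : probability Om R.

Lemma finite_rv_ffun (K T : finType) (Y : K -> Om -> T) :
  (forall k, finite_rv (Y k)) -> finite_rv (fun w => [ffun k => Y k w]).
Proof.
move=> mY s; have -> : (fun w => [ffun k => Y k w]) @^-1` [set s] =
    \bigcap_(k in [set: K]) Y k @^-1` [set s k].
  apply/seteqP; split => w /=; first by move=> <- k _; rewrite /= ffunE.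
  by move=> h; apply/ffunP => k; rewrite ffunE; exact: h.
by apply: fin_bigcap_measurable => // k _; exact: mY.
Qed.

Lemma uniform_ord_eq (b : nat) (Y : Om -> 'I_b) (x : nat) :
  uniform_on P Y [set: 'I_b]%SET -> (x < b)%N ->
  P (Y @^-1` [set y | y = x :> nat]) = (b%:R^-1)%:E.
Proof.
move=> uY xb; have -> : Y @^-1` [set y : 'I_b | y = x :> nat] = Y @^-1` [set Ordinal xb].
  by apply/seteqP; split => w /= h; [exact: val_inj|rewrite h].
by case: (uY (Ordinal xb)) => _ ->; rewrite inE cardsT card_ord.
Qed.

Lemma uniform_unit_eq (b : nat) (Y : Om -> 'I_b) (x : nat) : (1 < b)%N ->
  uniform_on P Y [set v : 'I_b | 0 < val v]%N%SET -> (x < b)%N ->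
  P (Y @^-1` [set y | y = x :> nat]) = ((x != 0%N)%:R / (b%:R - 1))%:E.
Proof.
move=> b1 uY xb; have -> : Y @^-1` [set y : 'I_b | y = x :> nat] = Y @^-1` [set Ordinal xb].
  by apply/seteqP; split => w /= h; [exact: val_inj|rewrite h].
case: (uY (Ordinal xb)) => _ ->; rewrite inE /= lt0n.
have -> : #|[set v : 'I_b | 0 < val v]%N%SET| = b.-1.
  have b0 : (0 < b)%N by exact: ltnW.
  rewrite -[in RHS](card_ord b) -(cardsC1 (Ordinal b0)); apply: eq_card => v.
  by rewrite !inE -val_eqE /= lt0n.
rewrite -subn1 natrB; last exact: ltnW.
by case: (x != 0%N); rewrite ?mul1r ?mul0r.
Qed.

Variable d : nat.
Variables (L : forall j : 'I_d, forall l : nat, 'I_l.+1 -> Om -> 'I_(nth_prime j))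
  (c : forall j : 'I_d, nat -> Om -> 'I_(nth_prime j)).
Arguments L : clear implicits.
Arguments c : clear implicits.
Hypothesis HLc : linear_shift_coefficients P L c.
Local Notation key := ('I_d * ({l : nat & 'I_l.+1} + nat))%type.
Local Notation fam := (linear_shift_family L c).

Let X (i : nat) (j : 'I_d) (l : nat) (w : Om) : nat :=
  ((\sum_(l' < l.+1) L j l l' w * digit j i l' + c j l w) %% nth_prime j)%N.

Let uL_lt (j : 'I_d) l (l' : 'I_l.+1) : (l' < l)%N -> uniform_on P (L j l l') [set: 'I_(nth_prime j)]%SET.
Proof. by case: HLc => _ h _ _; exact: h. Qed.

Let uL_diag (j : 'I_d) l : uniform_on P (L j l ord_max) [set v : 'I_(nth_prime j) | 0 < val v]%N%SET.
Proof. by case: HLc => h _ _ _; exact: h. Qed.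

Let uc (j : 'I_d) l : uniform_on P (c j l) [set: 'I_(nth_prime j)]%SET.
Proof. by case: HLc => _ _ h _; exact: h. Qed.

Let fL (j : 'I_d) l (l' : 'I_l.+1) : finite_rv (L j l l').
Proof.
have [h|h] := ltnP l' l; first exact: uniform_on_finite_rv (@uL_lt j l l' h).
have -> : l' = ord_max by apply: val_inj; apply/eqP; rewrite eqn_leq h -ltnS ltn_ord.
exact: uniform_on_finite_rv (@uL_diag j l).
Qed.

Let ffam (k : key) : finite_rv (fam k).
Proof.
case: k => j [[l l']|l]; first exact: (@fL j l l').
exact: uniform_on_finite_rv (@uc j l).
Qed.

Let fX i (j : 'I_d) l v : measurable (X i j l @^-1` [set v]).
Proof.
have m := finite_rv_pair (finite_rv_ffun (fun l' => @fL j l l'))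
  (uniform_on_finite_rv (@uc j l)).
pose phi (u : {ffun 'I_l.+1 -> 'I_(nth_prime j)} * 'I_(nth_prime j)) : nat :=
  ((\sum_(l' < l.+1) u.1 l' * digit j i l' + u.2) %% nth_prime j)%N.
have -> : X i j l @^-1` [set v] =
    (fun w => ([ffun l' => L j l l' w], c j l w)) @^-1` [set u | phi u = v].
  have E w : phi ([ffun l' => L j l l' w], c j l w) = X i j l w.
    by congr (_ %% _)%N; congr (_ + _)%N; apply: eq_bigr => l' _; rewrite ffunE.
  by apply/seteqP; split => w; rewrite /preimage /= E.
exact: finite_rv_preimage.
Qed.

Section Pair.
Variables (i i' K : nat) (s t : 'I_d -> nat -> nat).
Hypothesis sb : forall (j : 'I_d) l, (l < K)%N -> (s j l < nth_prime j)%N.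
Hypothesis tb : forall (j : 'I_d) l, (l < K)%N -> (t j l < nth_prime j)%N.

(* First digit at which [i] and [i'] differ, [K] if there is none. *)
Let v (j : 'I_d) := find (fun l => digit j i l != digit j i' l) (iota 0 K).

Let v_le (j : 'I_d) l : (l < v j)%N -> digit j i l = digit j i' l.
Proof.
move=> lv; have lK : (l < K)%N.
  by apply: leq_trans lv _; rewrite -[leqRHS](size_iota 0 K) find_size.
by have /negbFE/eqP := before_find 0%N lv; rewrite nth_iota.
Qed.

Let v_ne (j : 'I_d) : (v j < K)%N -> digit j i (v j) != digit j i' (v j).
Proof.
move=> vK; have h : has (fun l => digit j i l != digit j i' l) (iota 0 K).
  by rewrite has_find size_iota.
by have := nth_find 0%N h; rewrite -/(v j) nth_iota.
Qed.

Let e0E (j : 'I_d) l : (l < K)%N -> (i == i' %[mod nth_prime j ^ l])%N = (l <= v j)%N.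
Proof.
move=> lK; apply/idP/idP => [/modn_digits h|lv].
  rewrite leqNgt; apply/negP => vl; have := v_ne (ltn_trans vl lK).
  by rewrite h ?eqxx.
by apply/modn_digits => m ml; apply: v_le; exact: leq_trans lv.
Qed.

Let e1E (j : 'I_d) l : (l < K)%N -> (i == i' %[mod nth_prime j ^ l.+1])%N = (l < v j)%N.
Proof.
move=> lK; rewrite modnS_digits e0E//; apply/andP/idP => [[lv /eqP h]|lv].
  rewrite ltn_neqAle lv andbT; apply/eqP => E; have := @v_ne j; rewrite -E lK => /(_ isT).
  by rewrite h eqxx.
by split; [exact: ltnW|apply/eqP/v_le].
Qed.

Let kL (j : 'I_d) l (l' : 'I_l.+1) : key := (j, inl (Tagged (fun l => 'I_l.+1) l')).
Let kc (j : 'I_d) l : key := (j, inr l).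
(* The event on the digit pair [q] is solved for the coefficients in [C q],
   conditionally on those in [N q]: above row [v] only the shift is involved; from
   row [v] on, the two equations determine the shift and the entry in column [v]. *)
Let N (q : 'I_d * 'I_K) : seq key := map (@kL q.1 q.2)
  (seq.filter (fun l' : 'I_q.2.+1 => (l' : nat) != v q.1) (index_enum 'I_q.2.+1)).
Let C (q : 'I_d * 'I_K) : seq key :=
  (if (v q.1 <= q.2)%N then [:: kL q.1 (inord (v q.1) : 'I_q.2.+1)] else [::]) ++ [:: kc q.1 q.2].

(** [pos] is the coordinate and matrix row of a key, which separates the blocks; [row] is the column
    of an entry, which separates the keys inside a block. *)
Let pos (k : key) : 'I_d * nat := (k.1, match k.2 with inl a => tag a | inr l => l end).
Let row (k : key) : nat := match k.2 with inl a => val (tagged a) | inr l => 0%N end.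

Let N_pos q k : k \in N q -> pos k = (q.1, q.2 : nat).
Proof. by move=> /mapP[l' _ ->]. Qed.

Let C_pos q k : k \in C q -> pos k = (q.1, q.2 : nat).
Proof. by rewrite /C; case: ifP => _; rewrite !inE; [case/orP|]; move=> /eqP ->. Qed.

Let uniq_ks q : uniq (N q ++ C q).
Proof.
rewrite cat_uniq; apply/and3P; split.
- rewrite map_inj_uniq ?seq.filter_uniq ?index_enum_uniq// => a b /(congr1 row) /= ?.
  exact: val_inj.
- apply/hasPn => k kC; apply/negP => /mapP[l']; rewrite seq.mem_filter => /andP[l'v _] E.
  move: kC; rewrite E /C; case: ifP => [vl|_]; rewrite !inE /=; last by move/eqP => [].
  case/orP => /eqP E'; last by case: E'.
  by have := congr1 row E'; rewrite /row /= inordK ?ltnS// => e; rewrite e eqxx in l'v.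
- rewrite /C; case: ifP => _ //=; rewrite inE andbT; apply/negP => /eqP E.
  by case: E.
Qed.

Section Fixed.
Variable r : forall k : key, 'I_(nth_prime k.1).

Let u n (j : 'I_d) l : nat := (\sum_(l' < l.+1 | (l' : nat) != v j) r (kL j l') * digit j n l')%N.

Variable z : 'I_d * nat -> nat * nat.
Hypothesis Hz : forall (j : 'I_d) l, (v j <= l)%N -> (l < K)%N ->
  [/\ ((z (j, l)).1 < nth_prime j)%N, ((z (j, l)).2 < nth_prime j)%N,
    forall y x, (y < nth_prime j)%N -> (x < nth_prime j)%N ->
      ((u i j l + y * digit j i (v j) + x) %% nth_prime j == s j l)%N &&
      ((u i' j l + y * digit j i' (v j) + x) %% nth_prime j == t j l)%N =
      (y == (z (j, l)).1) && (x == (z (j, l)).2) &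
    u i j l = u i' j l -> ((z (j, l)).1 == 0%N) = (s j l == t j l)].

(** Once [N] is frozen at [r], the event becomes one condition per key. In rows above [v] there is
    no column [v], so [u] is the whole linear part and the shift alone must solve both
    congruences. *)
Let A (k : key) : set 'I_(nth_prime k.1) :=
  match k.2 with
  | inl a => if val (tagged a) == v k.1
             then [set x : 'I_(nth_prime k.1) | x = (z (k.1, tag a)).1 :> nat]
             else [set x | x = r k]
  | inr l => if (v k.1 <= l)%N
             then [set x : 'I_(nth_prime k.1) | x = (z (k.1, l)).2 :> nat]
             else [set x : 'I_(nth_prime k.1) |
               (u i k.1 l + x) %% nth_prime k.1 = s k.1 l /\
               (u i' k.1 l + x) %% nth_prime k.1 = t k.1 l]%N
  end.

Arguments A : clear implicits.

Let A_N q k : k \in N q -> A k = [set r k].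
Proof.
move=> /mapP[l']; rewrite seq.mem_filter => /andP[l'v _] ->.
by rewrite /A /= (negPf l'v).
Qed.

Let sum_lt (j : 'I_d) l n w : (l < v j)%N ->
  (forall l' : 'I_l.+1, (l' : nat) != v j -> L j l l' w = r (kL j l')) ->
  (\sum_(l' < l.+1) L j l l' w * digit j n l' = u n j l)%N.
Proof.
move=> lv h; rewrite /u [RHS]big_mkcond; apply: eq_bigr => l' _.
have l'v : (l' : nat) != v j by rewrite ltn_eqF// (leq_ltn_trans _ lv)// -ltnS.
by rewrite l'v h.
Qed.

Let sum_ge (j : 'I_d) l n w : (v j <= l)%N ->
  (forall l' : 'I_l.+1, (l' : nat) != v j -> L j l l' w = r (kL j l')) ->
  (\sum_(l' < l.+1) L j l l' w * digit j n l' =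
   u n j l + L j l (inord (v j)) w * digit j n (v j))%N.
Proof.
move=> vl h; rewrite (bigD1 (inord (v j)))//= inordK ?ltnS// addnC; congr (_ + _)%N.
apply: eq_big => [l'|l' l'v]; first by rewrite -val_eqE /= inordK.
by rewrite h//; move: l'v; rewrite -val_eqE /= inordK.
Qed.

Let event_eq :
  [set w | forall (j : 'I_d) l, (l < K)%N -> X i j l w = s j l /\ X i' j l w = t j l] `&`
  [set w | forall q k, k \in N q -> fam k w = r k] =
  [set w | forall q k, k \in N q ++ C q -> A k (fam k w)].
Proof.
have hN w (q : 'I_d * 'I_K) : (forall k, k \in N q -> fam k w = r k) ->
    forall l' : 'I_q.2.+1, (l' : nat) != v q.1 -> L q.1 q.2 l' w = r (kL q.1 l').
  move=> h l' l'v; apply: (h (kL q.1 l')); apply/mapP; exists l' => //.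
  by rewrite seq.mem_filter l'v mem_index_enum.
apply/seteqP; split => w /=.
  move=> [E H] q k; rewrite mem_cat => /orP[kN|kC]; first by rewrite (A_N kN) (H q).
  have hq := hN w q (H q); have [h1 h2] := E q.1 q.2 (ltn_ord q.2).
  move: kC h1 h2; rewrite /C /X; case: ifP => [vl|/negbT]; rewrite ?inE.
    rewrite !(sum_ge _ vl hq) => kk h1 h2.
    have [_ _ /(_ _ _ (ltn_ord (L q.1 q.2 (inord (v q.1)) w)) (ltn_ord (c q.1 q.2 w))) h _] :=
      Hz vl (ltn_ord q.2).
    move: h; rewrite h1 h2 !eqxx => /esym/andP[/eqP e1 /eqP e2].
    case/orP: kk => /eqP ->; first by rewrite /A /= inordK ?ltnS// eqxx.
    by rewrite /A /= vl.
  rewrite -ltnNge => lv; rewrite !(sum_lt _ lv hq) => /eqP -> h1 h2.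
  by rewrite /A /= leqNgt lv.
move=> H; have HN q k : k \in N q -> fam k w = r k.
  by move=> kN; have := H q k; rewrite mem_cat kN (A_N kN) => /(_ isT).
split => // j l lK; pose q := (j, Ordinal lK) : 'I_d * 'I_K.
have hq := hN w q (HN q); rewrite /= in hq.
have kcC : kc j l \in N q ++ C q.
  by rewrite mem_cat /C /=; case: ifP => _; rewrite !inE eqxx ?orbT.
have := H _ _ kcC; rewrite /A /X /=; case: ifP => [vl|/negbT].
  move=> e2; have kLC : kL j (inord (v j) : 'I_l.+1) \in N q ++ C q.
    by rewrite mem_cat /C /= vl !inE eqxx ?orbT.
  have := H _ _ kLC; rewrite /A /= inordK ?ltnS// eqxx => e1.
  have [_ _ /(_ _ _ (ltn_ord (L j l (inord (v j)) w)) (ltn_ord (c j l w))) h _] :=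
    Hz vl lK.
  by rewrite !(sum_ge _ vl hq); move: h; rewrite e1 e2 !eqxx => /andP[/eqP -> /eqP ->].
by rewrite -ltnNge => lv; rewrite !(sum_lt _ lv hq).
Qed.

(** Below row [v] entry and shift are both uniform, giving [b ^- 2]; in row [v] the entry is
    diagonal, giving [1 / (b * (b - 1))] for [s != t]; above it the shift gives [1 / b] for [s = t].
    The target values depend on [r], their probabilities do not. *)
Let prob_C (q : 'I_d * 'I_K) : (\prod_(k <- C q) P (fam k @^-1` A k))%E =
  (pair_kernel (nth_prime q.1) (q.2 < v q.1)%N (q.2 <= v q.1)%N (s q.1 q.2) (t q.1 q.2))%:E.
Proof.
case: q => j l; have lK := ltn_ord l; have b1 := prime_gt1 (prime_nth_prime j).
rewrite /C /pair_kernel /= sb// tb// mul1r; case: leqP => [vl|lv].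
  have [z1 z2 _ z0] := Hz vl lK.
  rewrite big_cons big_seq1.
  have -> : fam (kc j l) @^-1` A (kc j l) = c j l @^-1` [set x : 'I__ | x = (z (j, l : nat)).2 :> nat].
    by rewrite /A /= vl.
  have -> : fam (kL j (inord (v j) : 'I_l.+1)) @^-1` A (kL j (inord (v j))) =
      L j l (inord (v j)) @^-1` [set x : 'I__ | x = (z (j, l : nat)).1 :> nat].
    by rewrite /A /= inordK ?ltnS// eqxx.
  rewrite (uniform_ord_eq (@uc j l) z2).
  have [lv|lv] := leqP l (v j).
    have E : v j = l by apply/eqP; rewrite eqn_leq vl lv.
    have -> : inord (v j) = ord_max :> 'I_l.+1 by apply: val_inj; rewrite /= inordK ?ltnS.
    (* In row [v] the remaining columns see equal digits of [i] and [i'], so the offsets agree and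
       the last clause on [z] applies. *)
    rewrite (uniform_unit_eq b1 (@uL_diag j l) z1) z0; last first.
      rewrite /u E; apply: eq_bigr => l' l'l; rewrite v_le// E ltn_neqAle l'l /=.
      by rewrite -ltnS.
    by rewrite -EFinM; congr (_%:E); rewrite -mulrA -invfM [((nth_prime j)%:R - 1) * _]mulrC.
  rewrite (uniform_ord_eq (@uL_lt j l _ _) z1) ?inordK ?ltnS//.
  by rewrite -EFinM -invfM expr2.
rewrite big_seq1; have vl : (v j <= l)%N = false by rewrite leqNgt lv.
have uu : u i j l = u i' j l.
  apply: eq_bigr => l' l'l; rewrite v_le// (leq_ltn_trans _ lv)// -ltnS//.
have [x0 x0b Hx] := affine1_mod (u i j l) (sb j lK).
have -> : fam (kc j l) @^-1` A (kc j l) = c j l @^-1` [set x : 'I__ |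
    x = x0 :> nat /\ s j l = t j l].
  apply/seteqP; split => w; rewrite /A /= vl /= -uu.
    by move=> [h1 h2]; split; [apply/eqP; rewrite -Hx// h1|rewrite -h1 h2].
  by move=> [/eqP h1 h2]; move: h1; rewrite -Hx// => /eqP ->.
have [st|st] := eqVneq (s j l) (t j l).
  rewrite mul1r -(uniform_ord_eq (@uc j l) x0b); congr (P _).
  by apply/seteqP; split => w /= => [[]|].
rewrite mul0r (_ : _ @^-1` _ = set0) ?measure0//.
by apply/seteqP; split => w //= [_ /eqP]; rewrite (negPf st).
Qed.

Lemma linear_conditional :
  P ([set w | forall (j : 'I_d) l, (l < K)%N -> X i j l w = s j l /\ X i' j l w = t j l] `&`
     [set w | forall q k, k \in N q -> fam k w = r k]) =
  ((\prod_(q : 'I_d * 'I_K) (pair_kernel (nth_prime q.1) (q.2 < v q.1)%N (q.2 <= v q.1)%N (s q.1 q.2) (t q.1 q.2)) : R)%:E *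
   P [set w | forall q k, k \in N q -> fam k w = r k])%E.
Proof.
case: HLc => _ _ _ ind.
have posq (q q' : 'I_d * 'I_K) k : pos k = (q.1, q.2 : nat) -> pos k = (q'.1, q'.2 : nat) ->
    q = q'.
  move=> -> [e1 e2]; case: q q' e1 e2 => [j l] [j' l'] /= -> e2.
  by congr (_, _); exact: val_inj.
rewrite event_eq (indep_blocks ind A (ks := fun q => N q ++ C q)); last 2 first.
- exact: uniq_ks.
- have pNC q k : k \in N q ++ C q -> pos k = (q.1, q.2 : nat).
    by rewrite mem_cat => /orP[|]; [exact: N_pos|exact: C_pos].
  by move=> q q' k /pNC h /pNC; exact: posq.
rewrite (indep_blocks ind (fun k => [set r k]) (ks := N)); last 2 first.
- by move=> q; have := uniq_ks q; rewrite cat_uniq => /and3P[].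
- by move=> q q' k /N_pos h /N_pos; exact: posq.
under eq_bigr => q _.
  rewrite big_cat /= prob_C muleC big_seq.
  under eq_bigr => k kN do rewrite (A_N kN).
  rewrite -big_seq.
  over.
by rewrite big_split /= prodEFin.
Qed.

End Fixed.

Lemma linear_pair_prob :
  P [set w | forall (j : 'I_d) l, (l < K)%N -> X i j l w = s j l /\ X i' j l w = t j l] =
  (\prod_(j < d) \prod_(l < K) (pair_kernel (nth_prime j)
     (i == i' %[mod nth_prime j ^ l.+1]) (i == i' %[mod nth_prime j ^ l])
     (s j l) (t j l) : R))%:E.
Proof.
set E := [set w | _]; pose Ns : seq key := flatten (map N (index_enum _)).
have mE : measurable E.
  have -> : E = \bigcap_(q in [set: 'I_d * 'I_K])
      (X i q.1 q.2 @^-1` [set s q.1 q.2] `&` X i' q.1 q.2 @^-1` [set t q.1 q.2]).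
    apply/seteqP; split => w /= h; first by move=> [j l] _; exact: h.
    by move=> j l lK; exact: (h (j, Ordinal lK) I).
  by apply: fin_bigcap_measurable => // q _; apply: measurableI; exact: fX.
have -> : \prod_(j < d) \prod_(l < K) (pair_kernel (nth_prime j)
     (i == i' %[mod nth_prime j ^ l.+1]) (i == i' %[mod nth_prime j ^ l])
     (s j l) (t j l) : R) =
    \prod_(q : 'I_d * 'I_K) (pair_kernel (nth_prime q.1)
     (i == i' %[mod nth_prime q.1 ^ q.2.+1]) (i == i' %[mod nth_prime q.1 ^ q.2])
     (s q.1 q.2) (t q.1 q.2) : R) by rewrite pair_bigA.
set c0 := \prod_(q : 'I_d * 'I_K) _.
apply: (@indep_condition _ Om R P key (fun k => 'I_(nth_prime k.1)) fam (fun k => @ffam k) Ns E c0%:E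
  (fun k => Ordinal (nth_prime_gt0 k.1)) mE).
- rewrite lee_fin; apply: prodr_ge0 => q _; rewrite /pair_kernel.
  have b1 : 0 <= (nth_prime q.1)%:R - 1 :> R by rewrite subr_ge0 ler1n nth_prime_gt0.
  by apply: mulr_ge0 => //; case: ifP => _; [|case: ifP => _];
    rewrite ?divr_ge0 ?mulr_ge0 ?invr_ge0 ?exprn_ge0.
move=> r; pose u n (j : 'I_d) l := (\sum_(l' < l.+1 | (l' : nat) != v j) r (kL j l') * digit j n l')%N.
(* Solutions are chosen for all positions at once; [(0, 0)] is a filler outside the range of the
   two-equation system. *)
have /choice[z Hz] : forall q : 'I_d * nat, exists z : nat * nat, (v q.1 <= q.2)%N -> (q.2 < K)%N ->
  [/\ (z.1 < nth_prime q.1)%N, (z.2 < nth_prime q.1)%N,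
    forall y x, (y < nth_prime q.1)%N -> (x < nth_prime q.1)%N ->
      ((u i q.1 q.2 + y * digit q.1 i (v q.1) + x) %% nth_prime q.1 == s q.1 q.2)%N &&
      ((u i' q.1 q.2 + y * digit q.1 i' (v q.1) + x) %% nth_prime q.1 == t q.1 q.2)%N =
      (y == z.1) && (x == z.2) &
    u i q.1 q.2 = u i' q.1 q.2 -> (z.1 == 0%N) = (s q.1 q.2 == t q.1 q.2)].
  move=> [j l] /=; have [[vl lK]|h] := pselect ((v j <= l)%N /\ (l < K)%N); last first.
    by exists (0%N, 0%N) => vl lK; exfalso; apply: h.
  have dn : (digit j i (v j) : nat) != digit j i' (v j).
    exact: (@v_ne j (leq_ltn_trans vl lK)).
  have [z hz] := affine2_mod (u i j l) (u i' j l) (prime_nth_prime j)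
    (ltn_ord (digit j i (v j))) (ltn_ord (digit j i' (v j))) dn (@sb j l lK) (@tb j l lK).
  by exists z.
have := linear_conditional (fun j l => Hz (j, l)).
have -> : [set w | forall q k, k \in N q -> fam k w = r k] =
    [set w | forall k, k \in Ns -> fam k w = r k].
  apply/seteqP; split => w /= h.
    by move=> k /flatten_mapP[q _]; exact: h.
  by move=> q k kq; apply: h; apply/flatten_mapP; exists q => //; rewrite mem_index_enum.
rewrite -/E => ->; congr (_%:E * _)%E; rewrite /c0; apply: eq_bigr => q _.
by rewrite (e1E _ (ltn_ord q.2)) (e0E _ (ltn_ord q.2)).
Qed.

End Pair.

Lemma linear_pair_law : halton_pair_law P X.
Proof.
split => [i j l w|i j l v|i i' K s t]; first by rewrite ltn_pmod// nth_prime_gt0.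
  exact: fX.
(* The systems are solvable for digits in range; otherwise the event is empty and a kernel factor is
   0. *)
have [h|h] := pselect (forall (j : 'I_d) l, (l < K)%N -> (s j l < nth_prime j)%N && (t j l < nth_prime j)%N).
  by apply: linear_pair_prob => j l lK; have /andP[] := h j l lK.
have [j [l [lK jl]]] : exists j : 'I_d, exists l, (l < K)%N /\ ~~ ((s j l < nth_prime j)%N && (t j l < nth_prime j)%N).
  apply: contrapT => H; apply: h => j l lK; apply/negPn/negP => n.
  by apply: H; exists j, l.
rewrite (_ : [set w | _] = set0) ?measure0; last first.
  apply/seteqP; split => w //= /(_ j l lK)[e1 e2]; move/negP: jl; apply.
  by rewrite -e1 -e2 !ltn_pmod// nth_prime_gt0.
by rewrite (bigD1 j)//= (bigD1 (Ordinal lK))//= /pair_kernel (negPf jl) !mul0r.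
Qed.

End Linear.

(** * Mean squares of Halton averages *)

Section Radix.
Variables (R : realType) (b : nat) (u : nat -> nat).
Hypothesis ub : forall l, (u l < b)%N.
Local Notation term := (fun l => (u l)%:R / b%:R ^+ l.+1 : R).

Let b_gt0 : 0 < b%:R :> R.
Proof. by rewrite ltr0n (leq_trans _ (ub 0)). Qed.

Lemma series_cell K : series term K = (cell b u K)%:R / b%:R ^+ K.
Proof.
elim: K => [|K IH]; first by rewrite /series /= big_geq// mul0r.
have -> : series term K.+1 = series term K + term K by rewrite /series /= big_nat_recr.
rewrite IH /= natrD natrM exprS.
by field; rewrite expf_neq0 ?gt_eqF.
Qed.

Lemma cell_succ_le K n : (K <= n)%N ->
  (cell b u n).+1%:R / b%:R ^+ n <= (cell b u K).+1%:R / b%:R ^+ K :> R.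
Proof.
move=> /subnK <-; elim: (n - K)%N => [|m IH]; first by rewrite add0n.
apply: le_trans IH; rewrite addSn exprS invfM mulrA ler_wpM2r ?invr_ge0 ?exprn_ge0 ?(ltW b_gt0)//.
rewrite ler_pdivrMr// -natrM ler_nat mulnC /= mulnS addnC -addSn leq_add2r.
exact: ub.
Qed.

Let series_nd : nondecreasing_seq (series term).
Proof.
apply/nondecreasing_seqP => n; rewrite /series /= big_nat_recr//= lerDl.
by rewrite divr_ge0// exprn_ge0// (ltW b_gt0).
Qed.

Let series_le K n : series term n <= (cell b u K).+1%:R / b%:R ^+ K.
Proof.
apply: (@le_trans _ _ (series term (maxn K n))).
  by apply: series_nd; rewrite leq_maxr.
rewrite series_cell; apply: le_trans (cell_succ_le (leq_maxl K n)).
by rewrite ler_wpM2r ?invr_ge0 ?exprn_ge0 ?(ltW b_gt0)// ler_nat.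
Qed.

Lemma cvg_radix_point : series term @ \oo --> radix_point R b u.
Proof.
apply: nondecreasing_is_cvgn => //; exists ((cell b u 0).+1%:R / b%:R ^+ 0).
by move=> _ [n _ <-]; exact: series_le.
Qed.

(** Partial sums are left endpoints of nested cells and stay below every right endpoint. The upper
    inequality is not strict, as a tail of digits [b - 1] reaches the right endpoint. *)
Lemma radix_point_cell K :
  (cell b u K)%:R / b%:R ^+ K <= radix_point R b u /\
  radix_point R b u <= (cell b u K).+1%:R / b%:R ^+ K.
Proof.
have c : cvgn (series term) by apply/cvg_ex; eexists; exact: cvg_radix_point.
split; first by rewrite -series_cell; exact: nondecreasing_cvgn_le.
by apply: limr_le => //; apply: nearW => n; exact: series_le.
Qed.

End Radix.

Section Halton.
Context {dO : measure_display} {Om : measurableType dO} {R : realType}.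
Variables (P : probability Om R) (d : nat).

Definition halton_points (X : nat -> 'I_d -> nat -> Om -> nat) (i : nat) (w : Om) :
    d.-tuple (measurableTypeR R) :=
  [tuple radix_point R (nth_prime j) (fun l => X i j l w) | j < d].

Lemma halton_points_unit_cube X : halton_pair_law P X ->
  forall i w, unit_cube d (halton_points X i w).
Proof.
case=> Xb _ _ i w j; rewrite tnth_mktuple in_itv /=.
(* For [K = 0] the cell is all of [[0, 1]]. *)
have := @radix_point_cell R _ (fun l => X i j l w) (fun l => Xb i j l w) 0%N.
by rewrite expr0 divr1 divr1 /= => -[-> ->].
Qed.

Lemma halton_points_frame X : halton_pair_law P X ->
  forall i, digit_frame P (X i) (halton_points X i).
Proof.
case=> Xb mX XP i; split.
- by move=> j l w; exact: Xb.
- by move=> j l v; exact: mX.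
- apply/measurable_fun_tnthP => j.
  apply: (@measurable_fun_cvg _ _ _ _
    (fun m w => series (fun l => (X i j l w)%:R / (nth_prime j)%:R ^+ l.+1 : R) m)).
    move=> m; apply: measurable_sum => l.
    pose Y w := Ordinal (Xb i j l w).
    have mY : finite_rv Y.
      move=> v; have -> : Y @^-1` [set v] = X i j l @^-1` [set v : nat].
        by apply/seteqP; split => w /=; [move=> <-|move=> h; exact: val_inj].
      exact: mX.
    exact: (measurable_fun_finite (fun v : 'I_(nth_prime j) => (v : nat)%:R / (nth_prime j)%:R ^+ l.+1 : R) mY).
  by move=> w _; rewrite /= tnth_mktuple; exact: cvg_radix_point.
- move=> K s.
  (* The law of one point is the pair law at [i = i'], where both flags hold. *)
  have -> : [set w | forall j l, (l < K)%N -> X i j l w = s j l] =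
      [set w | forall j l, (l < K)%N -> X i j l w = s j l /\ X i j l w = s j l].
    by apply/seteqP; split => w /= h j l lK; [split|]; case: (h j l lK).
  rewrite XP; congr (_%:E); apply: eq_bigr => j _; apply: eq_bigr => l _.
  by rewrite /pair_kernel !eqxx andbb mul1r.
- exists set0; first by rewrite measure0.
  move=> w _ j K; rewrite tnth_mktuple.
  by apply: radix_point_cell => l; exact: Xb.
Qed.

Lemma Lfun2_sqr_lty (Y : Om -> R) : measurable_fun setT Y ->
  (\int[P]_w (Y w ^+ 2)%:E < +oo)%E -> Y \in Lfun P 2%:E.
Proof.
move=> mY Yoo; rewrite inE; apply/andP; split; rewrite inE//=.
rewrite /finite_norm unlock /Lnorm poweR_lty//.
under eq_integral => w _.
  have -> : (`|(EFin \o Y) w| `^ 2 = (Y w ^+ 2)%:E)%E.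
    by transitivity ((`|Y w| `^ 2)%:E) => //; rewrite -[2]/(2%:R) powR_mulrn// real_normK// num_real.
  over.
exact: Yoo.
Qed.

(** With an arbitrary centring [c] the mean need not be identified, and [c] may change with [n]. *)
Lemma variance_le (Y : Om -> R) c : Y \in Lfun P 2%:E ->
  ('V_P[Y] <= \int[P]_w ((Y w - c) ^+ 2)%:E)%E.
Proof.
move=> Y2; rewrite -(varianceB_cst_r c Y2) varianceE; last first.
  have C2 : cst (- c) \in Lfun P 2%:E by exact: Lfun_cst.
  have [_] := Lfun_addr_closed P (lee_tofin (ler1n R 2) : (1 <= 2%:E)%E); exact.
rewrite -[leRHS]sube0; apply: leeB; last exact: sqre_ge0.
by rewrite unlock.
Qed.

Variables (X : nat -> 'I_d -> nat -> Om -> nat).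
Hypothesis lawX : halton_pair_law P X.
Variable f : d.-tuple (measurableTypeR R) -> R.
Hypothesis mf : measurable_fun setT f.
Hypothesis foo : (\int[lebesgue_cube R d]_y (f y ^+ 2)%:E < +oo)%E.
Hypothesis d_gt0 : (0 < d)%N.
Local Notation x := (halton_points X).

Let Fr := halton_points_frame lawX.

(* The mean square of a sum of [n] terms is at most [n] times the sum of the mean
   squares, so the second approximation is taken with precision [O(1 / n)]; it
   differs from the first one by a function [h] of finitely many digits. *)
Lemma mean_square_sum_le (e : R) : 0 < e -> exists M : R, forall n, exists c : R,
  (\int[P]_w ((\sum_(i < n) (f (x i w) - c)) ^+ 2)%:E <= (n%:R * e + M)%:E)%E.
Proof.
move=> e0; have Lf := L2approx_sqr_integrable mf foo.
have g0 : 0 <= gain R d := gain_ge0 R d.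
(* The squared three-term sum costs factors 2, 4 and 4; with [4 * e1] for the mean square of [h],
   the terms linear in [n] add up to [n * e1 * (2 + 16 * gain R d)], and the bounded one to
   [4 * M]. *)
have C0 : 0 < 2 + 16 * gain R d by lra.
pose e1 := e / (2 + 16 * gain R d).
have e10 : 0 < e1 by rewrite divr_gt0.
have [K [g [dg Hg]]] := Lf _ e10.
have [m [M HM]] := step_mean_square_le lawX d_gt0 dg.
exists (4 * M) => n.
(* Cauchy-Schwarz bounds the first sum by [n * n * e1 / n.+1], at most [n * e1]; [n.+1] keeps the
   precision meaningful at [n = 0]. *)
have e2 : 0 < e1 / n.+1%:R by rewrite divr_gt0.
have [K' [g' [dg' Hg']]] := Lf _ e2.
pose h (u : 'I_d -> nat -> nat) := g' u - g u.
have dh : depends (maxn K K') h.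
  move=> u v uv; rewrite /h (dg u v) ?(dg' u v)// => j l lK; apply: uv.
    by rewrite leq_max lK orbT.
  by rewrite leq_max lK.
have [m' [M' HM']] := step_mean_square_le lawX d_gt0 dh.
(* Each term is split as [(f - g') + (h - m') + (g - m)]. The bounded estimate is applied to [g],
   chosen before [n], and the linear one to [h], whose number of digits varies with [n]. *)
exists (m + m').
pose a i w := f (x i w) - g' (fun j l => X i j l w).
pose b i w := h (fun j l => X i j l w) - m'.
pose c i w := g (fun j l => X i j l w) - m.
have mfx i : measurable_fun setT (fun w => f (x i w)).
  exact: (measurable_frame_comp (Fr i) mf).
have mg i : measurable_fun setT (fun w => g (fun j l => X i j l w)).
  exact: (measurable_frame_fun (Fr i) dg).
have mg' i : measurable_fun setT (fun w => g' (fun j l => X i j l w)).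
  exact: (measurable_frame_fun (Fr i) dg').
have ma i : measurable_fun setT (a i) by exact: measurable_funB.
have mh i : measurable_fun setT (fun w => h (fun j l => X i j l w)).
  exact: measurable_funB.
have mb i : measurable_fun setT (b i) by exact: measurable_funB.
have mc i : measurable_fun setT (c i) by exact: measurable_funB.
have mS (z : nat -> Om -> R) : (forall i, measurable_fun setT (z i)) ->
    measurable_fun setT (fun w => \sum_(i < n) z i w).
  by move=> mz; apply: measurable_sum => i; exact: mz.
have -> : (fun w => ((\sum_(i < n) (f (x i w) - (m + m'))) ^+ 2)%:E) =
    (fun w => ((\sum_(i < n) a i w + (\sum_(i < n) b i w + \sum_(i < n) c i w)) ^+ 2)%:E).
  apply/funext => w; congr ((_ ^+ 2)%:E); rewrite -!big_split; apply: eq_bigr => i _ /=.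
  by rewrite /a /b /c /h; ring.
have A : (\int[P]_w ((\sum_(i < n) a i w) ^+ 2)%:E <= (n%:R * e1)%:E)%E.
  apply: (@le_trans _ _ (\int[P]_w (n%:R%:E * \sum_(i < n) (a i w ^+ 2)%:E))%E).
    apply: ge0_le_integral => //.
    - by move=> w _; rewrite lee_fin sqr_ge0.
    - by apply: measurable_sqr; exact: mS.
    - by apply: measurable_funeM; apply: emeasurable_sum => i; exact: measurable_sqr.
    - move=> w _; rewrite sumEFin -EFinM lee_fin.
      by have := sqr_sum_le (fun i : 'I_n => a i w); rewrite card_ord.
  rewrite ge0_integralZl//; last 2 first.
  - by apply: emeasurable_sum => i; exact: measurable_sqr.
  - by move=> w _; apply: sume_ge0 => i _; rewrite lee_fin sqr_ge0.
  rewrite ge0_integral_sum//; last 2 first.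
  - by move=> i; exact: measurable_sqr.
  - by move=> i w _; rewrite lee_fin sqr_ge0.
  apply: (@le_trans _ _ (n%:R%:E * \sum_(i < n) (e1 / n.+1%:R)%:E)%E).
    apply: lee_wpmul2l => //; apply: lee_sum => i _; exact: (Hg' _ _ _ _ _ (Fr i)).
  rewrite sumEFin -EFinM lee_fin sumr_const card_ord ler_wpM2l//.
  rewrite -[X in X <= _]mulr_natr -mulrA ler_piMr ?(ltW e10)// mulrC.
  by rewrite ler_pdivrMr// mul1r ler_nat.
(* [h] is [(f - g) - (f - g')], and both errors are at most [e1] in mean square. *)
have hX0 : (\int[P]_w (h (fun j l => X 0%N j l w) ^+ 2)%:E <= (4 * e1)%:E)%E.
  have -> : (fun w => (h (fun j l => X 0%N j l w) ^+ 2)%:E) =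
      (fun w => (((f (x 0%N w) - g (fun j l => X 0%N j l w)) + - a 0%N w) ^+ 2)%:E).
    by apply/funext => w; congr ((_ ^+ 2)%:E); rewrite /a /h; ring.
  have mfg : measurable_fun setT (fun w => f (x 0%N w) - g (fun j l => X 0%N j l w)).
    exact: measurable_funB.
  have mna : measurable_fun setT (fun w => - a 0%N w) by exact: measurableT_comp.
  apply: le_trans (integral_sqrD_le P mfg mna) _.
  under [X in (_ + _ * X)%E]eq_integral do rewrite sqrrN.
  have -> : 4 * e1 = 2 * e1 + 2 * e1 by ring.
  rewrite [leRHS]EFinD [(2 * e1)%:E]EFinM; apply: leeD; apply: lee_wpmul2l => //; first exact: (Hg _ _ _ _ _ (Fr 0%N)).
  apply: le_trans (Hg' _ _ _ _ _ (Fr 0%N)) _.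
  by rewrite lee_fin ler_pdivrMr// ler_peMr ?(ltW e10)// ler1n.
have B : (\int[P]_w ((\sum_(i < n) b i w) ^+ 2)%:E <= (n%:R * gain R d * (4 * e1))%:E)%E.
  have [+ _] := HM' n; move/le_trans; apply.
  by rewrite [leRHS]EFinM lee_wpmul2l// lee_fin mulr_ge0.
have [_ C] := HM n.
apply: (@le_trans _ _ ((2 * (n%:R * e1)) + 2 * (2 * (n%:R * gain R d * (4 * e1)) + 2 * M))%:E).
  apply: le_trans (integral_sqrD_le P (mS _ ma) (measurable_funD (mS _ mb) (mS _ mc))) _.
  rewrite [leRHS]EFinD !(EFinM 2); apply: leeD; apply: lee_wpmul2l => //.
  apply: le_trans (integral_sqrD_le P (mS _ mb) (mS _ mc)) _.
  by rewrite [leRHS]EFinD !(EFinM 2); apply: leeD; apply: lee_wpmul2l.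
rewrite lee_fin.
have -> : e = e1 * (2 + 16 * gain R d) by rewrite /e1 divfK// gt_eqF.
by lra.
Qed.

Lemma sum_halton_Lfun2 n : (fun w => n%:R^-1 * \sum_(i < n) f (x i w)) \in Lfun P 2%:E.
Proof.
have fi i : (fun w => f (x i w)) \in Lfun P 2%:E.
  apply: Lfun2_sqr_lty; first exact: (measurable_frame_comp (Fr i) mf).
  rewrite (frame_law (Fr i) (h := fun y => (f y ^+ 2)%:E))//; first exact: measurable_sqr.
  by move=> y; rewrite lee_fin sqr_ge0.
have [S0 SD] := Lfun_addr_closed P (lee_tofin (ler1n R 2) : (1 <= 2%:E)%E).
have S : (fun w => \sum_(i < n) f (x i w)) \in Lfun P 2%:E.
  have -> : (fun w => \sum_(i < n) f (x i w)) = \sum_(i < n) (fun w => f (x i w)).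
    by apply/funext => w; rewrite fct_sumE.
  by elim/big_ind: _.
have -> : (fun w => n%:R^-1 * \sum_(i < n) f (x i w)) =
    n%:R^-1 \o* (fun w => \sum_(i < n) f (x i w)).
  by apply/funext => w; rewrite /= mulrC.
by apply: Lfun_scale => //; rewrite ler1n.
Qed.

Lemma variance_halton_cvg :
  (fun n => n%:R%:E * 'V_P[(fun w : Om => n%:R^-1 * \sum_(i < n) f (x i w))%R])%E
  @ \oo --> 0%E.
Proof.
set V := fun n : nat => _.
have V0 n : (0 <= V n)%E by rewrite mule_ge0// variance_ge0.
(* [n * n ^- 2 * (n * e + M)] is [e + M / n], and [M] does not depend on [n]. *)
have HV e : 0 < e -> exists M : R, forall n, (0 < n)%N -> (V n <= (e + M / n%:R)%:E)%E.
  move=> e0; have [M HM] := mean_square_sum_le e0; exists M => n n0.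
  have [c Hc] := HM n; have nR : 0 < n%:R :> R by rewrite ltr0n.
  apply: le_trans (lee_wpmul2l _ (variance_le c (sum_halton_Lfun2 n))) _ => //.
  have -> : (fun w => ((n%:R^-1 * (\sum_(i < n) f (x i w)) - c) ^+ 2)%:E) =
      (fun w => ((n%:R ^- 2)%:E * ((\sum_(i < n) (f (x i w) - c)) ^+ 2)%:E)%E).
    apply/funext => w; rewrite -EFinM; congr (_%:E).
    rewrite sumrB sumr_const card_ord -(mulr_natl c n).
    by field; rewrite gt_eqF.
  rewrite ge0_integralZl//; last 2 first.
  - apply: measurable_sqr; apply: measurable_sum => i; apply: measurable_funB => //.
    exact: (measurable_frame_comp (Fr i) mf).
  - by move=> w _; rewrite lee_fin sqr_ge0.
  rewrite muleA -EFinM.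
  apply: le_trans (lee_wpmul2l _ Hc) _; first by rewrite lee_fin mulr_ge0.
  rewrite -EFinM lee_fin le_eqVlt; apply/orP; left; apply/eqP.
  by field; rewrite gt_eqF.
apply/fine_cvgP; split.
  have [M HM] := HV 1 ltr01; exists 1%N => // n /= n0.
  by rewrite ge0_fin_numE//; apply: le_lt_trans (HM n n0) _; rewrite ltry.
apply/cvgrPdist_le => e e0; have [M HM] := HV (e / 2) (divr_gt0 e0 (ltr0Sn _ 1)).
have B0 : 0 <= `|M| / (e / 2) by rewrite divr_ge0// divr_ge0// ltW.
exists (Num.bound (`|M| / (e / 2))).+1 => // n /= nN.
have n0 : (0 < n)%N by exact: leq_trans nN.
have nR : 0 < n%:R :> R by rewrite ltr0n.
rewrite sub0r normrN ger0_norm ?fine_ge0// -lee_fin fineK; last first.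
  by rewrite ge0_fin_numE//; apply: le_lt_trans (HM n n0) _; rewrite ltry.
apply: le_trans (HM n n0) _; rewrite lee_fin.
suff : M / n%:R <= e / 2 by lra.
rewrite ler_pdivrMr// (le_trans (ler_norm _))// mulrC -ler_pdivrMr ?divr_gt0//.
by rewrite ltW// (lt_le_trans (archi_boundP B0))// ler_nat ltnW.
Qed.

End Halton.

Theorem corollary1 (R : realType) (d : nat) (hd : (1 <= d)%N)
    (f : d.-tuple (measurableTypeR R) -> R)
    (hf : f \_ (unit_cube d) \in Lfun (lebesgue_cube R d) 2%:E)
    (dO : measure_display) (Om : measurableType dO) (P : probability Om R)
    (x : nat -> Om -> d.-tuple R)
    (hx : nested_uniform_halton P x \/ linear_shift_halton P x) :
  (fun n : nat =>
    (n%:R)%:E * 'V_P[(fun w : Om => n%:R^-1 * \sum_(i < n) f (x i w))%R])%E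
  @ \oo --> 0%E.
Proof.
have [X [lawX Ex]] : exists X, halton_pair_law P X /\ forall i w, x i w = halton_points X i w.
  case: hx => [[pi Hpi Ex]|[L [c [HLc Ex]]]].
    by exists (fun i j l w => pi j (mkseq (digit j i) l) w (digit j i l) : nat);
      split; [exact: nested_pair_law|].
  by eexists; split; [exact: linear_pair_law HLc|].
have mf : measurable_fun setT (f \_ (unit_cube d)).
  by have := sub_Lfun_mfun hf; rewrite inE.
have foo : (\int[lebesgue_cube R d]_y ((f \_ (unit_cube d)) y ^+ 2)%:E < +oo)%E.
  have /integrableP[_] := Lfun2_integrable_sqr hf.
  by under eq_integral => y _ do rewrite /= ger0_norm ?sqr_ge0//.
(* The hypothesis controls [f] only on the cube; the points never leave it, so [f] may be replaced
   by its extension by 0. *)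
suff -> : (fun n : nat => n%:R%:E * 'V_P[(fun w : Om => n%:R^-1 * \sum_(i < n) f (x i w))%R])%E =
    (fun n : nat => n%:R%:E * 'V_P[(fun w : Om =>
       n%:R^-1 * \sum_(i < n) (f \_ (unit_cube d)) (halton_points X i w))%R])%E.
  exact: variance_halton_cvg.
apply/funext => n; congr (_ * variance P _)%E; apply/funext => w; congr (_ * _).
apply: eq_bigr => i _; rewrite Ex patchE mem_set//.
exact: (halton_points_unit_cube lawX).
Qed.
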